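(* Let $S=\mathrm{Spec}(K)$ be the spectrum of a field and let $G/S$ be an affine group scheme of finite type. Then $G$ is locally trigonalizable if it is of one of the following types: (a) commutative; (b) smooth, solvable, and connected.
   Context: A relatively affine group scheme $G/S$ is trigonalizable if there is a $G$-equivariant vector bundle $\mathcal{E}$ on $S$ (with $G$ acting trivially on $S$) which is faithful (for every geometric point $\bar s$ of $S$, the representation $G_{\bar s}\to GL(\mathcal{E}(\bar s))$ is a monomorphism) and which has a $G$-stable filtration $0=\mathcal{E}^n\subset \mathcal{E}^{n-1}\subset\cdots\subset\mathcal{E}^0=\mathcal{E}$ with each $\mathcal{E}^i/\mathcal{E}^{i+1}$ a line bundle. $G/S$ is locally trigonalizable if there is a finite locally free surjection $S'\to S$ such that $G\times_S S'$ is trigonalizable over $S'$. *)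

(* Defs.v *)
From HB Require Import structures.
From mathcomp Require Import all_boot all_order all_algebra ring_quotient.
From mathcomp Require Import mpoly.

Set Implicit Arguments.
Unset Strict Implicit.
Unset Printing Implicit Defensive.

Import GRing.Theory.
Local Open Scope ring_scope.

(* An affine scheme over Spec k is a ring with a structure morphism from k.   *)
(* Structure morphisms are kept explicit (rather than using comAlgType) so    *)
(* that restriction of scalars is composition.  Rings are nontrivial: the     *)
(* omitted test object Spec 0 is empty, and every scheme has exactly one      *)
(* point on it.                                                               *)
Record alg (k : comNzRingType) : Type := Alg {
  alg_ring :> comNzRingType;
  str : {rmorphism k -> alg_ring} }.

Record algHom (k : comNzRingType) (R R' : alg k) : Type := AlgHom {
  alg_hom :> {rmorphism R -> R'};
  alg_homE : forall c : k, alg_hom (str R c) = str R' c }.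

Definition restr (k B : comNzRingType) (f : {rmorphism k -> B}) (R : alg B) :
  alg k := Alg (str R \o f).

Definition restrHom (k B : comNzRingType) (f : {rmorphism k -> B})
    (R R' : alg B) (u : algHom R R') : algHom (restr f R) (restr f R') :=
  @AlgHom k (restr f R) (restr f R') u (fun c => alg_homE u (f c)).

(* A k-algebra seen as a k-module. *)
Definition restr_mod (k : comNzRingType) (B : alg k) : Type := B.

Section RestrMod.
Variables (k : comNzRingType) (B : alg k).
HB.instance Definition _ := GRing.Zmodule.on (restr_mod B).

Let scale (c : k) (x : restr_mod B) : restr_mod B := str B c * (x : B).

Fact restr_scalerA a b x : scale a (scale b x) = scale (a * b) x.
Proof. by rewrite /scale rmorphM mulrA. Qed.
Fact restr_scale1r : left_id 1 scale.
Proof. by move=> x; rewrite /scale rmorph1 mul1r. Qed.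
Fact restr_scalerDr : right_distributive scale +%R.
Proof. by move=> a x y; rewrite /scale mulrDr. Qed.
Fact restr_scalerDl x : {morph scale^~ x : a b / a + b}.
Proof. by move=> a b; rewrite /scale rmorphD mulrDl. Qed.

HB.instance Definition _ := GRing.Zmodule_isLmodule.Build k (restr_mod B)
  restr_scalerA restr_scale1r restr_scalerDr restr_scalerDl.
End RestrMod.

(* ** Spec and its Zariski topology *)

Definition prime_ideal (A : comNzRingType) (p : {pred A}) : Prop :=
  idealr_closed p /\ prime_idealr_closed p.

Definition in_V (A : comNzRingType) (I p : {pred A}) : Prop :=
  {subset I <= p}.

(* Spec A is nonempty since A is nontrivial. *)
Definition connected_spec (A : comNzRingType) : Prop :=
  forall I J : {pred A},
    (forall p, prime_ideal p -> in_V I p \/ in_V J p) ->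
    (forall p, prime_ideal p -> ~ (in_V I p /\ in_V J p)) ->
    (forall p, prime_ideal p -> in_V I p) \/
    (forall p, prime_ideal p -> in_V J p).

Definition spec_surjective (k : comNzRingType) (B : alg k) : Prop :=
  forall p : {pred k}, prime_ideal p ->
    exists2 q : {pred B}, prime_ideal q &
      forall c : k, (str B c \in q) = (c \in p).

(* ** Modules, base change and vector bundles on affine schemes *)

(* i exhibits M as the tensor product of E with R over k. *)
Definition is_base_change (k : comNzRingType) (R : alg k) (E : lmodType k)
    (M : lmodType R) (i : {linear E -> M | str R \; *:%R}) : Prop :=
  forall (N : lmodType R) (f : {linear E -> N | str R \; *:%R}),
    exists g : {linear M -> N},
      (forall x, g (i x) = f x) /\
      forall g' : {linear M -> N}, (forall x, g' (i x) = f x) -> g' =1 g.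

(* E is free of rank n over the basic open D(f); the R below are the          *)
(* k-algebras whose structure morphism factors through k[1/f].                *)
Definition free_over_basic_open (k : comNzRingType) (E : lmodType k) (f : k)
    (n : nat) : Prop :=
  forall R : alg k, (exists v : R, str R f * v = 1) ->
    exists i : {linear E -> 'rV[R]_n | str R \; *:%R}, is_base_change i.

Definition locally_free (k : comNzRingType) (E : lmodType k) (r : pred nat) :
  Prop :=
  exists (m : nat) (f c : 'I_m -> k) (n : 'I_m -> nat),
    \sum_j c j * f j = 1 /\
    forall j, r (n j) /\ free_over_basic_open E (f j) (n j).

Definition vector_bundle (k : comNzRingType) (E : lmodType k) : Prop :=
  locally_free E predT.

Definition line_bundle (k : comNzRingType) (E : lmodType k) : Prop :=
  locally_free E (pred1 1%N).

(* A choice of all the pullbacks of E to affine k-schemes. *)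
Record pullbacks (k : comNzRingType) (E : lmodType k) : Type := Pullbacks {
  pull :> forall R : alg k, lmodType R;
  pull_in : forall R : alg k, {linear E -> pull R | str R \; *:%R};
  pull_univ : forall R : alg k, is_base_change (pull_in R);
  pull_map : forall (R R' : alg k) (u : algHom R R'),
    {linear pull R -> pull R' | u \; *:%R};
  pull_mapE : forall (R R' : alg k) (u : algHom R R') (x : E),
    pull_map u (pull_in R x) = pull_in R' x }.

(* ** Group schemes *)

Record grpFunctor (k : comNzRingType) : Type := GrpFunctor {
  pts :> alg k -> groupType;
  fmap : forall R R' : alg k, algHom R R' -> {multiplicative pts R -> pts R'};
  fmap_id : forall (R : alg k) (u : algHom R R), u =1 id -> fmap u =1 id;
  fmap_comp : forall (R R' R'' : alg k) (u : algHom R R') (v : algHom R' R'')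
    (w : algHom R R''), w =1 v \o u -> fmap w =1 fmap v \o fmap u }.

(* A group functor represented by an affine k-scheme Spec (coord_ring G). *)
Record affGrp (k : comNzRingType) : Type := AffGrp {
  grp_functor :> grpFunctor k;
  coord_ring : alg k;
  ev : forall R : alg k, grp_functor R -> algHom coord_ring R;
  ev_inj : forall (R : alg k) (g h : grp_functor R), ev g =1 ev h -> g = h;
  ev_surj : forall (R : alg k) (f : algHom coord_ring R),
    exists g : grp_functor R, ev g =1 f;
  ev_nat : forall (R R' : alg k) (u : algHom R R') (g : grp_functor R),
    ev (fmap grp_functor u g) =1 u \o ev g }.

(* The base change of G along Spec B -> Spec k, as a functor on B-algebras;   *)
(* if G is represented by A, it is represented by the tensor product of A     *)
(* and B over k.                                                              *)
Definition base_change (k : comNzRingType) (G : grpFunctor k) (B : alg k) :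
  grpFunctor B :=
  @GrpFunctor B (fun R => G (restr (str B) R))
    (fun R R' u => fmap G (restrHom (str B) u))
    (fun R u => @fmap_id k G _ (restrHom (str B) u))
    (fun R R' R'' u v w => @fmap_comp k G _ _ _ (restrHom (str B) u)
       (restrHom (str B) v) (restrHom (str B) w)).

Definition finite_type (k : comNzRingType) (A : alg k) : Prop :=
  exists (n : nat) (x : 'I_n -> A),
    forall a : A, exists p : {mpoly k[n]}, mmap (str A) x p = a.

Definition finite_presentation (k : comNzRingType) (A : alg k) : Prop :=
  exists (n : nat) (x : 'I_n -> A) (m : nat) (q : 'I_m -> {mpoly k[n]}),
    (forall a : A, exists p : {mpoly k[n]}, mmap (str A) x p = a) /\
    (forall p : {mpoly k[n]}, mmap (str A) x p = 0 <->
       exists c : 'I_m -> {mpoly k[n]}, p = \sum_j c j * q j).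

(* Infinitesimal lifting along R -> R/I with I ^ 2 = 0. *)
Definition formally_smooth (k : comNzRingType) (A : alg k) : Prop :=
  forall (R R' : alg k) (u : algHom R R'),
    (forall y : R', exists x : R, u x = y) ->
    (forall x y : R, u x = 0 -> u y = 0 -> x * y = 0) ->
    forall f : algHom A R', exists f' : algHom A R, u \o f' =1 f.

Definition smooth (k : comNzRingType) (A : alg k) : Prop :=
  finite_presentation A /\ formally_smooth A.

Definition commutative_grp (k : comNzRingType) (G : grpFunctor k) : Prop :=
  forall (R : alg k) (g h : G R), commute g h.

Definition closed_subgroup (k : comNzRingType) (G : affGrp k)
    (H : forall R : alg k, G R -> Prop) : Prop :=
  (exists I : coord_ring G -> Prop, forall (R : alg k) (g : G R),
     H R g <-> forall a, I a -> ev g a = 0) /\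
  (forall R : alg k, H R 1%g /\ forall g h : G R, H R g -> H R h ->
     H R (g * h^-1)%g).

(* G = H_0, H_1, ..., H_n = 1 is a descending chain of closed subgroup        *)
(* schemes; the commutator condition says both that H_(i+1) is normal in H_i  *)
(* and that H_i / H_(i+1) is commutative.                                     *)
Definition solvable_grp (k : comNzRingType) (G : affGrp k) : Prop :=
  exists (n : nat) (H : nat -> forall R : alg k, G R -> Prop),
    [/\ forall i, (i <= n)%N -> closed_subgroup (H i),
        forall (R : alg k) (g : G R), H 0%N R g,
        forall (R : alg k) (g : G R), H n R g -> g = 1%g,
        forall i, (i < n)%N -> forall (R : alg k) (g : G R),
          H i.+1 R g -> H i R g &
        forall i, (i < n)%N -> forall (R : alg k) (g h : G R),
          H i R g -> H i R h -> H i.+1 R [~ g, h]%g].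

(* ** Equivariant vector bundles and trigonalizability *)

(* A G-equivariant structure on E, where G acts trivially on Spec k: an       *)
(* R-linear action of G(R) on the pullback of E to R, functorial in R.        *)
Record equivariant (k : comNzRingType) (G : grpFunctor k) (E : lmodType k) :
  Type := Equivariant {
  fib :> pullbacks E;
  rep_act : forall R : alg k, G R -> {linear fib R -> fib R};
  rep_act1 : forall R : alg k, rep_act (1%g : G R) =1 id;
  rep_actM : forall (R : alg k) (g h : G R),
    rep_act (g * h)%g =1 rep_act g \o rep_act h;
  rep_act_nat : forall (R R' : alg k) (u : algHom R R') (g : G R) (x : fib R),
    rep_act (fmap G u g) (pull_map fib u x) = pull_map fib u (rep_act g x) }.

(* For a geometric point s : Spec W -> Spec k, the fibre E(s) pulls back to a *)
(* W-algebra R as E pulls back to R viewed as a k-algebra, so that            *)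
(* G_s -> GL(E(s)) is given on R-valued points by the action on fib (restr    *)
(* s R).                                                                      *)
Definition faithful (k : comNzRingType) (G : grpFunctor k) (E : lmodType k)
    (rho : equivariant G E) : Prop :=
  forall (W : closedFieldType) (s : {rmorphism k -> W}) (R : alg W)
    (g h : G (restr s R)), rep_act rho g =1 rep_act rho h -> g = h.

(* The image of F in each pullback of E generates a G-stable submodule. *)
Definition rep_stable (k : comNzRingType) (G : grpFunctor k) (E : lmodType k)
    (rho : equivariant G E) (F : {pred E}) : Prop :=
  forall (R : alg k) (g : G R) (x : E), x \in F ->
    exists (m : nat) (c : 'I_m -> R) (y : 'I_m -> E),
      (forall j, y j \in F) /\
      rep_act rho g (pull_in rho R x) = \sum_j c j *: pull_in rho R (y j).

(* q, restricted to F, exhibits L as the quotient F / F'. *)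
Definition is_quotient (k : comNzRingType) (E L : lmodType k)
    (F F' : {pred E}) (q : E -> L) : Prop :=
  [/\ forall a, {in F &, forall x y, q (a *: x + y) = a *: q x + q y},
      {in F, forall x, (q x == 0) = (x \in F')} &
      forall z, exists2 x, x \in F & q x = z].

Definition trigonalizable (k : comNzRingType) (G : grpFunctor k) : Prop :=
  exists (E : lmodType k) (rho : equivariant G E) (n : nat)
      (F : nat -> {pred E}),
    [/\ vector_bundle E, faithful rho,
        (F 0%N =i predT) /\ (F n =i pred1 0),
        forall i, (i <= n)%N ->
          GRing.submod_closed (F i) /\ rep_stable rho (F i) &
        forall i, (i < n)%N -> {subset F i.+1 <= F i} /\
          exists (L : lmodType k) (q : E -> L),
            line_bundle L /\ is_quotient (F i) (F i.+1) q].

(* A finite morphism is affine, so a finite locally free cover of Spec k is   *)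
(* of the form Spec B with B a locally free k-module of finite rank.          *)
Definition locally_trigonalizable (k : comNzRingType) (G : grpFunctor k) :
  Prop :=
  exists B : alg k,
    [/\ vector_bundle (restr_mod B), spec_surjective B &
        trigonalizable (base_change G B)].

(* Main.v *)
(** A faithful representation of G is found in the regular representation; it is
    given by constant matrices M_k and linearly independent functions c_k on G,
    [rho g = sum_k c_k(g) M_k].  So it is enough to triangularize the M_k over a
    finite extension, and by induction on the dimension to find one stable line.
    If G is commutative the M_k commute, by independence of the c_k.

    If G is smooth and connected, let m be the ideal of the identity.  By Krull's
    theorem and a translation argument the intersection of the powers of m is
    generated by an idempotent, hence is 0; and smoothness lifts a generic tangent
    vector to a homomorphism from the coordinate ring to K[lambda][[s]] whose
    kernel is that intersection.  This is a schematically dense formal point of G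
    over a domain, congruent to 1 modulo s.

    The Lie-Kolchin argument then works with formal points congruent to 1 over
    iterated polynomial and power series rings, which are domains.  On a
    representation that stays irreducible over finite extensions, suppose that
    the (i+1)-st iterated commutators of such points commute with each other.
    The coefficients of their matrices form a commuting family; a common
    eigenspace, over a finite extension, is stable under G because eigenvalues
    are algebraic over the constants, hence constant along the formal point.  So
    these commutators are scalars of determinant 1, congruent to 1 modulo s, i.e.
    trivial, and the i-th iterated commutators commute. *)

Require Import Defs.
From HB Require Import structures.
From mathcomp Require Import all_boot all_order all_algebra ring_quotient.
From mathcomp Require Import mpoly.
From mathcomp Require Import ring.
From mathcomp Require Import boolp.
From mathcomp Require classical_sets.
Set Implicit Arguments.
Unset Strict Implicit.
Unset Printing Implicit Defensive.
Import GRing.Theory.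
Local Open Scope ring_scope.

(** * Ideals and linear functionals *)

(** The field may be finite and nilpotents matter, so identities between matrices cannot be tested
    on rational points of G. Universal points over tensor products, or a formal point on which no
    nonzero function vanishes, take their place. The formal point is asked to live over a domain and
    to reduce to 1 for one reason: an element of the domain that is algebraic over the constants
    must equal its own reduction. This is the form in which connectedness enters: eigenvalues cannot
    move and nontrivial roots of unity cannot occur. Eigenvalues exist only after a finite
    extension, so the ring has to stay a domain and the point has to stay dense over every
    extension; hence functorial families of rings instead of a single ring. The indeterminates
    lambda are the coordinates of the tangent vector. A fixed tangent vector would lose functions of
    order k whose leading form vanishes on it; with lambda generic, the coefficient of s^k is the
    whole leading form. *)

Lemma zorn_above (T : Type) (P : (T -> Prop) -> Prop) (A0 : T -> Prop) :
    P A0 ->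
    (forall F : (T -> Prop) -> Prop, (exists X, F X) ->
      (forall X, F X -> P X) ->
      (forall X Y, F X -> F Y ->
        (forall x, X x -> Y x) \/ (forall x, Y x -> X x)) ->
      P (fun x => exists2 X, F X & X x)) ->
  exists A, [/\ P A, forall x, A0 x -> A x &
    forall B, P B -> (forall x, A x -> B x) -> forall x, B x -> A x].
Proof.
(* Adjoining [A0] to every set turns the union of the empty chain into [A0], so [chainP] is applied
   to nonempty chains only and the maximal set lies above [A0]. *)
move=> PA0 chainP; pose U (X : T -> Prop) := fun x => X x \/ A0 x.
have [F FP Ftot|A [PA maxA]] :=
  @classical_sets.Zorn_bigcup T (fun X => P (U X)).
  have -> : U (classical_sets.bigcup F id) =
      fun x => exists2 X, (X = A0 \/ exists2 Y, F Y & X = U Y) & X x.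
    apply: funext => x; apply: propext; split.
      case=> [[X FX Xx]|A0x]; last by exists A0; [left|].
      by exists (U X); [right; exists X|left].
    case=> X [->|[Y FY ->]]; first by right.
    by case=> ?; [left; exists Y|right].
  apply: chainP; first by exists A0; left.
    by move=> X [->//|[Y FY ->]]; apply: FP.
  move=> X Y [->|[X' FX ->]] [->|[Y' FY ->]]; [by left|by left; right| |].
    by right; right.
  by case: (Ftot X' Y' FX FY) => h; [left|right] => x [/h|]; [left|right|left|right].
exists (U A); split=> // [x|B PB AB x Bx]; first by right.
apply: contrapT => nAx; apply: (maxA B); last first.
  suff -> : U B = B by [].
  by apply: funext => y; apply: propext; split=> [[//|A0y]|]; [apply: AB; right|left].
by split=> [y Ay|BA]; [apply: AB; left|apply: nAx; left; apply: BA].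
Qed.

Section Ideals.
Variable R : comNzRingType.

Definition ideal_pred (I : R -> Prop) :=
  I 0 /\ forall a x y, I x -> I y -> I (a * x + y).

Section Closure.
Variables (I : R -> Prop) (hI : ideal_pred I).

Lemma ideal0 : I 0. Proof. by case: hI. Qed.

Lemma idealD x y : I x -> I y -> I (x + y).
Proof. by case: hI => _ h Ix Iy; rewrite -[x]mul1r; apply: h. Qed.

Lemma ideal_mull a x : I x -> I (a * x).
Proof. by case: hI => h0 h Ix; rewrite -[_ * x]addr0; apply: h. Qed.

Lemma ideal_mulr a x : I x -> I (x * a).
Proof. by rewrite mulrC; apply: ideal_mull. Qed.

Lemma idealN x : I x -> I (- x).
Proof. by rewrite -mulN1r; apply: ideal_mull. Qed.

Lemma idealB x y : I x -> I y -> I (x - y).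
Proof. by move=> Ix Iy; apply/idealD/idealN. Qed.

Lemma ideal_sum (J : Type) (s : seq J) (Q : pred J) (f : J -> R) :
  (forall j, Q j -> I (f j)) -> I (\sum_(j <- s | Q j) f j).
Proof.
by move=> If; elim/big_ind: _ => //; [apply: ideal0 | apply: idealD].
Qed.
End Closure.

Lemma quotient_ring (I : R -> Prop) : ideal_pred I -> ~ I 1 ->
  exists (Q : comNzRingType) (p : {rmorphism R -> Q}),
    (forall y, exists x, p x = y) /\ (forall x, p x = 0 <-> I x).
Proof.
move=> hI nI1; pose S : {pred R} := fun x => `[< I x >].
have inS x : (x \in S) = `[< I x >] by [].
have hS : idealr_closed S.
  split; rewrite ?inS; first by apply/asboolP; case: hI.
    by apply/negP => /asboolP.
  move=> a x y; rewrite !inS => /asboolP Ix /asboolP Iy.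
  by apply/asboolP; case: hI => _; apply.
pose S2 : idealr R := HB.pack S
  (GRing.isZmodClosed.Build R S (idealr_closedB hS))
  (isProperIdeal.Build R S (idealr_closed_nontrivial hS)).
exists {ideal_quot S2}, \pi_({ideal_quot S2})%qT; split=> [y|x].
  by exists (repr (y : {ideal_quot S2})); apply: reprK.
have -> : I x <-> x \in S2.
  by rewrite [_ \in _]inS; split=> [h|/asboolP//]; apply/asboolP.
rewrite -{2}[x]subr0 Quotient.idealrBE -(rmorph0 \pi_({ideal_quot S2})%qT).
by split=> [->|/eqP].
Qed.

Lemma maximal_ideal_above (I : R -> Prop) : ideal_pred I -> ~ I 1 ->
  exists J : R -> Prop, [/\ ideal_pred J, ~ J 1, forall x, I x -> J x &
    forall x, ~ J x -> exists a, J (1 - a * x)].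
Proof.
move=> hI nI1.
have [//|F [X0 FX0] FP Ftot|A [[hA nA1] IA maxA]] :=
  @zorn_above R (fun X => ideal_pred X /\ ~ X 1) I.
  split; last by case=> X /FP[].
  split=> [|a x y [X FX Xx] [Y FY Yy]].
    by exists X0 => //; case: (FP X0 FX0) => hX _; apply: ideal0 hX.
  have [[_ hX] _] := FP X FX; have [[_ hY] _] := FP Y FY.
  case: (Ftot X Y FX FY) => h; first by exists Y => //; apply: hY (h _ Xx) Yy.
  by exists X => //; apply: hX Xx (h _ Yy).
exists A; split=> // x nAx; apply: contrapT => nex; apply: nAx.
pose B y := exists a, A (y - a * x).
apply: (maxA B); last by exists 1; rewrite mul1r subrr; apply: ideal0 hA.
  split; last by case=> a h; apply: nex; exists a.
  split=> [|a y z [b hb] [c hc]]; first by exists 0; rewrite mul0r subr0; apply: ideal0 hA.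
  exists (a * b + c); have [_ h] := hA.
  have -> : a * y + z - (a * b + c) * x = a * (y - b * x) + (z - c * x).
    by rewrite mulrBr mulrA mulrDl opprD addrACA.
  exact: h.
by move=> y Ay; exists 0; rewrite mul0r subr0.
Qed.
End Ideals.

Definition functional (k : comNzRingType) (A : alg k) (phi : A -> k) :=
  forall c x y, phi (str A c * x + y) = c * phi x + phi y.

Definition subspace (k : comNzRingType) (A : alg k) (W : A -> Prop) :=
  W 0 /\ forall c x y, W x -> W y -> W (str A c * x + y).

Section Functional.
Variables (k : comNzRingType) (A : alg k) (phi : A -> k).
Hypothesis hphi : functional phi.

Lemma fnlD : {morph phi : x y / x + y}.
Proof. by move=> x y; have := hphi 1 x y; rewrite rmorph1 !mul1r. Qed.

Lemma fnl0 : phi 0 = 0.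
Proof. by apply: (addrI (phi 0)); rewrite -fnlD !addr0. Qed.

Lemma fnlZ c x : phi (str A c * x) = c * phi x.
Proof. by have := hphi c x 0; rewrite fnl0 !addr0. Qed.

Lemma fnlN : {morph phi : x / - x}.
Proof. by move=> x; rewrite -mulN1r -(rmorphN1 (str A)) fnlZ mulN1r. Qed.

Lemma fnlB : {morph phi : x y / x - y}.
Proof. by move=> x y; rewrite fnlD fnlN. Qed.

Lemma fnl_sum (J : Type) (s : seq J) (P : pred J) (f : J -> A) :
  phi (\sum_(j <- s | P j) f j) = \sum_(j <- s | P j) phi (f j).
Proof. exact: (big_morph phi fnlD fnl0). Qed.
End Functional.

Section Subspace.
Variables (k : comNzRingType) (A : alg k) (W : A -> Prop) (hW : subspace W).

Lemma subspD x y : W x -> W y -> W (x + y).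
Proof. by case: hW => _ /(_ 1 x y); rewrite rmorph1 mul1r. Qed.

Lemma subspZ c x : W x -> W (str A c * x).
Proof. by case: hW => h0 /(_ c x 0) h Wx; rewrite -[_ * _]addr0; apply: h. Qed.

Lemma subspN x : W x -> W (- x).
Proof. by rewrite -mulN1r -(rmorphN1 (str A)); apply: subspZ. Qed.

Lemma subspB x y : W x -> W y -> W (x - y).
Proof. by move=> Wx /subspN; apply: subspD. Qed.

Lemma subsp_sum (J : Type) (s : seq J) (P : pred J) (f : J -> A) :
  (forall j, P j -> W (f j)) -> W (\sum_(j <- s | P j) f j).
Proof. by move=> Wf; elim/big_ind: _ => //; [case: hW | apply: subspD]. Qed.
End Subspace.

Lemma subspace_eq0 (k : comNzRingType) (A : alg k) : subspace (fun x : A => x = 0).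
Proof. by split=> // c x y -> ->; rewrite mulr0 addr0. Qed.

Lemma ideal_subspace (k : comNzRingType) (A : alg k) (I : A -> Prop) :
  ideal_pred I -> subspace I.
Proof. by case=> h0 h; split=> // c x y; apply: h. Qed.

Section Separation.
Variables (K : fieldType) (A : alg K).

(** A subspace containing [W] and maximal among those avoiding [v] is a complement of the line
    through [v]; [phi] is the coordinate along [v]. *)
Lemma functional_separation (W : A -> Prop) (v : A) : subspace W -> ~ W v ->
  exists phi : A -> K,
    [/\ functional phi, forall w, W w -> phi w = 0 & phi v = 1].
Proof.
move=> hW nWv.
have [//|F [X0 FX0] FP Ftot|U [[hU nUv] WU maxU]] :=
  @zorn_above A (fun X => subspace X /\ ~ X v) W.
  split; last by case=> X /FP[].
  split=> [|c x y [X FX Xx] [Y FY Yy]].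
    by exists X0 => //; case: (FP X0 FX0) => -[].
  have [[_ hX] _] := FP X FX; have [[_ hY] _] := FP Y FY.
  case: (Ftot X Y FX FY) => h; first by exists Y => //; apply: hY (h _ Xx) Yy.
  by exists X => //; apply: hX Xx (h _ Yy).
have dec x : exists c, U (x - str A c * v).
  have [Ux|nUx] := pselect (U x); first by exists 0; rewrite rmorph0 mul0r subr0.
  have [c Uc] : exists c, U (v - str A c * x).
    apply: contrapT => nex; apply: nUx.
    apply: (maxU (fun y => exists c, U (y - str A c * x))).
    - split; last by case=> c h; apply: nex; exists c.
      split=> [|a y z [b hb] [c hc]].
        by exists 0; rewrite rmorph0 mul0r subr0; case: hU.
      exists (a * b + c); rewrite rmorphD rmorphM mulrDl opprD addrACA -mulrA.
      by rewrite -mulrBr; case: hU => _; apply.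
    - by move=> y Uy; exists 0; rewrite rmorph0 mul0r subr0.
    - by exists 1; rewrite rmorph1 mul1r subrr; case: hU.
  have c0 : c != 0.
    by apply/eqP => c0; apply: nUv; move: Uc; rewrite c0 rmorph0 mul0r subr0.
  exists c^-1; have := subspN hU (subspZ hU c^-1 Uc).
  by rewrite mulrBr mulrA -rmorphM mulVf // rmorph1 mul1r opprB.
have [phi hphi] := choice dec.
have uniq x c : U (x - str A c * v) -> phi x = c.
  move=> hc; apply/eqP/contraT; rewrite -subr_eq0 => d0; case: nUv.
  have := subspZ hU (phi x - c)^-1 (subspB hU hc (hphi x)).
  have -> a b : x - a - (x - b) = b - a by rewrite opprB addrC addrA subrK.
  rewrite -mulrBl -rmorphB mulrA -rmorphM.
  by rewrite mulVf // rmorph1 mul1r.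
exists phi; split=> [c x y|w Ww|].
- apply: uniq; rewrite rmorphD rmorphM mulrDl opprD addrACA -mulrA -mulrBr.
  by case: hU => _; apply.
- by apply: uniq; rewrite rmorph0 mul0r subr0; apply: WU.
- by apply: uniq; rewrite rmorph1 mul1r subrr; case: hU.
Qed.

Lemma functionals_sep0 (x : A) :
  (forall phi : A -> K, functional phi -> phi x = 0) -> x = 0.
Proof.
move=> h; apply: contrapT => x0.
have [phi [hphi _ px]] := functional_separation (@subspace_eq0 K A) x0.
by move: (oner_eq0 K); rewrite -px h // eqxx.
Qed.

(** The [y i] lift a basis of the span of [s] modulo [W]. Their dual functionals are defined on all
    of [A], because they will be applied to one factor of a tensor product. *)
Lemma dual_family (W : A -> Prop) (s : seq A) : subspace W ->
  exists (d : nat) (y : nat -> A) (phi : nat -> A -> K),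
    [/\ forall i, functional (phi i), forall i w, W w -> phi i w = 0,
        forall i j, (i < d)%N -> (j < d)%N -> phi i (y j) = (i == j)%:R,
        forall U, subspace U -> (forall x, x \in s -> U x) ->
          forall i, (i < d)%N -> U (y i) &
        forall x, x \in s -> W (x - \sum_(i < d) str A (phi i x) * y i)].
Proof.
move=> hW; elim: s => [|x s [d [y [phi [fphi Wphi dual span ex]]]]].
  exists 0%N, (fun=> 0), (fun _ _ => 0); split=> // _ c _ _.
  by rewrite mulr0 addr0.
pose pr z := z - \sum_(i < d) str A (phi i z) * y i.
have prlin c u v : pr (str A c * u + v) = str A c * pr u + pr v.
  rewrite /pr mulrBr -addrACA -opprD mulr_sumr -big_split /=; congr (_ - _).
  by apply: eq_bigr => i _; rewrite fphi rmorphD rmorphM mulrDl mulrA.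
have phi_pr i z : (i < d)%N -> phi i (pr z) = 0.
  move=> id; rewrite fnlB // fnl_sum // (bigD1 (Ordinal id)) //= fnlZ //.
  rewrite dual // eqxx mulr1 big1 ?addr0 ?subrr // => j ij.
  by rewrite fnlZ // dual // eq_sym (negPf ij : (j == i :> nat) = false) mulr0.
have [Wx|nWx] := pselect (W (pr x)).
  exists d, y, phi; split=> // [U hU sU i id|z].
    by apply: span => // z zs; apply: sU; rewrite inE zs orbT.
  by rewrite inE => /orP[/eqP->|/ex].
have pr_pr z : pr (pr z) = pr z.
  by rewrite {1}/pr big1 ?subr0 // => i _; rewrite phi_pr // rmorph0 mul0r.
(* This subspace is [W] plus the span of the [y i]. A functional that kills it and is 1 at [pr x]
   extends the dual family by [pr x]. *)
have hWp : subspace (fun z => W (pr z)).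
  split=> [|c u v Wu Wv]; last by rewrite prlin; case: hW => _; apply.
  rewrite /pr big1 ?subr0; first by case: hW.
  by move=> i _; rewrite fnl0 // rmorph0 mul0r.
have [|psi [fpsi Wpsi psix]] := functional_separation hWp (v := pr x).
  by rewrite pr_pr.
exists d.+1, (fun i => if i == d then pr x else y i),
  (fun i => if i == d then psi else phi i); split.
- by move=> i; case: ifP.
- move=> i w Ww; case: ifP => _; last exact: Wphi.
  apply: Wpsi; rewrite /pr big1 ?subr0 // => j _.
  by rewrite Wphi // rmorph0 mul0r.
- move=> i j; rewrite (ltnS i) (ltnS j) (leq_eqVlt i) (leq_eqVlt j).
  case/predU1P=> [->|id]; case/predU1P=> [->|jd].
  + by rewrite !eqxx.
  + rewrite eqxx (ltn_eqF jd) [RHS](_ : _ = 0); last by rewrite gtn_eqF.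
    apply: Wpsi; rewrite /pr (bigD1 (Ordinal jd)) //= dual // eqxx rmorph1 mul1r.
    rewrite big1 ?addr0 ?subrr; first by case: hW.
    by move=> l lj; rewrite dual // (negPf lj : (l == j :> nat) = false) rmorph0 mul0r.
  + by rewrite eqxx (ltn_eqF id) phi_pr.
  + by rewrite (ltn_eqF id) (ltn_eqF jd); apply: dual.
- move=> U hU sU i; rewrite (ltnS i) (leq_eqVlt i); case: eqVneq => [_ _|_ /= id].
    apply: subspB => //; first by apply: sU; rewrite inE eqxx.
    apply: subsp_sum => // j _; apply: subspZ => //; apply: span => // z zs.
    by apply: sU; rewrite inE zs orbT.
  by apply: span => // z zs; apply: sU; rewrite inE zs orbT.
- have sumE z : z - \sum_(i < d.+1) str A
      ((if (i : nat) == d then psi else phi i) z) *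
      (if (i : nat) == d then pr x else y i) = pr z - str A (psi z) * pr x.
    rewrite big_ord_recr /= eqxx opprD addrA; congr (z - _ - _).
    by apply: eq_bigr => i _; rewrite ltn_eqF.
  move=> z; rewrite sumE inE => /orP[/eqP->|zs].
    have -> : psi x = 1.
      have: psi (x - pr x) = 0; last by rewrite fnlB // psix => /eqP; rewrite subr_eq0 => /eqP.
      apply: Wpsi; have := prlin (-1) (pr x) x.
      rewrite rmorphN1 !mulN1r addrC => ->; rewrite pr_pr addNr.
      by case: hW.
    by rewrite rmorph1 mul1r subrr; case: hW.
  have -> : psi z = 0 by apply: Wpsi; apply: ex.
  by rewrite rmorph0 mul0r subr0; apply: ex.
Qed.

Lemma finite_dual_family (s : seq A) :
  exists (d : nat) (y : nat -> A) (phi : nat -> A -> K),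
    [/\ forall i, functional (phi i),
        forall i j, (i < d)%N -> (j < d)%N -> phi i (y j) = (i == j)%:R,
        forall U, subspace U -> (forall x, x \in s -> U x) ->
          forall i, (i < d)%N -> U (y i) &
        forall x, x \in s -> x = \sum_(i < d) str A (phi i x) * y i].
Proof.
have [d [y [phi [fphi _ dual span ex]]]] := dual_family s (@subspace_eq0 K A).
by exists d, y, phi; split=> // x /ex /eqP; rewrite subr_eq0 => /eqP.
Qed.
End Separation.

(** * Tensor products *)

Definition mk_rmorphism (R S : nzRingType) (f : R -> S)
    (fB : {morph f : x y / x - y}) (fM : {morph f : x y / x * y})
    (f1 : f 1 = 1) : {rmorphism R -> S} :=
  HB.pack f (GRing.isZmodMorphism.Build R S f fB)
    (GRing.isMonoidMorphism.Build R S f (f1, fM)).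

Definition mk_additive (R S : zmodType) (f : R -> S)
    (fB : {morph f : x y / x - y}) : {additive R -> S} :=
  HB.pack f (GRing.isZmodMorphism.Build R S f fB).

(** Over a field the slices (identity tensor [psi]) detect all linear relations, so together with
    generation by pure tensors they characterize the tensor product; the universal property is
    derived in [tens_univ]. *)
Record tensor (K : fieldType) (A C : alg K) := Tensor {
  tens :> alg K;
  inl_t : algHom A tens;
  inr_t : algHom C tens;
  tens_gen : forall t : tens, exists s : seq (A * C),
    t = \sum_(p <- s) inl_t p.1 * inr_t p.2;
  tens_slice : forall psi : C -> K, functional psi ->
    exists2 sl : tens -> A, {morph sl : x y / x - y} &
      forall a c, sl (inl_t a * inr_t c) = str A (psi c) * a }.

Section TensorExists.
Variables (K : fieldType) (A C : alg K) (n : nat) (x : 'I_n -> A).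
Hypothesis x_gen : forall a : A, exists p : {mpoly K[n]}, mmap (str A) x p = a.
Local Notation MP := {mpoly C[n]}.

(** The polynomial ring over [C] maps onto the tensor product, and this is the slice at that level:
    [psi] on coefficients, evaluation at [x] on monomials. It is additive, not multiplicative. *)
Let sl (psi : C -> K) (P : MP) := mmap (str A \o psi) x P.

Let slB psi : functional psi -> {morph sl psi : P Q / P - Q}.
Proof.
move=> fpsi P Q; pose g : {additive C -> A} := mk_additive (f := str A \o psi)
  (fun u v => etrans (congr1 (str A) (fnlB fpsi u v)) (rmorphB (str A) _ _)).
exact: (mmapB x g P Q).
Qed.

Let sl0 psi : functional psi -> sl psi 0 = 0.
Proof. by move=> fpsi; have := slB fpsi 0 0; rewrite !subrr. Qed.

Let slD psi : functional psi -> {morph sl psi : P Q / P + Q}.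
Proof.
move=> fpsi P Q; rewrite -[Q in P + Q]opprK slB // -[- Q]sub0r slB // sl0 //.
by rewrite sub0r opprK.
Qed.

Let slZX psi c m : functional psi ->
  sl psi (c *: 'X_[m]) = str A (psi c) * mmap1 x m.
Proof.
move=> fpsi; have [->|c0] := eqVneq c 0.
  by rewrite scale0r sl0 // fnl0 // rmorph0 mul0r.
rewrite /sl /mmap msuppMCX //=.
by rewrite big_seq1 mcoeffZ mcoeffX eqxx mulr1.
Qed.

Let slMX psi (m : 'X_{1..n}) P : functional psi ->
  sl psi ('X_[m] * P) = mmap1 x m * sl psi P.
Proof.
move=> fpsi; elim/mpolyind: P => [|c m' P _ _ IH]; first by rewrite mulr0 sl0 ?mulr0.
rewrite mulrDr !slD // IH mulrDr; congr (_ + _).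
rewrite -scalerAr -mpolyXD !slZX // commr_mmap1_M; last by move=> *; apply: mulrC.
by rewrite mulrCA.
Qed.

Let slZ psi c P : functional psi ->
  sl psi (c *: P) = sl (fun d => psi (c * d)) P.
Proof.
move=> fpsi; have fpsi' : functional (fun d => psi (c * d)).
  by move=> d u v; rewrite mulrDr mulrCA fpsi.
elim/mpolyind: P => [|d m P _ _ IH]; first by rewrite scaler0 !sl0.
by rewrite scalerDr !slD // IH scalerA !slZX.
Qed.

(** Functionals on [C] separate points, so being killed by every slice means being zero in the
    tensor product. It is an ideal because [psi] composed with a multiplication of [C] is again a
    functional. *)
Let I (P : MP) := forall psi, functional psi -> sl psi P = 0.

Let hI : ideal_pred I.
Proof.
split=> [psi|Q P P' IP IP' psi fpsi]; first exact: sl0.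
rewrite slD // IP' // addr0.
elim/mpolyind: Q => [|c m Q _ _ IH]; first by rewrite mul0r sl0.
rewrite mulrDl slD // IH addr0 -scalerAl slZ // slMX ?IP ?mulr0 //.
  by move=> d u v; rewrite mulrDr mulrCA fpsi.
by move=> d u v; rewrite mulrDr mulrCA fpsi.
Qed.

Let sl_map psi c p : functional psi ->
  sl psi (c *: map_mpoly (str C) p) = str A (psi c) * mmap (str A) x p.
Proof.
move=> fpsi; elim/mpolyind: p => [|d m p _ _ IH].
  by rewrite !rmorph0 scaler0 sl0 // mulr0.
have -> : map_mpoly (str C) (d *: 'X_[m] + p) = map_mpoly (str C) (d *: 'X_[m]) + map_mpoly (str C) p.
  exact: (rmorphD (map_mpoly (str C))).
rewrite scalerDr slD // IH mmapD mulrDr; congr (_ + _).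
have -> : map_mpoly (str C) (d *: 'X_[m]) = str C d *: 'X_[m].
  by rewrite -(map_mpolyX (str C)); exact: (map_mpolyZ (str C) d 'X_[m]).
rewrite scalerA slZX // (mmapZ x (str A)) mmapX mulrA -rmorphM.
by rewrite (mulrC c) fnlZ // (mulrC d).
Qed.

Lemma tensor_of_generators : inhabited (tensor A C).
Proof.
have nI1 : ~ I 1.
  have [||psi [fpsi _ psi1]] := @functional_separation K C (fun z => z = 0) 1.
  - exact: subspace_eq0.
  - by move/eqP; rewrite oner_eq0.
  move/(_ _ fpsi)/eqP; have -> : 1 = 1 *: map_mpoly (str C) 1 :> MP.
    by rewrite scale1r (rmorph1 (map_mpoly (str C))).
  by rewrite sl_map // psi1 !rmorph1 mul1r oner_eq0.
have [Q [pr [pr_surj pr0]]] := quotient_ring hI nI1.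
have [lft lftP] := choice x_gen.
pose i1 a := pr (map_mpoly (str C) (lft a)).
have i1E p : pr (map_mpoly (str C) p) = i1 (mmap (str A) x p).
  apply/eqP; rewrite /i1 -subr_eq0 -rmorphB -(rmorphB (map_mpoly (str C))).
  apply/eqP/pr0 => psi fpsi; have := sl_map 1 (p - lft (mmap (str A) x p)) fpsi.
  by rewrite scale1r => ->; rewrite rmorphB /= lftP subrr mulr0.
have i1B : {morph i1 : a b / a - b}.
  by move=> a b; rewrite -[RHS]rmorphB -(rmorphB (map_mpoly (str C))) i1E rmorphB /= !lftP.
have i1M : {morph i1 : a b / a * b}.
  by move=> a b; rewrite -[RHS]rmorphM -(rmorphM (map_mpoly (str C))) i1E rmorphM /= !lftP.
have i11 : i1 1 = 1 by rewrite -(rmorph1 (mmap (str A) x)) -i1E !rmorph1.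
pose f1 := mk_rmorphism i1B i1M i11.
pose f2 : {rmorphism C -> Q} := pr \o mpolyC n (R := C).
have f1C c : f1 (str A c) = f2 (str C c).
  by rewrite /= -(mmapC x (str A) c) -i1E /= map_mpolyC.
pose T := @Alg K Q (f2 \o str C).
pose F1 := @AlgHom K A T f1 f1C.
pose F2 := @AlgHom K C T f2 (fun=> erefl).
split; apply: (@Tensor K A C T F1 F2) => [t|psi fpsi].
  have [P <-] := pr_surj t.
  exists [seq (mmap1 x m, P@_m) | m <- msupp P]; rewrite big_map {1}[P]mpolyE.
  rewrite rmorph_sum; apply: eq_bigr => m _ /=; rewrite -mul_mpolyC rmorphM mulrC.
  by congr (_ * _); rewrite -(mmapX x (str A)) -i1E map_mpolyX.
have [rep repP] := choice pr_surj.
have slE P : sl psi P = sl psi (rep (pr P)).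
  apply/eqP; rewrite -subr_eq0 -slB //; apply/eqP; move: psi fpsi; apply/pr0.
  by rewrite rmorphB repP subrr.
exists (fun t => sl psi (rep t)) => [t u|a c].
  by rewrite -slB // [RHS]slE rmorphB !repP.
have -> : F1 a * F2 c = pr (c *: map_mpoly (str C) (lft a)).
  by rewrite -mul_mpolyC rmorphM mulrC.
by rewrite -slE sl_map // lftP.
Qed.
End TensorExists.

Lemma tensor_exists (K : fieldType) (A C : alg K) :
  finite_type A -> inhabited (tensor A C).
Proof. by case=> n [x hx]; apply: tensor_of_generators hx. Qed.

Section TensorTheory.
Variables (K : fieldType) (A C : alg K) (T : tensor A C).
Local Notation i1 := (inl_t T).
Local Notation i2 := (inr_t T).

Lemma additive_sum (U V : zmodType) (f : U -> V) (J : Type) (s : seq J)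
    (P : pred J) (F : J -> U) :
  {morph f : x y / x - y} ->
  f (\sum_(j <- s | P j) F j) = \sum_(j <- s | P j) f (F j).
Proof. by move=> fB; exact: (raddf_sum (mk_additive fB)). Qed.

Definition tsum (s : seq (A * C)) : T := \sum_(p <- s) i1 p.1 * i2 p.2.

(** Once the right factors are independent, the left coefficients are unique: they are slices. Later
    identities between tensors are compared in this form. *)
Lemma tens_expand (t : T) :
  exists (d : nat) (e : nat -> C) (psi : nat -> C -> K) (a : nat -> A),
    [/\ forall i, functional (psi i),
        forall i j, (i < d)%N -> (j < d)%N -> psi i (e j) = (i == j)%:R,
        t = \sum_(i < d) i1 (a i) * i2 (e i) &
        forall i (sl : T -> A), {morph sl : x y / x - y} ->
          (forall a c, sl (i1 a * i2 c) = str A (psi i c) * a) -> sl t = a i].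
Proof.
have [s ->] := tens_gen t.
have [d [e [psi [fpsi dual _ ex]]]] := finite_dual_family [seq p.2 | p <- s].
exists d, e, psi, (fun i => \sum_(p <- s) str A (psi i p.2) * p.1); split=> //.
  rewrite (eq_big_seq (fun p => \sum_(i < d) i1 (str A (psi i p.2) * p.1) * i2 (e i))).
    by rewrite exchange_big /=; apply: eq_bigr => i _; rewrite rmorph_sum mulr_suml.
  move=> p ps; rewrite [in LHS](ex p.2); last by apply: map_f.
  rewrite rmorph_sum mulr_sumr; apply: eq_bigr => i _.
  by rewrite !rmorphM !alg_homE mulrCA mulrA.
by move=> i sl slB slE; rewrite additive_sum //; apply: eq_bigr => p _.
Qed.

Lemma tens_pairing (phi : A -> K) (psi : C -> K) (s : seq (A * C)) :
  functional phi -> functional psi ->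
  forall sl : T -> A, {morph sl : x y / x - y} ->
     (forall a c, sl (i1 a * i2 c) = str A (psi c) * a) ->
  phi (sl (\sum_(p <- s) i1 p.1 * i2 p.2)) =
  psi (\sum_(p <- s) str C (phi p.1) * p.2).
Proof.
move=> fphi fpsi sl slB slE; rewrite additive_sum // !fnl_sum //.
by apply: eq_bigr => p _; rewrite slE !fnlZ // mulrC.
Qed.

(** The formula is well defined: each functional [psi] on [C] sends it to [phi] of a right slice,
    and functionals separate the elements of [C]. *)
Lemma tens_lslice (phi : A -> K) : functional phi ->
  exists2 sl : T -> C, {morph sl : x y / x - y} &
    forall a c, sl (i1 a * i2 c) = str C (phi a) * c.
Proof.
move=> fphi; have [rep repP] := choice (@tens_gen _ _ _ T).
pose sl t := \sum_(p <- rep t) str C (phi p.1) * p.2.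
have slE s : sl (tsum s) = \sum_(p <- s) str C (phi p.1) * p.2.
  apply/eqP; rewrite -subr_eq0; apply/eqP; apply: functionals_sep0 => psi fpsi.
  rewrite fnlB //; have [rsl rslB rslE] := tens_slice T fpsi.
  by rewrite -!(tens_pairing _ fphi fpsi rslB rslE) -repP subrr.
exists sl => [t u|a c]; last first.
  by have := slE [:: (a, c)]; rewrite /tsum !big_seq1.
have -> : t - u = tsum (rep t ++ [seq (- p.1, p.2) | p <- rep u]).
  rewrite /tsum big_cat big_map /= -repP {1}(repP u) -sumrN; congr (_ + _).
  by apply: eq_bigr => p _; rewrite rmorphN mulNr.
rewrite slE big_cat big_map /= -sumrN; congr (_ + _).
by apply: eq_bigr => p _; rewrite fnlN // rmorphN mulNr.
Qed.

(** A vanishing sum of pure tensors is rewritten with independent right factors; slices show that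
    every left coefficient is 0, so the sum of the products of values of [f] and [g] vanishes
    too. *)
Lemma tens_univ (R : alg K) (f : algHom A R) (g : algHom C R) :
  exists h : algHom T R, (forall a, h (i1 a) = f a) /\ (forall c, h (i2 c) = g c).
Proof.
have [rep repP] := choice (@tens_gen _ _ _ T).
pose h t := \sum_(p <- rep t) f p.1 * g p.2.
have tsum0 s : tsum s = 0 -> \sum_(p <- s) f p.1 * g p.2 = 0.
  move=> s0; have [d [e [psi [fpsi dual _ ex]]]] := finite_dual_family [seq p.2 | p <- s].
  rewrite (eq_big_seq (fun p => \sum_(i < d) f (str A (psi i p.2) * p.1) * g (e i))).
    rewrite exchange_big /=; apply: big1 => i _; rewrite -mulr_suml -rmorph_sum.
    have [sl slB slE] := tens_slice T (fpsi i).
    suff -> : \sum_(p <- s) str A (psi i p.2) * p.1 = sl (tsum s).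
      by rewrite s0 -(subrr 0) slB subrr rmorph0 mul0r.
    by rewrite /tsum additive_sum //; apply: eq_bigr => p _.
  move=> p ps; rewrite [in LHS](ex p.2); last by apply: map_f.
  rewrite rmorph_sum mulr_sumr; apply: eq_bigr => i _.
  by rewrite !rmorphM !alg_homE mulrCA mulrA.
pose neg (s : seq (A * C)) := [seq (- p.1, p.2) | p <- s].
have negE s : \sum_(p <- neg s) f p.1 * g p.2 = - \sum_(p <- s) f p.1 * g p.2.
  by rewrite big_map -sumrN; apply: eq_bigr => p _; rewrite rmorphN mulNr.
have tnegE s : tsum (neg s) = - tsum s.
  by rewrite /tsum big_map -sumrN; apply: eq_bigr => p _; rewrite rmorphN mulNr.
have repT t : tsum (rep t) = t by exact: esym (repP t).
have tcat s s' : tsum (s ++ s') = tsum s + tsum s' by rewrite /tsum big_cat.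
have hE s : h (tsum s) = \sum_(p <- s) f p.1 * g p.2.
  apply/eqP; rewrite -subr_eq0 -negE /h -big_cat; apply/eqP/tsum0.
  by rewrite tcat tnegE repT subrr.
have hB : {morph h : t u / t - u}.
  move=> t u; have -> : t - u = tsum (rep t ++ neg (rep u)).
    by rewrite tcat tnegE !repT.
  by rewrite hE big_cat /= negE.
have hM : {morph h : t u / t * u}.
  move=> t u.
  have -> : t * u = tsum [seq (p.1 * q.1, p.2 * q.2) | p <- rep t, q <- rep u].
    rewrite {1}(repP t) {1}(repP u) big_distrlr /tsum big_allpairs_dep /=.
    apply: eq_bigr => p _; apply: eq_bigr => q _.
    by rewrite !rmorphM mulrACA.
  rewrite hE big_allpairs_dep /= [RHS]big_distrlr /=.
  apply: eq_bigr => p _; apply: eq_bigr => q _.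
  by rewrite !rmorphM mulrACA.
have hone (a : A) (c : C) : h (i1 a * i2 c) = f a * g c.
  by have := hE [:: (a, c)]; rewrite /tsum !big_seq1.
have h1 : h 1 = 1 by have := hone 1 1; rewrite !rmorph1 !mulr1.
have hC c : mk_rmorphism hB hM h1 (str T c) = str R c.
  by rewrite /= -(alg_homE i1) -[i1 _]mulr1 -(rmorph1 i2) hone rmorph1 mulr1 alg_homE.
exists (AlgHom hC); split=> [a|c] /=.
  by rewrite -[i1 a]mulr1 -(rmorph1 i2) hone rmorph1 mulr1.
by rewrite -[i2 c]mul1r -(rmorph1 i1) hone rmorph1 mul1r.
Qed.
End TensorTheory.

(** * Faithful representations *)

Section Points.
Variables (K : fieldType) (G : affGrp K).
Local Notation A := (coord_ring G).
Hypothesis hft : finite_type A.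

Lemma point_of (R : alg K) (f : algHom A R) : exists g : G R, ev g =1 f.
Proof. exact: ev_surj. Qed.

Lemma evM_nat (R R' : alg K) (u : algHom R R') (g h : G R) a :
  ev (fmap G u g * fmap G u h)%g a = u (ev (g * h)%g a).
Proof. by rewrite -gmulfM ev_nat. Qed.

Lemma fmap1 (R R' : alg K) (u : algHom R R') : fmap G u 1%g = 1%g.
Proof. by apply: (@mulgI _ (fmap G u 1%g)); rewrite -gmulfM !mulg1. Qed.

Lemma fmapV (R R' : alg K) (u : algHom R R') (g : G R) :
  fmap G u (g^-1)%g = ((fmap G u g)^-1)%g.
Proof. by apply: (@mulgI _ (fmap G u g)); rewrite -gmulfM !mulgV fmap1. Qed.

Lemma ev1_nat (R R' : alg K) (u : algHom R R') a :
  ev (1%g : G R') a = u (ev (1%g : G R) a).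
Proof. by rewrite -(fmap1 u) ev_nat. Qed.

Lemma ev_ext (R R' : alg K) (u : algHom R R') (g : G R) (g' : G R') :
  (forall a, ev g' a = u (ev g a)) -> g' = fmap G u g.
Proof. by move=> h; apply: ev_inj => a; rewrite ev_nat h. Qed.

Definition kself : alg K := @Alg K K (GRing.RMorphism.clone _ _ (@idfun K) _).

Definition to_alg (R : alg K) : algHom kself R :=
  @AlgHom K kself R (str R) (fun=> erefl).

Definition counit (a : A) : K := ev (1%g : G kself) a.

Lemma ev1 (R : alg K) a : ev (1%g : G R) a = str R (counit a).
Proof. exact: (ev1_nat (to_alg R)). Qed.

(** This is the coproduct of [a], read off the product of the two universal points over the tensor
    square of the coordinate ring; any pair of points is a specialization of these two. *)
Lemma comul (a : A) : exists (r : nat) (b e : nat -> A) (psi : nat -> A -> K),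
  [/\ forall i, functional (psi i),
      forall i j, (i < r)%N -> (j < r)%N -> psi i (e j) = (i == j)%:R &
      forall (R : alg K) (g h : G R),
        ev (g * h)%g a = \sum_(i < r) ev g (b i) * ev h (e i)].
Proof.
have [T] := @tensor_exists K A A hft.
have [x hx] := point_of (inl_t T); have [y hy] := point_of (inr_t T).
have [r [e [psi [b [fpsi dual tE _]]]]] := tens_expand (ev (x * y)%g a : T).
exists r, b, e, psi; split=> // R g h.
have [u [ul ur]] := tens_univ T (ev g) (ev h).
have -> : g = fmap G u x by apply: ev_ext => c; rewrite hx ul.
have -> : h = fmap G u y by apply: ev_ext => c; rewrite hy ur.
rewrite evM_nat tE rmorph_sum; apply: eq_bigr => i _.
by rewrite !ev_nat /= hx hy rmorphM.
Qed.

(** The span of [s] is a subcomodule of the regular representation, in which g sends a(y) to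
    a(yg). *)
Definition stable_seq (s : seq A) := forall a, a \in s ->
  exists t : seq (A * A), {subset unzip1 t <= s} /\
    forall (R : alg K) (y g : G R),
      ev (y * g)%g a = \sum_(p <- t) ev y p.1 * ev g p.2.

(* Coefficients of the iterated coproduct: by associativity, the left factors
   b_k in [a(gh) = sum_k b_k(g) e_k(h)] span a translation-stable space as soon
   as the e_k are independent. *)
Lemma stable_seq_exists (a : A) : exists s : seq A,
  stable_seq s /\ forall U, subspace U -> (forall b, b \in s -> U b) -> U a.
Proof.
have [r [b [e [psi [fpsi dual aE]]]]] := comul a.
exists [seq b k | k <- index_iota 0 r]; split; last first.
  move=> U hU Ub; have -> : a = \sum_(i < r) str A (counit (e i)) * b i.
    have [g hg] := point_of (@AlgHom K A A idfun (fun=> erefl)).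
    rewrite -[LHS]hg -[g]mulg1 aE; apply: eq_bigr => i _.
    by rewrite hg ev1 mulrC.
  apply: subsp_sum => // i _; apply: subspZ => //; apply: Ub.
  by apply/mapP; exists (nat_of_ord i); rewrite ?mem_index_iota /=.
move=> w /mapP[k]; rewrite mem_index_iota => /andP[_ kr] ->.
have /choice[cm hcm] : forall q, exists s : seq (A * A),
    forall (R : alg K) (g h : G R),
      ev (g * h)%g (e q) = \sum_(p <- s) ev g p.1 * ev h p.2.
  move=> q; have [r' [b' [e' [_ [_ _ h]]]]] := comul (e q).
  exists [seq (b' i, e' i) | i <- index_iota 0 r'] => R g g'.
  by rewrite h big_map big_mkord.
exists [seq (b q, \sum_(p <- cm q) str A (psi k p.2) * p.1) | q <- index_iota 0 r].
split=> [c|R y g].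
  by rewrite /unzip1 -map_comp.
have [T] := @tensor_exists K A R hft.
have [sl slB slE] := tens_lslice T (fpsi k).
have [h hh] := point_of (inl_t T).
pose y' := fmap G (inr_t T) y; pose g' := fmap G (inr_t T) g.
have slsum := additive_sum _ _ _ slB.
have := mulgA y' g' h; move/(congr1 (fun z => sl (ev z a))).
rewrite !aE !slsum => H.
transitivity (\sum_(i < r) sl (ev (y' * g')%g (b i) * ev h (e i))).
  rewrite (bigD1 (Ordinal kr)) //= big1 => [|i ik].
    by rewrite hh evM_nat mulrC slE dual // eqxx rmorph1 mul1r addr0.
  rewrite hh evM_nat mulrC slE dual //.
  by rewrite eq_sym (negPf ik : (i == k :> nat) = false) rmorph0 mul0r.
rewrite -H big_map big_mkord; apply: eq_bigr => i _.
rewrite hcm mulr_sumr slsum rmorph_sum mulr_sumr; apply: eq_bigr => p _.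
by rewrite hh !ev_nat /= mulrA -rmorphM mulrC slE rmorphM alg_homE mulrCA.
Qed.

Lemma stable_seq_cat s s' : stable_seq s -> stable_seq s' -> stable_seq (s ++ s').
Proof.
move=> hs hs' a; rewrite mem_cat => /orP[/hs|/hs'] [t [st h]]; exists t; split=> //.
  by move=> c /st; rewrite mem_cat => ->.
by move=> c /st; rewrite mem_cat orbC => ->.
Qed.

Lemma stable_seq_seq (l : seq A) : exists s : seq A, stable_seq s /\
  forall U, subspace U -> (forall b, b \in s -> U b) -> forall a, a \in l -> U a.
Proof.
elim: l => [|a l [s [hs sl]]]; first by exists [::]; split.
have [s' [hs' s'a]] := stable_seq_exists a.
exists (s' ++ s); split=> [|U hU Us b]; first exact: stable_seq_cat.
rewrite inE => /orP[/eqP->|bl].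
  by apply: s'a => // c cs; apply: Us; rewrite mem_cat cs.
by apply: (sl U) => // c cs; apply: Us; rewrite mem_cat cs orbT.
Qed.

(** [u] is kept apart from the structure morphism of [R]: the matrices will have entries in
    extensions of [K], while the points stay points over [K]-algebras. *)
Definition rho (r : nat) (c : nat -> A) (S : nzRingType) n (M : nat -> 'M[S]_n)
    (R : alg K) (u : {rmorphism S -> R}) (g : G R) : 'M[R]_n :=
  \sum_(k < r) ev g (c k) *: map_mx u (M k).

Lemma faithful_matrices :
  exists (r : nat) (c : nat -> A) (chi : nat -> A -> K) (d : nat)
      (M : nat -> 'M[K]_d),
    [/\ forall k, functional (chi k),
        forall i j, (i < r)%N -> (j < r)%N -> chi i (c j) = (i == j)%:R,
        forall (R : alg K) (g h : G R), rho r c M (str R) (g * h)%g =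
          rho r c M (str R) h *m rho r c M (str R) g,
        forall R : alg K, rho r c M (str R) (1%g : G R) = 1%:M &
        forall (R : alg K) (g h : G R),
          rho r c M (str R) g = rho r c M (str R) h -> g = h].
Proof.
have [n [x xgen]] := hft.
have [s [hs xs]] := stable_seq_seq (codom x).
have [d [v [phi [fphi dual vspan ex]]]] := finite_dual_family s.
(* The elements whose right translates stay in the span of the [v i]. This subspace contains [s],
   hence every [v j], which yields the matrix coefficients. *)
pose U w := exists m : nat -> A, forall (R : alg K) (y g : G R),
  ev (y * g)%g w = \sum_(i < d) ev g (m i) * ev y (v i).
have hU : subspace U.
  split=> [|k w w' [m hm] [m' hm']].
    by exists (fun=> 0) => R y g; rewrite rmorph0 big1 // => i _; rewrite rmorph0 mul0r.
  exists (fun i => str A k * m i + m' i) => R y g.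
  rewrite rmorphD rmorphM alg_homE hm hm' mulr_sumr -big_split.
  by apply: eq_bigr => i _; rewrite rmorphD rmorphM alg_homE mulrDl mulrA.
have Us a : a \in s -> U a.
  move=> sa; have [t [ts aE]] := hs a sa.
  exists (fun i => \sum_(p <- t) str A (phi i p.1) * p.2) => R y g.
  rewrite aE (eq_bigr (fun i : 'I_d => \sum_(p <- t)
    ev g (str A (phi i p.1) * p.2) * ev y (v i))); last first.
    by move=> i _; rewrite rmorph_sum mulr_suml.
  rewrite exchange_big /=; apply: eq_big_seq => p pt.
  rewrite {1}(ex p.1); last by apply: ts; apply: map_f.
  rewrite rmorph_sum mulr_suml; apply: eq_bigr => i _.
  by rewrite !rmorphM !alg_homE mulrAC.
have /choice[m hm] : forall j, exists mj : nat -> A, (j < d)%N ->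
    forall (R : alg K) (y g : G R),
    ev (y * g)%g (v j) = \sum_(i < d) ev g (mj i) * ev y (v i).
  move=> j; have [jd|] := boolP (j < d)%N; last by exists (fun=> 0).
  by have [mj h] := vspan U hU Us j jd; exists mj.
have [r [c [chi [fchi cdual _ mex]]]] :=
  finite_dual_family [seq m p.1 p.2 | p <- [seq (j, i) | j <- iota 0 d, i <- iota 0 d]].
(* The [c k] are a basis of the span of the matrix coefficients, and [M k] collects the coordinates
   along [c k]. *)
pose M k : 'M[K]_d := \matrix_(j, i) chi k (m j i).
have rhoE (R : alg K) (g : G R) :
    rho r c M (str R) g = \matrix_(j, i) ev g (m j i).
  apply/matrixP => j i; rewrite /rho summxE !mxE (mex (m j i)).
    rewrite rmorph_sum; apply: eq_bigr => k _.
    by rewrite !mxE rmorphM alg_homE mulrC.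
  apply: (map_f (fun p => m p.1 p.2) (x := (nat_of_ord j, nat_of_ord i))).
  by apply/allpairsP; exists (nat_of_ord j, nat_of_ord i); split; rewrite ?mem_iota /=.
(* The [v i] remain independent over [R] in the tensor product with [R]; coefficients can therefore
   be compared at the universal point [y]. *)
have uniq (R : alg K) (T : tensor A R) (al be : 'I_d -> R) :
    \sum_(i < d) inr_t T (al i) * inl_t T (v i) =
    \sum_(i < d) inr_t T (be i) * inl_t T (v i) -> al =1 be.
  move=> E l; have [sl slB slE] := tens_lslice T (fphi l).
  have slal (ga : 'I_d -> R) : sl (\sum_(i < d) inr_t T (ga i) * inl_t T (v i)) = ga l.
    rewrite (additive_sum _ _ _ slB) (bigD1 l) //= big1 => [|i il].
      by rewrite mulrC slE dual // eqxx rmorph1 mul1r addr0.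
    rewrite mulrC slE dual // eq_sym (negPf il : (i == l :> nat) = false).
    by rewrite rmorph0 mul0r.
  by rewrite -slal E slal.
exists r, c, chi, d, M; split=> // [R g h|R|R g h].
- rewrite !rhoE; have [T] := @tensor_exists K A R hft.
  have [y hy] := point_of (inl_t T).
  apply/matrixP => j i; rewrite !mxE.
  apply: (uniq R T (fun i => ev (g * h)%g (m j i))
    (fun i => \sum_l _ * _) _ i) => {i}.
  transitivity (ev (y * (fmap G (inr_t T) g * fmap G (inr_t T) h))%g (v j)).
    by rewrite (hm j) //; apply: eq_bigr => i _; rewrite evM_nat hy.
  rewrite mulgA (hm j) //.
  rewrite (eq_bigr (fun l : 'I_d => \sum_(i < d) inr_t T (ev h (m j l) * ev g (m l i)) *
    inl_t T (v i))) => [|l _].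
    rewrite exchange_big /=; apply: eq_bigr => i _.
    rewrite -mulr_suml -rmorph_sum; congr (inr_t T _ * _).
    by apply: eq_bigr => l _; rewrite !mxE.
  rewrite (hm l) // mulr_sumr; apply: eq_bigr => i _.
  by rewrite !ev_nat /= hy mulrA rmorphM.
- rewrite rhoE; have [T] := @tensor_exists K A R hft.
  have [y hy] := point_of (inl_t T).
  apply/matrixP => j i; rewrite !mxE.
  apply: (uniq R T (fun i => ev (1%g : G R) (m j i)) (fun i => (j == i)%:R) _ i) => {i}.
  transitivity (ev (y * 1)%g (v j)).
    rewrite (hm j) //; apply: eq_bigr => i _.
    by rewrite -(fmap1 (inr_t T)) ev_nat hy.
  rewrite mulg1 hy (bigD1 j) //= eqxx rmorph1 mul1r big1 ?addr0 // => i ij.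
  by rewrite eq_sym (negPf ij) rmorph0 mul0r.
- rewrite !rhoE => /matrixP E; apply: ev_inj => a.
  (* Taking y = 1 recovers the values of the [v j] from the matrix, hence the values of the
     generators [x i]. *)
  have vE j : (j < d)%N -> ev g (v j) = ev h (v j).
    move=> jd; rewrite -[g]mul1g -[h]mul1g !(hm j) //; apply: eq_bigr => i _.
    by have := E (Ordinal jd) i; rewrite !mxE => ->.
  have sE b : b \in s -> ev g b = ev h b.
    move=> bs; rewrite (ex b bs) !rmorph_sum; apply: eq_bigr => i _.
    by rewrite !rmorphM !alg_homE vE.
  have xE i : ev g (x i) = ev h (x i).
    apply/eqP; rewrite -subr_eq0; apply/eqP.
    apply: (xs (fun b => ev g b - ev h b = 0)); last exact: codom_f.
      split=> [|k b b' hb hb']; first by rewrite !rmorph0 subrr.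
      by rewrite !rmorphD !rmorphM !alg_homE opprD addrACA -mulrBr hb hb' mulr0 addr0.
    by move=> b bs; rewrite sE // subrr.
  have [p <-] := xgen a; elim/mpolyind: p => [|k mm p _ _ IH]; first by rewrite !rmorph0.
  rewrite mmapD !rmorphD IH; congr (_ + _).
  rewrite (mmapZ x (str A)) mmapX !rmorphM !alg_homE /mmap1 !rmorph_prod.
  by congr (_ * _); apply: eq_bigr => i _; rewrite !rmorphXn /= xE.
Qed.

(* The M_k define a representation of G_L: an L-algebra is a K-algebra R with a
   map u from L compatible with f, and the order of the products is that of an
   action on row vectors. *)
Definition is_rep (L : fieldType) (f : {rmorphism K -> L}) r (c : nat -> A) n
    (M : nat -> 'M[L]_n) :=
  forall (R : alg K) (u : {rmorphism L -> R}), (forall z, u (f z) = str R z) ->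
  (forall g h : G R, rho r c M u (g * h)%g = rho r c M u h *m rho r c M u g) /\
  rho r c M u (1%g : G R) = 1%:M.

(** Two independent universal points commute. The coefficient of c_k ⊗ c_l is M_k M_l in one order
    of the product and M_l M_k in the other; slicing along [chi k] and [chi l] isolates it. *)
Lemma commutative_matrices (L : fieldType) (f : {rmorphism K -> L})
    (r : nat) (c : nat -> A) (chi : nat -> A -> K) n (M : nat -> 'M[L]_n) :
  (forall k, functional (chi k)) ->
  (forall i j, (i < r)%N -> (j < r)%N -> chi i (c j) = (i == j)%:R) ->
  is_rep f r c M ->
  commutative_grp G ->
  forall k l, (k < r)%N -> (l < r)%N -> M k *m M l = M l *m M k.
Proof.
move=> fchi dual hM cG k l kr lr.
have [T2] := @tensor_exists K A (Alg f) hft.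
have [T1] := @tensor_exists K A T2 hft.
pose u : {rmorphism L -> T1} := inr_t T1 \o inr_t T2.
have uE z : u (f z) = str T1 z.
  by rewrite /= -(alg_homE (inr_t T1)) -(alg_homE (inr_t T2)).
have [rhoM _] := hM T1 u uE.
have [x hhx] := point_of (inl_t T1).
pose hy : {rmorphism A -> T1} := inr_t T1 \o inl_t T2.
have hyE z : hy (str A z) = str T1 z by rewrite /= !alg_homE.
have [y hhy] := point_of (@AlgHom K A T1 hy hyE).
have /matrixP E : rho r c M u x *m rho r c M u y =
  rho r c M u y *m rho r c M u x by rewrite -!rhoM cG.
have [sl1 sl1B sl1E] := tens_lslice T1 (fchi k).
have [sl2 sl2B sl2E] := tens_lslice T2 (fchi l).
have rhoij (z : G T1) i j : rho r c M u z i j =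
    \sum_(k < r) ev z (c k) * u (M k i j).
  by rewrite /rho summxE; apply: eq_bigr => q _; rewrite !mxE.
have pick (q : nat) (F : 'I_r -> L) (qr : (q < r)%N) :
    \sum_(p < r) str (Alg f) (chi q (c p)) * F p = F (Ordinal qr).
  rewrite (bigD1 (Ordinal qr)) //= dual // eqxx rmorph1 mul1r big1 ?addr0 // => p pq.
  by rewrite dual // eq_sym (negPf pq : (p == q :> nat) = false) rmorph0 mul0r.
have slxy (F : 'I_r -> 'I_r -> L) :
    sl2 (sl1 (\sum_(p < r) \sum_(q < r)
      inl_t T1 (c p) * inr_t T1 (inl_t T2 (c q) * inr_t T2 (F p q)))) =
    F (Ordinal kr) (Ordinal lr).
  pose F1 p := \sum_(q < r) inl_t T2 (c q) * inr_t T2 (F p q).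
  have -> : sl1 (\sum_(p < r) \sum_(q < r)
      inl_t T1 (c p) * inr_t T1 (inl_t T2 (c q) * inr_t T2 (F p q))) = F1 (Ordinal kr).
    rewrite (eq_bigr (fun p : 'I_r => inl_t T1 (c p) * inr_t T1 (F1 p))).
      rewrite (additive_sum _ _ _ sl1B) (bigD1 (Ordinal kr)) //= sl1E dual // eqxx.
      rewrite rmorph1 mul1r big1 ?addr0 // => p pk.
      by rewrite sl1E dual // eq_sym (negPf pk : (p == k :> nat) = false) rmorph0 mul0r.
    by move=> p _; rewrite rmorph_sum mulr_sumr.
  by rewrite /F1 (additive_sum _ _ _ sl2B) (eq_bigr _ (fun q _ => sl2E _ _)) pick.
apply/matrixP => i j.
have E1 : (rho r c M u x *m rho r c M u y) i j =
    \sum_(p < r) \sum_(q < r)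
      inl_t T1 (c p) * inr_t T1 (inl_t T2 (c q) * inr_t T2 ((M p *m M q) i j)).
  rewrite !mxE.
  transitivity (\sum_t \sum_(p < r) \sum_(q < r) inl_t T1 (c p) *
     inr_t T1 (inl_t T2 (c q) * inr_t T2 (M p i t * M q t j))).
    apply: eq_bigr => t _; rewrite !rhoij big_distrlr /=.
    apply: eq_bigr => p _; apply: eq_bigr => q _.
    by rewrite hhx hhy /= !rmorphM mulrACA -!mulrA; congr (_ * _); rewrite mulrCA.
  rewrite exchange_big /=; apply: eq_bigr => p _.
  rewrite exchange_big /=; apply: eq_bigr => q _.
  by rewrite mxE rmorph_sum !mulr_sumr rmorph_sum mulr_sumr.
have E2 : (rho r c M u y *m rho r c M u x) i j =
    \sum_(p < r) \sum_(q < r)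
      inl_t T1 (c p) * inr_t T1 (inl_t T2 (c q) * inr_t T2 ((M q *m M p) i j)).
  rewrite !mxE.
  transitivity (\sum_t \sum_(p < r) \sum_(q < r) inl_t T1 (c p) *
     inr_t T1 (inl_t T2 (c q) * inr_t T2 (M q i t * M p t j))).
    apply: eq_bigr => t _; rewrite !rhoij mulrC big_distrlr /=.
    apply: eq_bigr => p _; apply: eq_bigr => q _.
    rewrite hhx hhy /= !rmorphM mulrACA -!mulrA; congr (_ * _).
    by rewrite ![in RHS]mulrA [RHS]mulrAC !mulrA.
  rewrite exchange_big /=; apply: eq_bigr => p _.
  rewrite exchange_big /=; apply: eq_bigr => q _.
  by rewrite mxE rmorph_sum !mulr_sumr rmorph_sum mulr_sumr.
have := E i j; rewrite E1 E2 => /(congr1 (fun z => sl2 (sl1 z))).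
by rewrite !slxy.
Qed.

Lemma is_rep_map (L L' : fieldType) (f : {rmorphism K -> L}) (g : {rmorphism L -> L'})
    (f' : {rmorphism K -> L'}) r (c : nat -> A) n (M : nat -> 'M[L]_n) :
  (forall z, f' z = g (f z)) ->
  is_rep f r c M -> is_rep f' r c (fun k => map_mx g (M k)).
Proof.
move=> fE hM R u hu; have [|rM r1] := hM R (u \o g).
  by move=> z; rewrite -hu fE.
have rE (x : G R) : rho r c (fun k => map_mx g (M k)) u x = rho r c M (u \o g) x.
  by apply: eq_bigr => k _; congr (_ *: _); apply/matrixP => i j; rewrite !mxE.
by split=> [x y|]; rewrite !rE.
Qed.

(** For square [B] this is a change of basis; for fewer rows it is the restriction to the stable row
    space of [B]. *)
Lemma is_rep_conj (L : fieldType) (f : {rmorphism K -> L}) r (c : nat -> A) n m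
    (M : nat -> 'M[L]_n) (B : 'M[L]_(m, n)) (C : 'M[L]_(n, m)) :
  B *m C = 1%:M -> (forall k, (k < r)%N -> exists N, B *m M k = N *m B) ->
  is_rep f r c M -> is_rep f r c (fun k => B *m M k *m C).
Proof.
move=> BC stab hM R u hu; have [rM r1] := hM R u hu.
have BC' : map_mx u B *m map_mx u C = 1%:M by rewrite -map_mxM BC map_mx1.
have rE (x : G R) : rho r c (fun k => B *m M k *m C) u x =
    map_mx u B *m rho r c M u x *m map_mx u C.
  rewrite /rho mulmx_sumr mulmx_suml; apply: eq_bigr => k _.
  by rewrite !map_mxM -scalemxAr -scalemxAl.
have rB (x : G R) : map_mx u B *m rho r c M u x =
    rho r c (fun k => B *m M k *m C) u x *m map_mx u B.
  rewrite /rho mulmx_sumr mulmx_suml; apply: eq_bigr => k _.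
  have [N BN] := stab k (ltn_ord k).
  rewrite -scalemxAl -scalemxAr -!map_mxM; congr (_ *: map_mx u _).
  by rewrite BN -[N *m B *m C]mulmxA BC mulmx1.
split=> [x y|]; last by rewrite rE r1 mulmx1.
by rewrite {1}rE rM mulmxA rB -!mulmxA (mulmxA (map_mx u B)) -rE.
Qed.
End Points.

(** * Finite extensions and triangularization *)

Lemma field_quotient (R : comNzRingType) (J : R -> Prop) :
  ideal_pred J -> ~ J 1 -> (forall x, ~ J x -> exists a, J (1 - a * x)) ->
  exists (F : fieldType) (p : {rmorphism R -> F}),
    (forall y, exists x, p x = y) /\ (forall x, p x = 0 <-> J x).
Proof.
move=> hJ nJ1 maxJ; have [Q [p [psurj p0]]] := quotient_ring hJ nJ1.
have /choice[inv hinv] : forall y : Q, exists z : Q,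
    (y != 0 -> z * y = 1) /\ (y = 0 -> z = 0).
  move=> y; have [->|y0] := eqVneq y 0; first by exists 0; split.
  have [x xy] := psurj y; have [a Ja] : exists a, J (1 - a * x).
    by apply: maxJ => /p0; rewrite xy => /eqP; apply/negP.
  exists (p a); split=> [_|yE]; last by rewrite yE eqxx in y0.
  by apply/eqP; rewrite -xy -rmorphM eq_sym -subr_eq0 -(rmorph1 p) -rmorphB; apply/eqP/p0.
pose F : fieldType := HB.pack (GRing.ComNzRing.sort Q)
  (GRing.ComNzRing_isField.Build Q (fun y => (hinv y).1) ((hinv 0).2 erefl)).
by exists F, p.
Qed.

Section FiniteExtensions.

Definition finite_ext (K L : fieldType) (f : {rmorphism K -> L}) :=
  exists s : seq L, forall U, @subspace K (Alg f) U ->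
    (forall x, x \in s -> U x) -> forall x, U x.

Lemma finite_ext_id (K : fieldType) : finite_ext (@idfun K : {rmorphism K -> K}).
Proof.
exists [:: 1] => U hU U1 x; rewrite -[x]mulr1.
by apply: (@subspZ K (Alg (@idfun K : {rmorphism K -> K}))) => //; apply: U1; rewrite inE.
Qed.

Lemma finite_ext_comp (K L M : fieldType) (f : {rmorphism K -> L})
    (g : {rmorphism L -> M}) (h : {rmorphism K -> M}) :
  (forall z, h z = g (f z)) -> finite_ext f -> finite_ext g -> finite_ext h.
Proof.
move=> hE [s hs] [t ht]; exists [seq g x * y | x <- s, y <- t] => U [U0 hU] Ust z.
suff: forall x, U (g x * z) by move/(_ 1); rewrite rmorph1 mul1r.
apply: (ht (fun z => forall x, U (g x * z))) => [|y yt].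
  split=> [x|c u v Uu Uv x]; first by rewrite mulr0.
  rewrite mulrDr mulrA -rmorphM -[g _ * u]mul1r -(rmorph1 h).
  exact: hU.
apply: (hs (fun x => U (g x * y))) => [|x xs].
  split=> [|c u v Uu Uv]; first by rewrite rmorph0 mul0r.
  have -> : g (f c * (u : L) + (v : L)) * y = h c * (g u * y) + g v * y.
    by rewrite hE rmorphD rmorphM mulrDl mulrA.
  exact: hU.
by apply: Ust; apply: allpairs_f.
Qed.

(** The quotient of L[X] by a maximal ideal above (p), so that p may be reducible. Reduction modulo
    p shows that finitely many powers of the class of X span. *)
Lemma root_extension (L : fieldType) (p : {poly L}) : (1 < size p)%N ->
  exists (L' : fieldType) (g : {rmorphism L -> L'}) (a : L'),
    finite_ext g /\ root (map_poly g p) a.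
Proof.
move=> sp; pose I (q : {poly L}) := p %| q.
have hI : ideal_pred I.
  split=> [|a x y Ix Iy]; first exact: dvdp0.
  by apply: dvdp_add => //; apply: dvdp_mull.
have nI1 : ~ I 1 by rewrite /I dvdp1; move/eqP => E; rewrite E in sp.
have [J [hJ nJ1 IJ maxJ]] := maximal_ideal_above hI nI1.
have [F [pr [prs pr0]]] := field_quotient hJ nJ1 maxJ.
pose g : {rmorphism L -> F} := pr \o polyC.
have prE q : (map_poly g q).[pr 'X] = pr q.
  elim/poly_ind: q => [|q c IH]; first by rewrite !rmorph0 horner0.
  by rewrite !rmorphD !rmorphM /= map_polyX map_polyC hornerMXaddC IH.
exists F, g, (pr 'X); split; last first.
  by rewrite /root prE; apply/eqP/pr0/IJ; rewrite /I dvdpp.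
exists [seq pr 'X ^+ i | i <- index_iota 0 (size p)] => U hU Us y.
have [q <-] := prs y.
have -> : pr q = pr (q %% p).
  rewrite {1}(divp_eq q p) rmorphD; apply/eqP; rewrite -subr_eq0 addrK.
  by apply/eqP/pr0/IJ; rewrite /I dvdp_mull.
have sq : (size (q %% p)%R < size p)%N by rewrite ltn_modp -size_poly_gt0 ltnW.
rewrite -prE horner_coef; apply: (@subsp_sum L (Alg g)) => // i _.
rewrite coef_map; apply: (@subspZ L (Alg g)) => //; apply: Us.
apply/mapP; exists (nat_of_ord i) => //; rewrite mem_index_iota /=.
by apply: leq_trans (ltnW sq); apply: leq_trans (ltn_ord i) (size_poly _ _).
Qed.

(** Let a be a root of p in an extension. Either v(X - a) = 0 and v is an eigenvector of [X], or v(X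
    - a) is still a common eigenvector of [s], since [X] commutes with [s], and is annihilated by
    p/(T - a), of smaller degree. *)
Lemma eigen_step (m : nat) (L : fieldType) n (X : 'M[L]_n.+1) (s : seq 'M[L]_n.+1)
    (v : 'rV[L]_n.+1) (p : {poly L}) :
  (size p <= m)%N -> p != 0 -> v != 0 -> v *m horner_mx X p = 0 ->
  (forall Y, Y \in s -> X *m Y = Y *m X /\ exists a, v *m Y = a *: v) ->
  exists (L' : fieldType) (g : {rmorphism L -> L'}) (w : 'rV[L']_n.+1),
    [/\ finite_ext g, w != 0 &
      forall Y, Y \in X :: s -> exists a, w *m map_mx g Y = a *: w].
Proof.
elim: m L X s v p => [|m IH] L X s v p.
  by rewrite leqn0 size_poly_eq0 => /eqP->; rewrite eqxx.
move=> sp p0 v0 vp hs; have [sp1|sp1] := leqP (size p) 1.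
  case/eqP: v0; move: vp p0; rewrite (size1_polyC sp1) horner_mx_C mul_mx_scalar.
  rewrite polyC_eq0 => /(congr1 (fun w => (p`_0)^-1 *: w)).
  by rewrite scalerA scaler0 => + c0; rewrite mulVf // scale1r.
have [L1 [g1 [a [fg1 /factor_theorem[q qE]]]]] := root_extension sp1.
pose v1 := map_mx g1 v; pose X1 := map_mx g1 X; pose w := v1 *m (X1 - a%:M).
have q0 : q != 0.
  apply: contraNneq p0 => q0; move: qE; rewrite q0 mul0r => /eqP.
  by rewrite map_poly_eq0.
have [w0|w0] := eqVneq w 0.
  exists L1, g1, v1; split=> //; first by rewrite map_mx_eq0.
  move=> Y; rewrite inE => /orP[/eqP->|/hs[_ [b vY]]].
    by exists a; apply/eqP; rewrite -subr_eq0 -mul_mx_scalar -mulmxBr; apply/eqP.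
  by exists (g1 b); rewrite -map_mxM vY map_mxZ.
have wq : w *m horner_mx X1 q = 0.
  have: map_mx g1 (v *m horner_mx X p) = 0 by rewrite vp map_mx0.
  rewrite map_mxM map_horner_mx qE mulrC rmorphM rmorphB /=.
  by rewrite horner_mx_X horner_mx_C -[_ * horner_mx _ _]/(_ *m _) mulmxA.
have [|Y /mapP[Z Zs ->]|L2 [g2 [z [fg2 z0 hz]]]] :=
    IH L1 X1 [seq map_mx g1 Y | Y <- s] w q _ q0 w0 wq.
- rewrite -ltnS; apply: leq_trans sp; move: (congr1 (fun r : {poly L1} => size r) qE).
  by rewrite size_map_poly size_Mmonic ?monicXsubC // size_XsubC addn2 /= => ->.
- have [XZ [b vZ]] := hs Z Zs; split; first by rewrite -!map_mxM XZ.
  have XaZ : (X1 - a%:M) *m map_mx g1 Z = map_mx g1 Z *m (X1 - a%:M).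
    by rewrite mulmxBl mulmxBr -!map_mxM XZ -scalar_mxC.
  by exists (g1 b); rewrite /w -mulmxA XaZ mulmxA -map_mxM vZ map_mxZ -scalemxAl.
exists L2, (g2 \o g1), z; split=> //; first exact: finite_ext_comp fg1 fg2.
move=> Y Ys; have [|b zb] := hz (map_mx g1 Y).
  move: Ys; rewrite !inE => /orP[/eqP->|Ys]; first by rewrite eqxx.
  by rewrite (map_f (fun Z : 'M_n.+1 => map_mx g1 Z)) ?orbT.
exists b; rewrite -zb; congr (_ *m _); by apply/matrixP => i j; rewrite !mxE.
Qed.

Lemma commuting_eigenvector (L : fieldType) n (s : seq 'M[L]_n.+1) :
  (forall X Y, X \in s -> Y \in s -> X *m Y = Y *m X) ->
  exists (L' : fieldType) (g : {rmorphism L -> L'}) (w : 'rV[L']_n.+1),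
    [/\ finite_ext g, w != 0 &
      forall Y, Y \in s -> exists a, w *m map_mx g Y = a *: w].
Proof.
elim: s => [|X s IH] comm.
  exists L, idfun, (delta_mx 0 0); split=> //; first exact: finite_ext_id.
  by apply/eqP => /matrixP/(_ 0 0)/eqP; rewrite !mxE !eqxx oner_eq0.
have [|L1 [g1 [w [fg1 w0 hw]]]] := IH.
  by move=> Y Z Ys Zs; apply: comm; rewrite inE ?Ys ?Zs orbT.
pose X1 := map_mx g1 X; pose s1 := [seq map_mx g1 Y | Y <- s].
have [||Y /mapP[Z Zs ->]|L2 [g2 [z [fg2 z0 hz]]]] :=
    @eigen_step _ L1 n X1 s1 w (char_poly X1) (leqnn _) _ w0.
- by rewrite -size_poly_eq0 size_char_poly.
- by rewrite Cayley_Hamilton mulmx0.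
- by split; [rewrite -!map_mxM comm // inE ?eqxx ?Zs ?orbT | apply: hw].
exists L2, (g2 \o g1), z; split=> //; first exact: finite_ext_comp fg1 fg2.
move=> Y Ys; have [|b zb] := hz (map_mx g1 Y).
  move: Ys; rewrite !inE => /orP[/eqP->|Ys]; first by rewrite eqxx.
  by rewrite (map_f (fun Z : 'M_n.+1 => map_mx g1 Z)) ?orbT.
exists b; rewrite -zb; congr (_ *m _); by apply/matrixP => i j; rewrite !mxE.
Qed.
End FiniteExtensions.

Section Trigonalization.
Variables (K : fieldType) (G : affGrp K) (r : nat) (c : nat -> coord_ring G).

(** All sizes and all finite extensions are allowed at once, with [c] fixed: the induction in
    [trigonalize] replaces a representation by a quotient over a larger field. *)
Definition has_stable_line := forall (L : fieldType) (f : {rmorphism K -> L}) n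
    (M : nat -> 'M[L]_n.+1), finite_ext f -> is_rep f r c M ->
  exists (L' : fieldType) (g : {rmorphism L -> L'}) (v : 'rV[L']_n.+1),
    [/\ finite_ext g, v != 0 &
      forall k, (k < r)%N -> exists a, v *m map_mx g (M k) = a *: v].

Lemma trigonalize n (L : fieldType) (f : {rmorphism K -> L}) (M : nat -> 'M[L]_n) :
  has_stable_line -> finite_ext f -> is_rep f r c M ->
  exists (L' : fieldType) (g : {rmorphism L -> L'}) (P : 'M[L']_n),
    [/\ finite_ext g, P \in unitmx &
      forall k, (k < r)%N -> is_trig_mx (P *m map_mx g (M k) *m invmx P)].
Proof.
move=> line; elim: n L f M => [|n IH] L f M ff hM.
  exists L, idfun, 1%:M; split; first exact: finite_ext_id.
    exact: unitmx1.
  by move=> k _; apply/is_trig_mxP => -[].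
have [L1 [g1 [v [fg1 v0 hv]]]] := line L f n M ff hM.
pose M1 k := map_mx g1 (M k); pose f1 : {rmorphism K -> L1} := g1 \o f.
have hM1 : is_rep f1 r c M1 by apply: is_rep_map hM.
have ff1 : finite_ext f1 by apply: finite_ext_comp ff fg1.
(* As [v] has rank one, this completes it to a basis whose first row is proportional to [v]. *)
pose P1 : 'M_(1 + n) := row_ebase v.
have P1u : P1 \in unitmx by apply: row_ebase_unit.
have [al vE] : exists al, v = al *: row 0 P1.
  have := mulmx_ebase v; rewrite -/P1; set C := col_ebase v => E.
  have rv : \rank v = 1%N by apply/eqP; rewrite rank_rV v0.
  exists (C 0 0); rewrite -{1}E rv [C]mx11_scalar mul_scalar_mx -scalemxAl mxE eqxx mulr1n.
  congr (_ *: _); apply/rowP => j; rewrite !mxE (bigD1 0) //= big1 => [|i i0].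
    by rewrite !mxE eqxx mul1r addr0.
  by rewrite !mxE eq_sym (negPf i0 : (i == 0 :> nat) = false) mul0r.
have al0 : al != 0 by apply: contraNneq v0 => al0; rewrite vE al0 scale0r.
pose N k := P1 *m M1 k *m invmx P1.
have hN : is_rep f1 r c N.
  apply: is_rep_conj hM1; first exact: mulmxV.
  by move=> k _; exists (N k); rewrite /N mulmxKV.
have Nrow k : (k < r)%N -> exists a, row 0 (N k) = a *: delta_mx 0 0.
  move=> kr; have [a va] := hv k kr; exists a.
  rewrite /N !row_mul; have -> : row 0 P1 = al^-1 *: v by rewrite vE scalerA mulVf ?scale1r.
  rewrite -scalemxAl va scalerA mulrC -scalerA -scalemxAl; congr (_ *: _).
  rewrite vE scalerA mulVf // scale1r -row_mul mulmxV //.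
  by apply/rowP => j; rewrite !mxE eqxx eq_sym.
have Nur k : (k < r)%N -> ursubmx (N k : 'M_(1 + n)) = 0.
  move=> kr; have [a /rowP ra] := Nrow k kr; apply/matrixP => i j; rewrite !mxE.
  have := ra (rshift 1 j); rewrite !mxE ord1 /=; have -> : lshift n 0 = 0 :> 'I_(1 + n).
    exact: val_inj.
  by move=> ->; rewrite mulr0.
(* The representation on the quotient by the stable line; taking this block is multiplicative
   because the upper right block vanishes. *)
pose N' k := drsubmx (N k : 'M_(1 + n)).
have hN' : is_rep f1 r c N'.
  move=> R u hu; have [rM r1] := hN R u hu.
  have rE (x : G R) : rho r c N' u x = drsubmx (rho r c N u x : 'M_(1 + n)).
    apply/matrixP => i j; rewrite /rho !mxE !summxE.
    by apply: eq_bigr => k _; rewrite !mxE.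
  have rur (x : G R) : ursubmx (rho r c N u x : 'M_(1 + n)) = 0.
    apply/matrixP => i j; rewrite /rho !mxE summxE; apply: big1 => k _.
    have /matrixP/(_ i j) := Nur k (ltn_ord k); rewrite !mxE => ->.
    by rewrite rmorph0 mulr0.
  split=> [x y|]; rewrite !rE.
    rewrite rM -[rho r c N u x in LHS](@submxK _ 1 n 1 n).
    rewrite -[rho r c N u y in LHS](@submxK _ 1 n 1 n) mulmx_block block_mxKdr.
    by rewrite rur mulmx0 add0r.
  by rewrite r1 -[1%:M]/(1%:M : 'M_(1 + n)) scalar_mx_block block_mxKdr.
have [L2 [g2 [P2 [fg2 P2u hP2]]]] := IH L1 f1 N' ff1 hN'.
pose D : 'M_(1 + n) := block_mx 1%:M 0 0 P2.
have Du : D \in unitmx by rewrite unitmxE det_lblock det1 mul1r -unitmxE.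
have DV : invmx D = block_mx 1%:M 0 0 (invmx P2).
  apply: (can_inj (mulKmx Du)); rewrite mulmxV // mulmx_block.
  by rewrite !mulmx0 !mul0mx mulmx1 !addr0 add0r mulmxV // -scalar_mx_block.
exists L2, (g2 \o g1), (D *m map_mx g2 P1); split.
- exact: finite_ext_comp fg1 fg2.
- by rewrite unitmx_mul Du map_unitmx.
move=> k kr.
have -> : D *m map_mx g2 P1 *m map_mx (g2 \o g1) (M k) *m invmx (D *m map_mx g2 P1) =
    D *m map_mx g2 (N k) *m invmx D.
  have -> : map_mx (g2 \o g1) (M k) = map_mx g2 (M1 k).
    by apply/matrixP => i j; rewrite !mxE.
  pose Q := map_mx g2 P1; have Qu : Q \in unitmx by rewrite map_unitmx.
  have DQu : D *m Q \in unitmx by rewrite unitmx_mul Du.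
  have -> : invmx (D *m Q) = invmx Q *m invmx D.
    apply: (can_inj (mulKmx DQu)).
    by rewrite mulmxV // mulmxA -[D *m Q *m _]mulmxA mulmxV // mulmx1 mulmxV.
  by rewrite /Q -map_invmx /N !map_mxM !mulmxA.
rewrite DV -[N k](@submxK _ 1 n 1 n) Nur // map_block_mx map_mx0 !mulmx_block.
rewrite !mulmx0 !mul0mx !mul1mx !mulmx1 !addr0 !add0r.
rewrite (@is_trig_block_mx _ 1 n 1 n) //. rewrite mul0mx eqxx hP2 // andbT /=.
by apply/is_trig_mxP => i j; rewrite !ord1.
Qed.
End Trigonalization.

(** * Free modules and flags *)

Section FreeModules.
Variable k : comNzRingType.

Section Coordinates.
Variables (E : lmodType k) (n : nat) (e : 'I_n -> E) (co : 'I_n -> E -> k).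
Hypothesis co_lin : forall j a x y, co j (a *: x + y) = a * co j x + co j y.
Hypothesis co_gen : forall x, x = \sum_j co j x *: e j.
Hypothesis co_dual : forall i j, co i (e j) = (i == j)%:R.

Section Into.
Variable R : alg k.

Definition coord_row (x : E) : 'rV[R]_n := \row_j str R (co j x).

Fact coord_row_zmod : zmod_morphism coord_row.
Proof.
move=> x y; apply/rowP => j; rewrite !mxE -rmorphB; congr (str R _).
by rewrite -[x - y]addrC -scaleN1r co_lin mulN1r addrC.
Qed.

Fact coord_row_scal : scalable_for (str R \; *:%R) coord_row.
Proof.
move=> a x; apply/rowP => j; rewrite !mxE -rmorphM; congr (str R _).
have co0 : co j 0 = 0.
  have /eqP := co_lin j 1 0 0; rewrite scale1r addr0 mul1r -subr_eq0 opprD addrA.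
  by rewrite subrr sub0r oppr_eq0 => /eqP.
by rewrite -[a *: x]addr0 co_lin co0 addr0.
Qed.

HB.instance Definition _ := GRing.isZmodMorphism.Build E 'rV[R]_n coord_row coord_row_zmod.
HB.instance Definition _ := GRing.isScalable.Build k E 'rV[R]_n (str R \; *:%R) coord_row coord_row_scal.

Definition coord_in : {linear E -> 'rV[R]_n | str R \; *:%R} := coord_row.

Lemma coord_in_e j : coord_in (e j) = delta_mx 0 j.
Proof.
by apply/rowP => i; rewrite !mxE co_dual eqxx /= rmorph_nat.
Qed.

Section Out.
Variables (N : lmodType R) (f : {linear E -> N | str R \; *:%R}).

Definition coord_out (y : 'rV[R]_n) : N := \sum_j y 0 j *: f (e j).

Fact coord_out_linear : linear coord_out.
Proof.
move=> a y z; rewrite /coord_out scaler_sumr -big_split; apply: eq_bigr => j _.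
by rewrite !mxE scalerDl scalerA.
Qed.

HB.instance Definition _ := GRing.isLinear.Build R 'rV[R]_n N _ coord_out coord_out_linear.
End Out.

Lemma coord_base_change : is_base_change coord_in.
Proof.
move=> N f; exists (coord_out f); split=> [x|g' hg' y] /=.
  rewrite {2}(co_gen x) linear_sum; apply: eq_bigr => j _.
  by rewrite linearZ /= mxE.
rewrite {1}(row_sum_delta y) linear_sum; apply: eq_bigr => j _.
by rewrite linearZ /= -coord_in_e hg'.
Qed.
End Into.

Lemma coord_locally_free (P : pred nat) : P n -> locally_free E P.
Proof.
(* The cover by the single basic open D(1). *)
move=> Pn; exists 1%N, (fun=> 1), (fun=> 1), (fun=> n); split=> [|_].
  by rewrite big_ord1 mulr1.
by split=> // R _; exists (coord_in R); apply: coord_base_change.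
Qed.
End Coordinates.

Section Rows.
Variable n : nat.
Local Notation E := 'rV[k]_n.

Definition rowco (j : 'I_n) (x : E) : k := x 0 j.

Lemma rowco_lin j a (x y : E) : rowco j (a *: x + y) = a * rowco j x + rowco j y.
Proof. by rewrite /rowco !mxE. Qed.

Lemma rowco_gen (x : E) : x = \sum_j rowco j x *: delta_mx 0 j.
Proof. exact: row_sum_delta. Qed.

Lemma rowco_dual (i j : 'I_n) : rowco i (delta_mx 0 j) = (i == j)%:R.
Proof. by rewrite /rowco mxE eqxx. Qed.

Lemma row_locally_free (P : pred nat) : P n -> locally_free E P.
Proof. exact: coord_locally_free rowco_lin rowco_gen rowco_dual P. Qed.

Section RowMap.
Variables (R R' : alg k) (u : algHom R R').

Definition row_map (x : 'rV[R]_n) : 'rV[R']_n := map_mx u x.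

Fact row_map_zmod : zmod_morphism row_map.
Proof. by move=> x y; rewrite /row_map map_mxB. Qed.

Fact row_map_scal : scalable_for (u \; *:%R) row_map.
Proof. by move=> a x; rewrite /row_map map_mxZ. Qed.

HB.instance Definition _ := GRing.isZmodMorphism.Build _ _ row_map row_map_zmod.
HB.instance Definition _ := GRing.isScalable.Build R 'rV[R]_n 'rV[R']_n (u \; *:%R) row_map row_map_scal.
End RowMap.

Fact row_pull_mapE (R R' : alg k) (u : algHom R R') (x : E) :
  row_map u (coord_in rowco_lin R x) = coord_in rowco_lin R' x.
Proof. by apply/rowP => j; rewrite !mxE alg_homE. Qed.

Definition row_pullbacks : pullbacks E :=
  @Pullbacks k E (fun R => 'rV[R]_n) (coord_in rowco_lin)
    (fun R => coord_base_change rowco_lin rowco_gen rowco_dual (R := R))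
    (fun R R' u => row_map u) row_pull_mapE.
End Rows.
End FreeModules.

Section MatrixAction.
Variables (k : comNzRingType) (G : grpFunctor k) (d : nat).
Variable act : forall R : alg k, G R -> 'M[R]_d.
Hypothesis act1 : forall R : alg k, act (1%g : G R) = 1%:M.
Hypothesis actM : forall (R : alg k) (g h : G R), act (g * h)%g = act h *m act g.
Hypothesis act_nat : forall (R R' : alg k) (u : algHom R R') (g : G R),
  act (fmap G u g) = map_mx u (act g).

Definition row_equivariant : equivariant G 'rV[k]_d.
Proof.
apply: (@Equivariant k G _ (row_pullbacks k d) (fun R g => mulmxr (act g))).
- by move=> R x; rewrite /= act1 mulmx1.
- by move=> R g h x; rewrite /= actM mulmxA.
- by move=> R R' u g x; rewrite /= act_nat /row_map map_mxM.
Defined.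
End MatrixAction.

Section LowRows.
Variables (k : comNzRingType) (d : nat).

(** Rows supported on the first d - i coordinates. They are preserved by right multiplication with
    lower triangular matrices, and the index runs so that the filtration decreases from everything
    to 0. *)
Definition low_rows (i : nat) : {pred 'rV[k]_d} :=
  fun x => [forall j : 'I_d, (d - i <= j)%N ==> (x 0 j == 0)].

Lemma low_rowsP i (x : 'rV[k]_d) :
  reflect (forall j : 'I_d, (d - i <= j)%N -> x 0 j = 0) (x \in low_rows i).
Proof.
apply: (iffP forallP) => [h j ij|h j]; first exact/eqP/(implyP (h j)).
by apply/implyP => /h ->.
Qed.

Lemma low_rows_submod i : GRing.submod_closed (low_rows i).
Proof.
split=> [|a x y /low_rowsP hx /low_rowsP hy]; apply/low_rowsP => j ij.
  by rewrite mxE.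
by rewrite !mxE hx // hy // mulr0 addr0.
Qed.

Lemma low_rows_quotient i : (i < d)%N ->
  {subset low_rows i.+1 <= low_rows i} /\
  exists (L : lmodType k) (q : 'rV[k]_d -> L),
    line_bundle L /\ is_quotient (low_rows i) (low_rows i.+1) q.
Proof.
move=> id; split=> [x /low_rowsP hx|].
  by apply/low_rowsP => j ij; apply: hx; apply: leq_trans ij; apply: leq_sub2l.
(* The only coordinate that is free in [low_rows i] and forced to be 0 in [low_rows i.+1]; it gives
   the quotient map. *)
have j0P : (d - i.+1 < d)%N by rewrite -subn_gt0 subKn.
pose j0 := Ordinal j0P.
exists 'rV[k]_1, (fun x => const_mx (x 0 j0)); split; first exact: row_locally_free.
split=> [a x y _ _|x /low_rowsP hx|z].
- by apply/rowP => j; rewrite !mxE.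
- apply/eqP/low_rowsP => [/rowP/(_ 0)|hx0].
    rewrite !mxE => xj0 j; rewrite leq_eqVlt => /orP[/eqP jE|ij].
      by rewrite -xj0; congr (x 0 _); apply: val_inj.
    by apply: hx; rewrite subnS in ij; apply: leq_trans ij; apply: leqSpred.
  by apply/rowP => j; rewrite !mxE hx0 /=.
- exists (z 0 0 *: delta_mx 0 j0).
    apply/low_rowsP => j ij; rewrite !mxE eqxx /=.
    have -> : (j == j0) = false; last by rewrite mulr0.
    have lt : (d - i.+1 < d - i)%N by rewrite subnS prednK // subn_gt0.
    exact: gtn_eqF (leq_trans lt ij).
  by apply/rowP => j; rewrite !mxE !eqxx mulr1 ord1.
Qed.
End LowRows.

Lemma trigonalizable_of_trig_matrices (k : comNzRingType) (G : grpFunctor k) d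
    (act : forall R : alg k, G R -> 'M[R]_d) :
  (forall R : alg k, act R 1%g = 1%:M) ->
  (forall (R : alg k) (g h : G R), act R (g * h)%g = act R h *m act R g) ->
  (forall (R R' : alg k) (u : algHom R R') (g : G R),
     act R' (fmap G u g) = map_mx u (act R g)) ->
  (forall (R : alg k) (g h : G R), act R g = act R h -> g = h) ->
  (forall (R : alg k) (g : G R), is_trig_mx (act R g)) ->
  Defs.trigonalizable G.
Proof.
move=> act1 actM act_nat act_inj act_trig.
exists 'rV[k]_d, (row_equivariant act1 actM act_nat), d, (@low_rows k d); split.
- exact: row_locally_free.
- move=> W s R g h E; apply: act_inj; apply/row_matrixP => i.
  by rewrite !rowE; apply: E.
- split=> x; rewrite ?inE; first by apply/low_rowsP => j; rewrite subn0 leqNgt ltn_ord.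
  apply/low_rowsP/eqP => [h|-> j _]; last by rewrite mxE.
  by apply/rowP => j; rewrite mxE; apply: h; rewrite subnn.
- move=> i _; split; first exact: low_rows_submod.
  move=> R g x /low_rowsP hx; pose w := map_mx (str R) x *m act R g.
  exists d, (fun j : 'I_d => w 0 j), (fun j : 'I_d => if (j < d - i)%N then delta_mx 0 j else 0).
  split=> [j|].
    case: ifP => ji; last by apply/low_rowsP => l _; rewrite mxE.
    apply/low_rowsP => l il; rewrite mxE eqxx /=.
    by rewrite [l == j](gtn_eqF (leq_trans ji il)).
  have wj (j : 'I_d) : (d - i <= j)%N -> w 0 j = 0.
    move=> ij; rewrite mxE; apply: big1 => l _; rewrite mxE.
    have [il|li] := leqP (d - i) l; first by rewrite hx // rmorph0 mul0r.
    by rewrite (is_trig_mxP (act_trig R g)) ?mulr0 //; apply: leq_trans ij.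
  transitivity w; first by congr (_ *m _); apply/rowP => j; rewrite !mxE.
  rewrite {1}(row_sum_delta w); apply: eq_bigr => j _.
  case: ltnP => ji; last by rewrite wj // !scale0r.
  by congr (_ *: _); apply/rowP => l; rewrite !mxE /rowco mxE eqxx /= rmorph_nat.
- by move=> i id; apply: low_rows_quotient.
Qed.

Lemma finite_ext_vector_bundle (K L : fieldType) (f : {rmorphism K -> L}) :
  finite_ext f -> vector_bundle (restr_mod (Alg f)).
Proof.
case=> s hs; have [d [y [phi [fphi dual _ ex]]]] := @finite_dual_family K (Alg f) s.
have gen x : x = \sum_(i < d) str (Alg f) (phi i x) * y i.
  move: x; apply: hs => [|x /ex //]; split=> [|c u v hu hv].
    by rewrite big1 // => i _; rewrite fnl0 // rmorph0 mul0r.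
  rewrite {1}hu {1}hv mulr_sumr -big_split; apply: eq_bigr => i _.
  by rewrite fphi rmorphD rmorphM mulrDl mulrA.
apply: (@coord_locally_free K (restr_mod (Alg f)) d (fun i => y i)
  (fun i => phi i : restr_mod (Alg f) -> K)) => // [j a u v|i j].
  exact: fphi.
exact: dual.
Qed.

Lemma field_spec_surjective (K L : fieldType) (f : {rmorphism K -> L}) :
  spec_surjective (Alg f).
Proof.
move=> p [[p0 p1 pl] _]; exists (pred1 0 : {pred L}).
  split; first split; rewrite ?inE ?eqxx ?oner_eq0 //.
    by move=> a u v; rewrite !inE => /eqP-> /eqP->; rewrite mulr0 addr0.
  by move=> u v; rewrite !inE mulf_eq0.
move=> c; rewrite inE /= fmorph_eq0; apply/eqP/idP => [->//|cp].
apply: contraNeq p1 => c0; have := pl c^-1 c 0 cp p0.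
by rewrite addr0 mulVf.
Qed.

Section Assembly.
Variables (K : fieldType) (G : affGrp K).
Hypothesis hft : finite_type (coord_ring G).

Lemma locally_trigonalizable_of_lines :
  (forall r (c : nat -> coord_ring G) (chi : nat -> coord_ring G -> K),
    (forall k, functional (chi k)) ->
    (forall i j, (i < r)%N -> (j < r)%N -> chi i (c j) = (i == j)%:R) ->
    has_stable_line r c) ->
  locally_trigonalizable G.
Proof.
move=> lines; have [r [c [chi [d [M [fchi dual rM r1 rinj]]]]]] := faithful_matrices hft.
have hM : is_rep (@idfun K : {rmorphism K -> K}) r c M.
  move=> R u hu; have rE (x : G R) : rho r c M u x = rho r c M (str R) x.
    apply: eq_bigr => k _; congr (_ *: _); apply/matrixP => i j.
    by rewrite !mxE -hu.
  by split=> [x y|]; rewrite !rE.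
have [L [g [P [fg Pu trig]]]] :=
  trigonalize (lines r c chi fchi dual) (@finite_ext_id K) hM.
pose N k := P *m map_mx g (M k) *m invmx P.
have hN : is_rep g r c N.
  apply: is_rep_conj (is_rep_map (f' := g) _ hM) => //; first exact: mulmxV.
  by move=> k _; exists (N k); rewrite /N mulmxKV.
exists (Alg g); split.
- exact: finite_ext_vector_bundle.
- exact: field_spec_surjective.
apply: (@trigonalizable_of_trig_matrices L (base_change G (Alg g)) d
  (fun R x => @rho K G r c L d N (restr g R) (str R) x)).
- by move=> R; have [] := hN (restr g R) (str R) (fun=> erefl).
- by move=> R x y; have [] := hN (restr g R) (str R) (fun=> erefl).
- move=> R R' u x; rewrite /rho map_mx_sum; apply: eq_bigr => k _.
  apply/matrixP => i j; rewrite !mxE; apply: etrans (esym (rmorphM u _ _)).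
  congr (_ * _); last exact: esym (alg_homE u _).
  exact: (ev_nat (restrHom g u) x (c k)).
(* Undoing the conjugation by [P] recovers the original faithful matrices. *)
- move=> R x y E; apply: (rinj (restr g R)).
  have PE (z : G (restr g R)) : @rho K G r c K d M (restr g R) (str (restr g R)) z =
      map_mx (str R) (invmx P) *m @rho K G r c L d N (restr g R) (str R) z *m map_mx (str R) P.
    rewrite /rho mulmx_sumr mulmx_suml; apply: eq_bigr => k _.
    rewrite -scalemxAr -scalemxAl -!map_mxM !mulmxA mulVmx // mul1mx mulmxKV //.
    by congr (_ *: _); apply/matrixP => i j; rewrite !mxE.
  by rewrite !PE E.
- move=> R x; apply/is_trig_mxP => i j ij; rewrite summxE; apply: big1 => k _.
  have Nij : N k i j = 0 by apply: (is_trig_mxP (trig k (ltn_ord k))).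
  by rewrite mxE [map_mx _ _ i j]mxE Nij rmorph0 mulr0.
Qed.

Lemma commutative_stable_line r (c : nat -> coord_ring G) (chi : nat -> coord_ring G -> K) :
  (forall k, functional (chi k)) ->
  (forall i j, (i < r)%N -> (j < r)%N -> chi i (c j) = (i == j)%:R) ->
  commutative_grp G -> has_stable_line r c.
Proof.
move=> fchi dual cG L f n M _ hM.
have [|L' [g [v [fg v0 hv]]]] := @commuting_eigenvector L n [seq M k | k <- iota 0 r].
  move=> X Y /mapP[k + ->] /mapP[l + ->]; rewrite !mem_iota /= => kr lr.
  exact: (commutative_matrices hft fchi dual hM cG).
exists L', g, v; split=> // k kr; apply: hv; apply/mapP; exists k => //.
by rewrite mem_iota.
Qed.
End Assembly.

(** * Power series and families of augmented extensions *)

Definition domain (R : nzRingType) := forall x y : R, x * y = 0 -> x = 0 \/ y = 0.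

Record pseries (R : Type) := Pseries { cf : nat -> R }.

Section PowerSeries.
Variable R : comNzRingType.
Local Notation PS := (pseries R).

HB.instance Definition _ := gen_eqMixin PS.
HB.instance Definition _ := gen_choiceMixin PS.

Lemma psP (f g : PS) : cf f =1 cf g -> f = g.
Proof. by case: f g => f [g] /= /funext ->. Qed.

Definition ps_add (f g : PS) := Pseries (fun n => cf f n + cf g n).
Definition ps_opp (f : PS) := Pseries (fun n => - cf f n).
Definition ps_cst (c : R) := Pseries (fun n => if n is 0 then c else 0).
Definition ps_mul (f g : PS) :=
  Pseries (fun n => \sum_(i < n.+1) cf f i * cf g (n - i)).

Fact ps_addA : associative ps_add.
Proof. by move=> f g h; apply: psP => n /=; rewrite addrA. Qed.
Fact ps_addC : commutative ps_add.
Proof. by move=> f g; apply: psP => n /=; rewrite addrC. Qed.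
Fact ps_add0 : left_id (ps_cst 0) ps_add.
Proof. by move=> f; apply: psP => -[|n] /=; rewrite add0r. Qed.
Fact ps_addN : left_inverse (ps_cst 0) ps_opp ps_add.
Proof. by move=> f; apply: psP => -[|n] /=; rewrite addNr. Qed.

HB.instance Definition _ :=
  GRing.isZmodule.Build PS ps_addA ps_addC ps_add0 ps_addN.

(** A coefficient of a product of series sees only truncations, so commutativity and associativity
    are inherited from polynomials. *)
Definition trunc (n : nat) (f : PS) : {poly R} := \poly_(i < n) cf f i.

Lemma coef_truncM n m (f g : PS) : (m < n)%N ->
  (trunc n f * trunc n g)`_m = cf (ps_mul f g) m.
Proof.
move=> mn; rewrite coefM; apply: eq_bigr => i _; rewrite !coef_poly.
by rewrite (leq_ltn_trans _ mn) ?(leq_ltn_trans _ mn) // ?leq_subr // -ltnS.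
Qed.

Fact ps_mulC : commutative ps_mul.
Proof.
by move=> f g; apply: psP => n; rewrite -!(coef_truncM _ _ (ltnSn n)) mulrC.
Qed.

Lemma coef_truncMr n m (f : PS) (p : {poly R}) : (m < n)%N ->
  (p * trunc n f)`_m = \sum_(i < m.+1) p`_i * cf f (m - i).
Proof.
move=> mn; rewrite coefM; apply: eq_bigr => i _; rewrite coef_poly.
by rewrite (leq_ltn_trans _ mn) // leq_subr.
Qed.

Lemma ps_mulAl (f g h : PS) n :
  cf (ps_mul (ps_mul f g) h) n = (trunc n.+1 f * trunc n.+1 g * trunc n.+1 h)`_n.
Proof.
rewrite coef_truncMr //; apply: eq_bigr => i _; rewrite coef_truncM //.
Qed.

Fact ps_mulA : associative ps_mul.
Proof.
move=> f g h; apply: psP => n; rewrite ps_mulAl.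
by rewrite (ps_mulC f) ps_mulAl mulrC mulrA.
Qed.
Fact ps_mul1 : left_id (ps_cst 1) ps_mul.
Proof.
move=> f; apply: psP => n /=; rewrite big_ord_recl /= mul1r subn0.
by rewrite big1 ?addr0 // => i _; rewrite mul0r.
Qed.
Fact ps_mulD : left_distributive ps_mul ps_add.
Proof.
move=> f g h; apply: psP => n /=; rewrite -big_split; apply: eq_bigr => i _ /=.
by rewrite mulrDl.
Qed.
Fact ps_1neq0 : ps_cst 1 != 0 :> PS.
Proof. by apply/eqP => /(congr1 (fun f => cf f 0))/eqP; rewrite oner_eq0. Qed.

HB.instance Definition _ :=
  GRing.Zmodule_isComNzRing.Build PS ps_mulA ps_mulC ps_mul1 ps_mulD ps_1neq0.

Lemma cfD (f g : PS) n : cf (f + g) n = cf f n + cf g n. Proof. by []. Qed.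
Lemma cfB (f g : PS) n : cf (f - g) n = cf f n - cf g n. Proof. by []. Qed.
Lemma cf0 n : cf (0 : PS) n = 0. Proof. by case: n. Qed.
Lemma cfM (f g : PS) n : cf (f * g) n = \sum_(i < n.+1) cf f i * cf g (n - i).
Proof. by []. Qed.
Lemma cf_cstM c (f : PS) n : cf (ps_cst c * f) n = c * cf f n.
Proof.
rewrite cfM big_ord_recl /= subn0 big1 ?addr0 // => i _; by rewrite mul0r.
Qed.

Lemma cf_sum (J : Type) (s : seq J) (P : pred J) (F : J -> PS) n :
  cf (\sum_(j <- s | P j) F j) n = \sum_(j <- s | P j) cf (F j) n.
Proof. exact: (big_morph (fun f : PS => cf f n) (fun f g => cfD f g n) (cf0 n)). Qed.

Lemma ps_cstB : {morph ps_cst : x y / x - y}.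
Proof. by move=> x y; apply: psP => -[|n] //=; rewrite subr0. Qed.
Lemma ps_cstM : {morph ps_cst : x y / x * y}.
Proof. by move=> x y; apply: psP => -[|n]; rewrite cf_cstM //= mulr0. Qed.

Definition psC : {rmorphism R -> PS} := mk_rmorphism ps_cstB ps_cstM erefl.

Definition ps_eval0 (f : PS) := cf f 0.

Fact ps_eval0B : {morph ps_eval0 : f g / f - g}. Proof. by []. Qed.
Fact ps_eval0M : {morph ps_eval0 : f g / f * g}.
Proof. by move=> f g; rewrite /ps_eval0 cfM big_ord1. Qed.

Definition ps_aug : {rmorphism PS -> R} :=
  mk_rmorphism ps_eval0B ps_eval0M erefl.

Lemma ps_domain : domain R -> domain PS.
Proof.
move=> dR f g fg; have [|f0] := pselect (f = 0); first by left.
have [|g0] := pselect (g = 0); first by right.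
have low (h : PS) : h <> 0 -> exists n, cf h n <> 0 /\ forall m, (m < n)%N -> cf h m = 0.
  move=> h0; have ex : exists n, cf h n != 0.
    by apply: contrapT => no; apply: h0; apply: psP => n; rewrite cf0;
      apply/eqP/negPn/negP => hn; apply: no; exists n.
  case: (ex_minnP ex) => n hn min; exists n; split; first exact/eqP.
  by move=> m mn; apply/eqP/negPn/negP => /min; rewrite leqNgt mn.
have [a [fa fmin]] := low f f0; have [b [gb gmin]] := low g g0.
have := congr1 (fun h => cf h (a + b)) fg; rewrite cf0 cfM.
have aab : (a < (a + b).+1)%N by rewrite ltnS leq_addr.
rewrite (bigD1 (Ordinal aab)) //= big1 => [|i ia].
  by rewrite addr0 addKn => /dR[].
have [lt|gt|/eqP E] := ltngtP i a; last by rewrite -val_eqE /= E in ia.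
  by rewrite fmin // mul0r.
by rewrite gmin ?mulr0 // ltn_subLR ?ltn_add2r // -ltnS.
Qed.
End PowerSeries.

Section PowerSeriesMap.
Variables (R S : comNzRingType) (u : {rmorphism R -> S}).
Definition ps_map_fun (f : pseries R) : pseries S := Pseries (fun n => u (cf f n)).

Fact ps_map_funB : {morph ps_map_fun : f g / f - g}.
Proof. by move=> f g; apply: psP => n /=; rewrite rmorphB. Qed.
Fact ps_map_funM : {morph ps_map_fun : f g / f * g}.
Proof.
move=> f g; apply: psP => n; rewrite [LHS]rmorph_sum.
by apply: eq_bigr => i _; rewrite rmorphM.
Qed.
Fact ps_map_fun1 : ps_map_fun 1 = 1.
Proof. by apply: psP => -[|n]; rewrite /= ?rmorph1 ?rmorph0. Qed.

Definition ps_map := mk_rmorphism ps_map_funB ps_map_funM ps_map_fun1.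
End PowerSeriesMap.

(* A functorial family of augmented extensions F(R) of K-algebras, such as
   polynomials or power series over R, whose elements are determined by their
   R-linear coefficients. *)
Record fam (K : comNzRingType) := Fam {
  fob :> alg K -> alg K;
  fidx : Type;
  fcoef : forall R : alg K, fidx -> fob R -> R;
  fcst : forall R : alg K, algHom R (fob R);
  faug : forall R : alg K, algHom (fob R) R;
  fm : forall R S : alg K, algHom R S -> algHom (fob R) (fob S);
  fdom : forall R : alg K, domain R -> domain (fob R);
  fcoefB : forall (R : alg K) j, {morph @fcoef R j : x y / x - y};
  fcoefZ : forall (R : alg K) j c x, @fcoef R j (fcst R c * x) = c * fcoef j x;
  fcoef_inj : forall (R : alg K) (x : fob R), (forall j, fcoef j x = 0) -> x = 0;
  fcoef_m : forall (R S : alg K) (u : algHom R S) j x,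
    fcoef j (fm u x) = u (fcoef j x);
  faug_m : forall (R S : alg K) (u : algHom R S) x, faug S (fm u x) = u (faug R x);
  faug_cst : forall (R : alg K) c, faug R (fcst R c) = c;
  fm_cst : forall (R S : alg K) (u : algHom R S) c,
    fm u (fcst R c) = fcst S (u c) }.

Definition id_alg (K : comNzRingType) (R : alg K) : algHom R R :=
  @AlgHom K R R (@idfun R : {rmorphism R -> R}) (fun=> erefl).

Definition comp_alg (K : comNzRingType) (R S T : alg K) (v : algHom S T)
    (u : algHom R S) : algHom R T :=
  @AlgHom K R T (v \o u : {rmorphism R -> T})
    (fun c => etrans (congr1 v (alg_homE u c)) (alg_homE v c)).

Section Families.
Variable K : comNzRingType.

Definition ps_alg (R : alg K) : alg K := @Alg K (pseries R) (@psC R \o str R).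

Definition ps_fm (R S : alg K) (u : algHom R S) : algHom (ps_alg R) (ps_alg S).
Proof.
apply: (@AlgHom K (ps_alg R) (ps_alg S) (ps_map u)) => c.
by apply: psP => -[|n] /=; rewrite ?alg_homE ?rmorph0.
Defined.

Definition ps_fam : fam K.
Proof.
apply: (@Fam K ps_alg nat (fun R n f => cf f n)
  (fun R => @AlgHom K R (ps_alg R) (@psC R) (fun=> erefl))
  (fun R => @AlgHom K (ps_alg R) R (@ps_aug R) (fun=> erefl)) ps_fm).
- by move=> R; apply: ps_domain.
- by [].
- by move=> R j c x; apply: cf_cstM.
- by move=> R x x0; apply: psP => n; rewrite x0 cf0.
- by [].
- by [].
- by [].
- by move=> R S u c; apply: psP => -[|n] /=; rewrite ?rmorph0.
Defined.

Variable d : nat.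

Definition mp_alg (R : alg K) : alg K := @Alg K {mpoly R[d]} (@mpolyC d R \o str R).

Definition mp_aug (R : alg K) : algHom (mp_alg R) R.
Proof.
apply: (@AlgHom K (mp_alg R) R (mcoeff 0%MM : {rmorphism {mpoly R[d]} -> R})) => c.
by rewrite /= mcoeffC eqxx mulr1.
Defined.

Definition mp_fm (R S : alg K) (u : algHom R S) : algHom (mp_alg R) (mp_alg S).
Proof.
apply: (@AlgHom K (mp_alg R) (mp_alg S) (map_mpoly u)) => c /=.
by rewrite map_mpolyC; congr (_%:MP); exact: alg_homE.
Defined.

Lemma mpoly_domain (R : comNzRingType) : domain R -> domain {mpoly R[d]}.
Proof.
move=> dR; suff h : forall p q : {mpoly R[d]}, p * q = 0 -> p = 0 \/ q = 0 by exact: h.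
move=> p q pq; have [->|p0] := eqVneq p 0; first by left.
have [->|q0] := eqVneq q 0; first by right.
have lc0 : mleadc p * mleadc q != 0.
  by apply/eqP => /dR[] /eqP; rewrite mleadc_eq0; apply/negP.
have E := mleadcM_proper lc0; have F : mleadc (p * q) = 0 by rewrite pq mcoeff0.
by move: lc0; rewrite -E [mleadc _]F eqxx.
Qed.

Definition mp_fam : fam K.
Proof.
apply: (@Fam K mp_alg 'X_{1..d} (fun R m p => p@_m)
  (fun R => @AlgHom K R (mp_alg R) (@mpolyC d R) (fun=> erefl)) mp_aug mp_fm).
- by move=> R; apply: mpoly_domain.
- by move=> R m p q; rewrite /= mcoeffB.
- by move=> R m c p; rewrite /= mul_mpolyC mcoeffZ.
- by move=> R p p0; apply/mpolyP => m; rewrite p0 mcoeff0.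
- by move=> R S u m p; apply: mcoeff_map_mpoly.
- by move=> R S u p; apply: mcoeff_map_mpoly.
- by move=> R c; rewrite /= mcoeffC eqxx mulr1.
- by move=> R S u c; apply: map_mpolyC.
Defined.

(** Points over [F] and over [F'] both give points over the composite, where their parameters are
    independent. The ring K[lambda][[s]] is also of this form. *)
Definition comp_fam (F F' : fam K) : fam K.
Proof.
apply: (@Fam K (fun R => F' (F R)) (fidx F' * fidx F)%type
  (fun R j x => fcoef j.2 (fcoef j.1 x))
  (fun R => comp_alg (fcst F' (F R)) (fcst F R))
  (fun R => comp_alg (faug F R) (faug F' (F R)))
  (fun R S u => fm F' (fm F u))).
- by move=> R dR; apply/fdom/fdom.
- by move=> R [j' j] x y; rewrite !fcoefB.
- by move=> R [j' j] c x; rewrite /= !fcoefZ.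
- move=> R x x0; apply: fcoef_inj => j'; apply: fcoef_inj => j.
  exact: (x0 (j', j)).
- by move=> R S u [j' j] x; rewrite !fcoef_m.
- by move=> R S u x; rewrite /= !faug_m.
- by move=> R c; rewrite /= !faug_cst.
- by move=> R S u c; rewrite /= !fm_cst.
Defined.
End Families.

Section FamilyTheory.
Variables (K : comNzRingType) (F : fam K) (R : alg K) (j : fidx F).
Local Notation coef := (@fcoef K F R j).

Lemma fcoef0 : coef 0 = 0.
Proof. by rewrite -(subrr 0) fcoefB subrr. Qed.

Lemma fcoefD : {morph coef : x y / x + y}.
Proof.
move=> x y; have N z : coef (- z) = - coef z by rewrite -[- z]sub0r fcoefB fcoef0 sub0r.
by rewrite -{1}[y]opprK fcoefB N opprK.
Qed.

Lemma fcoef_sum (J : Type) (s : seq J) (P : pred J) (f : J -> F R) :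
  coef (\sum_(i <- s | P i) f i) = \sum_(i <- s | P i) coef (f i).
Proof. exact: (big_morph coef fcoefD fcoef0). Qed.

Lemma fcoefZr c x : coef (x * fcst F R c) = coef x * c.
Proof. by rewrite mulrC fcoefZ mulrC. Qed.
End FamilyTheory.

Lemma fam_ext (K : comNzRingType) (F : fam K) (R : alg K) (x y : F R) :
  (forall j, fcoef j x = fcoef j y) -> x = y.
Proof.
move=> h; apply/eqP; rewrite -subr_eq0; apply/eqP; apply: fcoef_inj => j.
by rewrite fcoefB h subrr.
Qed.

(** * The Lie-Kolchin argument *)

Lemma fm_compE (K : comNzRingType) (F : fam K) (R S T : alg K) (u : algHom R S)
    (v : algHom S T) (w : algHom R T) : (forall x, w x = v (u x)) ->
  forall x, fm F v (fm F u x) = fm F w x.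
Proof. by move=> wE x; apply: fam_ext => j; rewrite !fcoef_m wE. Qed.

(* Divide q by X - x as often as possible: the remaining factor is nonzero at z
   because its augmentation is. *)
Lemma algebraic_constant (K : comNzRingType) (F : fam K) (L : alg K)
    (q : {poly L}) (z : F L) (x : L) :
  domain L -> q != 0 -> root (map_poly (fcst F L) q) z -> faug F L z = x ->
  z = fcst F L x.
Proof.
move=> dL; have [m] := ubnP (size q); elim: m q => // m IH q sq q0 rz zx.
have [qx|qx] := eqVneq q.[x] 0; last first.
  case/eqP: qx; have /rootP := rz; move/(congr1 (faug F L)); rewrite rmorph0 -zx.
  rewrite -horner_map -map_poly_comp /= => <-; rewrite map_poly_id // => c _.
  by rewrite /= faug_cst.
have /factor_theorem[p qE] : root q x by apply/rootP.
have p0 : p != 0 by apply: contraNneq q0 => p0; rewrite qE p0 mul0r.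
move: rz; rewrite qE rmorphM rmorphB /= map_polyX map_polyC /=.
move/rootP; rewrite hornerM hornerXsubC => /(fdom dL)[/rootP rp|/eqP].
  apply: (IH p) => //; rewrite -ltnS; apply: leq_trans sq.
  by rewrite qE size_Mmonic ?monicXsubC // size_XsubC addn2 /=.
by rewrite subr_eq0 => /eqP.
Qed.

Lemma field_domain (K : fieldType) : domain K.
Proof. by move=> x y /eqP; rewrite mulf_eq0 => /orP[/eqP|/eqP]; [left|right]. Qed.

(** Among the finite subsets of [P], one whose span has the largest dimension spans all of [P]. *)
Lemma finite_spanning (L : fieldType) n (P : 'M[L]_n -> Prop) :
  exists s : seq 'M[L]_n, (forall X, X \in s -> P X) /\
    forall X, P X -> X \in <<s>>%VS.
Proof.
pose Q d := `[< exists s : seq 'M[L]_n, (forall X, X \in s -> P X) /\ \dim <<s>> = d >].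
have ex : exists d, Q d by exists 0%N; apply/asboolP; exists [::]; rewrite span_nil dimv0.
have ub d : Q d -> (d <= \dim {:'M[L]_n})%N.
  by move/asboolP => [s [_ <-]]; apply/dimvS/subvf.
case: (ex_maxnP ex ub) => d /asboolP[s [sP sd]] max.
exists s; split=> // X PX; have := max (\dim <<X :: s>>).
have -> : Q (\dim <<X :: s>>).
  apply/asboolP; exists (X :: s); split=> // Y; rewrite inE => /orP[/eqP->//|].
  exact: sP.
move/(_ isT) => le; have sub : (<<s>> <= <<X :: s>>)%VS.
  by apply: sub_span => Y Ys; rewrite inE Ys orbT.
have /eqP -> : <<s>>%VS == <<X :: s>>%VS by rewrite eqEdim sub sd.
by apply: memv_span; rewrite inE eqxx.
Qed.

Lemma horner_mx_conjugate (R : comNzRingType) n (X Q Q' : 'M[R]_n.+1) (p : {poly R}) :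
  Q' *m Q = 1%:M -> Q *m Q' = 1%:M ->
  horner_mx (Q *m X *m Q') p = Q *m horner_mx X p *m Q'.
Proof.
move=> Q'Q QQ'; elim/poly_ind: p => [|p c IH].
  by rewrite !rmorph0 mulmx0 mul0mx.
rewrite !rmorphD !rmorphM /= IH !horner_mx_X !horner_mx_C mulmxDr mulmxDl.
congr (_ + _); last by rewrite -mulmxA -scalar_mxC mulmxA QQ' mul1mx.
rewrite -![_ * _]/(_ *m _) !mulmxA -[_ *m Q' *m Q]mulmxA Q'Q mulmx1.
by [].
Qed.

Lemma horner_mx_eigen (R : comNzRingType) n (Y : 'M[R]_n.+1) (w : 'rV[R]_n.+1) z
    (p : {poly R}) : w *m Y = z *: w -> w *m horner_mx Y p = p.[z] *: w.
Proof.
move=> wY; elim/poly_ind: p => [|p c IH]; first by rewrite rmorph0 mulmx0 horner0 scale0r.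
rewrite rmorphD rmorphM /= horner_mx_X horner_mx_C mulmxDr hornerMXaddC.
rewrite -[_ * Y]/(_ *m Y) mulmxA IH -scalemxAl wY scalerA mul_mx_scalar.
by rewrite scalerDl.
Qed.

Section RhoMap.
Variables (K : fieldType) (G : affGrp K) (r : nat) (c : nat -> coord_ring G).

Lemma rho_fmap (L : nzRingType) n (M : nat -> 'M[L]_n) (R S : alg K) (v : algHom R S)
    (u : {rmorphism L -> R}) (u' : {rmorphism L -> S}) (g : G R) :
  (forall x, u' x = v (u x)) ->
  rho r c M u' (fmap G v g) = map_mx v (rho r c M u g).
Proof.
move=> uE; rewrite /rho map_mx_sum; apply: eq_bigr => k _.
apply/matrixP => i j; rewrite !mxE. apply: etrans (esym (rmorphM v _ _)).
by rewrite ev_nat uE.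
Qed.
End RhoMap.

Section LieKolchin.
Variables (K : fieldType) (G : affGrp K).
Local Notation A := (coord_ring G).
Variables (r : nat) (c : nat -> A) (chi : nat -> A -> K).
Hypothesis fchi : forall k, functional (chi k).
Hypothesis dual : forall i j, (i < r)%N -> (j < r)%N -> chi i (c j) = (i == j)%:R.
Variables (Fg : fam K) (gam : algHom A (Fg (kself K))).
Hypothesis gam_inj : forall a, gam a = 0 -> a = 0.
Hypothesis gam_aug : forall a, faug Fg (kself K) (gam a) = counit a.

Section OverL.
Variable La : alg K.

(** Only the iterated commutators themselves, not the subgroups that they generate. Level 0 consists
    of the points that reduce to 1 under the augmentation. *)
Fixpoint derived (i : nat) (F : fam K) (g : G (F La)) : Prop :=
  if i is i'.+1 then
    exists x y, [/\ derived i' x, derived i' y & g = [~ x, y]%g]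
  else fmap G (faug F La) g = 1%g.

Lemma derived_fmap i (F F' : fam K) (v : algHom (F La) (F' La)) (g : G (F La)) :
  (forall x, faug F' La (v x) = faug F La x) ->
  derived i g -> derived i (fmap G v g).
Proof.
move=> vE; elim: i g => [|i IH] g /=.
  by move=> <-; apply: ev_inj => a; rewrite !ev_nat /= !ev_nat /= vE.
move=> [x [y [hx hy ->]]]; exists (fmap G v x), (fmap G v y); split.
- exact: IH.
- exact: IH.
by rewrite /commg /conjg !gmulfM !fmapV.
Qed.

Lemma derived_conj i (F : fam K) (g h : G (F La)) :
  derived i g -> derived i (g ^ h)%g.
Proof.
elim: i g => [|i IH] g /=.
  by rewrite /conjg !gmulfM fmapV => ->; rewrite mul1g mulVg.
move=> [x [y [hx hy ->]]]; exists (x ^ h)%g, (y ^ h)%g; split; [exact: IH|exact: IH|].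
by rewrite conjRg.
Qed.

Lemma derived_aug i (F : fam K) (g : G (F La)) :
  derived i g -> fmap G (faug F La) g = 1%g.
Proof.
elim: i g => [|i IH] g //= [x [y [hx hy ->]]].
by rewrite /commg /conjg !gmulfM !fmapV !IH // invg1 !mulg1.
Qed.

Definition gpt : G (Fg (kself K)) := projT1 (cid (point_of gam)).
Lemma gptE : ev gpt =1 gam. Proof. exact: projT2 (cid (point_of gam)). Qed.

Definition gptL : G (Fg La) := fmap G (fm Fg (to_alg La)) gpt.

Lemma gptL_derived : derived 0 (F := Fg) gptL.
Proof.
apply: ev_inj => a; rewrite !ev_nat /= ev_nat /= gptE faug_m gam_aug.
by rewrite ev1.
Qed.

Lemma coef_gptL j a : fcoef j (ev gptL a) = str La (fcoef j (gam a)).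
Proof. by rewrite ev_nat /= gptE fcoef_m. Qed.

(** Applying a functional of [La] and taking coefficients turns the relation into the vanishing of
    [gam] at a combination of the [c k] over [K]. Injectivity of [gam] and independence of the [c k]
    finish, functional by functional. *)
Lemma gptL_indep (t : nat -> La) :
  \sum_(k < r) ev gptL (c k) * fcst Fg La (t k) = 0 -> forall k, (k < r)%N -> t k = 0.
Proof.
move=> h k kr; apply: functionals_sep0 => psi fpsi.
pose a := \sum_(k < r) str A (psi (t k)) * c k.
have a0 : a = 0.
  apply: gam_inj; apply: fcoef_inj => j.
  have := congr1 (fun x => psi (fcoef j x)) h; rewrite fcoef_sum fnl_sum // fcoef0 fnl0 // => E.
  rewrite -{}[RHS]E rmorph_sum fcoef_sum; apply: eq_bigr => i _.
  rewrite fcoefZr coef_gptL fnlZ // rmorphM alg_homE.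
  by rewrite -(alg_homE (fcst Fg (kself K))) fcoefZ mulrC.
have : chi k a = 0 by rewrite a0 fnl0.
rewrite fnl_sum // (bigD1 (Ordinal kr)) //= fnlZ // dual // eqxx mulr1 big1 ?addr0 // => i ik.
by rewrite fnlZ // dual // eq_sym (negPf ik : (i == k :> nat) = false) mulr0.
Qed.
End OverL.

Section Step.
Variables (L : fieldType) (f : {rmorphism K -> L}) (n : nat) (M : nat -> 'M[L]_n.+1).
Hypothesis hM : is_rep f r c M.
Local Notation La := (Alg f).

Definition rep (F : fam K) (g : G (F La)) : 'M[F La]_n.+1 := rho r c M (fcst F La) g.

Lemma repM (F : fam K) (g h : G (F La)) : rep (g * h)%g = rep h *m rep g.
Proof. by have [h1 h2] := hM (alg_homE (fcst F La)); first [exact: h1|exact: h2]. Qed.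

Lemma rep1 (F : fam K) : rep (1%g : G (F La)) = 1%:M.
Proof. by have [h1 h2] := hM (alg_homE (fcst F La)); first [exact: h1|exact: h2]. Qed.

Lemma repVl (F : fam K) (g : G (F La)) : rep g^-1%g *m rep g = 1%:M.
Proof. by rewrite -repM mulgV rep1. Qed.

Lemma repVr (F : fam K) (g : G (F La)) : rep g *m rep g^-1%g = 1%:M.
Proof. by rewrite -repM mulVg rep1. Qed.

Lemma rep_fmap (F F' : fam K) (v : algHom (F La) (F' La)) (g : G (F La)) :
  (forall x, v (fcst F La x) = fcst F' La x) -> rep (fmap G v g) = map_mx v (rep g).
Proof. by move=> vE; apply: rho_fmap => x; rewrite vE. Qed.

Lemma rep_aug i (F : fam K) (g : G (F La)) :
  derived i g -> map_mx (faug F La) (rep g) = 1%:M.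
Proof.
move=> hg; have [_ r1] := hM (R := La) (u := (@idfun L : {rmorphism L -> L})) (fun z => erefl).
rewrite -r1 -(derived_aug hg); symmetry; apply: rho_fmap => x.
by rewrite /= faug_cst.
Qed.

Definition coefs i (X : 'M[L]_n.+1) := exists (F : fam K) (g : G (F La)) (j : fidx F),
  derived i g /\ X = \matrix_(a, b) (fcoef j (rep g a b) : L).

Definition derived_commute i := forall (F : fam K) (g h : G (F La)),
  derived i g -> derived i h -> rep g *m rep h = rep h *m rep g.

Section Comp.
Variables (F F' : fam K).
Local Notation FF := (comp_fam F F').
Definition inl_f : algHom (F La) (FF La) := fcst F' (F La).
Definition inr_f : algHom (F' La) (FF La) := fm F' (fcst F La).

Lemma inl_f_derived i (g : G (F La)) : derived i g -> derived i (F := FF) (fmap G inl_f g).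
Proof. by apply: derived_fmap => x; rewrite /= faug_cst. Qed.

Lemma inr_f_derived i (g : G (F' La)) : derived i g -> derived i (F := FF) (fmap G inr_f g).
Proof. by apply: derived_fmap => x; rewrite /= faug_m faug_cst. Qed.

Lemma inl_f_rep (g : G (F La)) : rep (F := FF) (fmap G inl_f g) = map_mx inl_f (rep g).
Proof. exact: rep_fmap. Qed.

Lemma inr_f_rep (g : G (F' La)) : rep (F := FF) (fmap G inr_f g) = map_mx inr_f (rep g).
Proof. by apply: rep_fmap => x; rewrite /= fm_cst. Qed.
End Comp.

(** Both points are moved to the composite family. Their parameters are independent there, so taking
    first the coefficient [j'] and then [j] of the commutation relation isolates the two
    matrices. *)
Lemma coefs_commute i X Y : derived_commute i -> coefs i X -> coefs i Y ->
  X *m Y = Y *m X.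
Proof.
move=> comm [F [g [j [hg ->]]]] [F' [h [j' [hh ->]]]].
set X' := \matrix_(_, _) _; set Y' := \matrix_(_, _) _.
have := comm _ _ _ (inl_f_derived F' hg) (inr_f_derived F hh).
rewrite inl_f_rep inr_f_rep => /matrixP E.
have E' a b : \sum_l rep g a l * fcst F La (Y' l b) = \sum_l fcst F La (Y' a l) * rep g l b.
  have := congr1 (fcoef j') (E a b); rewrite !mxE !fcoef_sum => E2.
  transitivity (\sum_l fcoef j' (map_mx (inl_f F F') (rep g) a l *
      map_mx (inr_f F F') (rep h) l b)).
    by apply: eq_bigr => l _; rewrite !mxE fcoefZ fcoef_m.
  rewrite E2; apply: eq_bigr => l _; rewrite !mxE.
  by rewrite fcoefZr fcoef_m.
apply/matrixP => a b; have := congr1 (fcoef j) (E' a b); rewrite !fcoef_sum !mxE => E2.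
transitivity (\sum_l fcoef j (rep g a l * fcst F La (Y' l b))).
  by apply: eq_bigr => l _; rewrite fcoefZr [X' _ _]mxE.
by rewrite E2; apply: eq_bigr => l _; rewrite fcoefZ [X' _ _]mxE.
Qed.

Lemma derived_commute_scalar i :
  (forall X, coefs i.+1 X -> exists x, X = x%:M) -> derived_commute i.
Proof.
move=> scal F x y hx hy; pose w := [~ x, y]%g.
have hw : derived i.+1 w by exists x, y.
pose z := rep w 0 0.
have wz : rep w = z%:M.
  apply/matrixP => a b; apply: fam_ext => j.
  have [|t tE] := scal (\matrix_(a, b) (fcoef j (rep w a b) : L)).
    by exists F, w, j.
  have tE' a' b' : fcoef j (rep w a' b') = t *+ (a' == b').
    by have /matrixP/(_ a' b') := tE; rewrite !mxE.
  rewrite tE' mxE; case: eqP => _; last by rewrite fcoef0.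
  by rewrite [RHS]tE'.
have dV (g : G (F La)) : \det (rep g^-1%g) * \det (rep g) = 1.
  by rewrite -det_mulmx repVl det1.
have z1 : z ^+ n.+1 = 1.
  rewrite -det_scalar -wz /w /commg /conjg !repM !det_mulmx.
  have gen (p p' q q' : F La) : p' * p = 1 -> q' * q = 1 -> p * q * p' * q' = 1.
    by move=> pp qq; rewrite [p * q]mulrC -[q * p * p']mulrA [p * p']mulrC pp mulr1 mulrC.
  exact: gen.
have az : faug F La z = 1.
  have /matrixP/(_ 0 0) := rep_aug hw; rewrite wz !mxE eqxx mulr1n.
  by rewrite mulr1n.
(* A root of T^(n+1) - 1 in a domain equals the constant to which it reduces, here 1. Since
   [algebraic_constant] copes with multiple roots, a characteristic dividing n+1 is covered. *)
have zE : z = 1.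
  rewrite (@algebraic_constant K F La ('X^(n.+1) - 1 : {poly L}) z 1) ?rmorph1 //.
  - exact: field_domain.
  - by rewrite -size_poly_eq0 size_XnsubC.
  - apply/rootP; rewrite rmorphB /= map_polyXn rmorph1 !hornerE z1.
    by rewrite subrr.
have xyE : (x * y = y * x * w)%g by rewrite /w /commg /conjg !mulgA mulgK mulgV mul1g.
by rewrite -!repM xyE (repM (y * x)%g w) wz zE mul1mx.
Qed.


Section Stability.
Variables (L' : fieldType) (g : {rmorphism L -> L'}) (i : nat) (al : 'M[L]_n.+1 -> L').
Local Notation La' := (Alg (g \o f)).

Definition eig (w : 'rV[L']_n.+1) := forall X, coefs i X -> w *m map_mx g X = al X *: w.

Let gf : algHom La La' := @AlgHom K La La' g (fun=> erefl).

(** Moving [w] by the dense point amounts to conjugating [X]. The conjugate again has its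
    coefficients in [coefs i], so [w] is an eigenvector of it; the eigenvalue is a root of the
    characteristic polynomial of [X], which has constant coefficients, and so is constant and equal
    to [al X]. Independence of the [c k] along the dense point then separates the [M k]. *)
Lemma eig_stable (w : 'rV[L']_n.+1) k : eig w -> (k < r)%N -> eig (w *m map_mx g (M k)).
Proof.
move=> ew kr X hX; have [->|w0] := eqVneq w 0.
  by rewrite !mul0mx scaler0.
have [b0 wb0] : exists b, w 0 b != 0.
  apply: contrapT => no; case/eqP: w0; apply/rowP => b; rewrite mxE.
  by apply/eqP/negPn/negP => hb; apply: no; exists b.
have [F' [x0 [j' [hx0 XE]]]] := hX.
pose ga := gptL La; pose R := Fg La; pose S := Fg La'.
have hga : derived 0 (F := Fg) ga by apply: gptL_derived.
pose Y := rep ga *m map_mx (fcst Fg La) X *m rep ga^-1%g.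
(* [x0] and the dense point are put over the composite family. Since [rep] reverses products, taking
   the coefficient [j'] of the conjugate of [x0] gives exactly [Y]. *)
have Ycoef jj : coefs i (\matrix_(a, b) (fcoef jj (Y a b) : L)).
  pose y := (fmap G (inr_f Fg F') x0 ^ fmap G (inl_f Fg F') ga)%g.
  exists (comp_fam Fg F'), y, (j', jj); split.
    exact: derived_conj (inr_f_derived Fg hx0).
  have -> : rep (F := comp_fam Fg F') y = map_mx (inl_f Fg F') (rep ga) *m
      map_mx (inr_f Fg F') (rep x0) *m map_mx (inl_f Fg F') (rep ga^-1%g).
    by rewrite /y /conjg !repM -fmapV !inl_f_rep inr_f_rep.
  set A1 := map_mx _ (rep ga); set B1 := map_mx _ (rep x0); set C1 := map_mx _ (rep _).
  apply/matrixP => a b; rewrite mxE [RHS]mxE.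
  change (fcoef jj (Y a b) = fcoef jj (fcoef j' ((A1 *m B1 *m C1) a b))).
  congr (fcoef jj _).
  rewrite mxE [(A1 *m B1 *m C1) a b]mxE fcoef_sum; apply: eq_bigr => l _.
  rewrite [C1 l b]mxE fcoefZr; congr (_ * _).
  rewrite mxE [(A1 *m B1) a l]mxE fcoef_sum; apply: eq_bigr => m _.
  by rewrite [A1 a m]mxE fcoefZ [B1 m l]mxE fcoef_m mxE XE mxE.
pose T := fm Fg gf; pose Y' : 'M[S]_n.+1 := map_mx T Y.
pose cs := fcst Fg La'; pose wS : 'rV[S]_n.+1 := map_mx cs w.
(* Every coefficient of [Y'] multiplies [w] by a scalar, so [Y'] does too; its eigenvalue is read
   off at [b0], where [w] is a nonzero constant. *)
pose z : S := cs (w 0 b0)^-1 * (wS *m Y') 0 b0.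
pose aj jj := al (\matrix_(a, b) (fcoef jj (Y a b) : L)).
have coefY jj b : fcoef jj ((wS *m Y') 0 b) = aj jj * w 0 b.
  have /rowP/(_ b) := ew _ (Ycoef jj); rewrite !mxE => <-; rewrite fcoef_sum.
  by apply: eq_bigr => l _; rewrite !mxE fcoefZ fcoef_m.
have coefz jj : fcoef jj z = aj jj.
  by rewrite fcoefZ coefY mulrCA mulVf // mulr1.
have wY : wS *m Y' = z *: wS.
  apply/rowP => b; apply: fam_ext => jj.
  by rewrite coefY !mxE fcoefZr coefz.
have QQ' : map_mx T (rep ga) *m map_mx T (rep ga^-1%g) = 1%:M.
  by rewrite -map_mxM repVr map_mx1.
have Q'Q : map_mx T (rep ga^-1%g) *m map_mx T (rep ga) = 1%:M.
  by rewrite -map_mxM repVl map_mx1.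
have TX : map_mx T (map_mx (fcst Fg La) X) = map_mx cs (map_mx g X).
  by apply/matrixP => a b; rewrite !mxE fm_cst.
have Y'E : Y' = map_mx T (rep ga) *m map_mx cs (map_mx g X) *m map_mx T (rep ga^-1%g).
  by rewrite -TX -!map_mxM.
have az : faug Fg La' z = al X.
  have aY : map_mx (faug Fg La') Y' = map_mx g X.
    apply/matrixP => a b; rewrite mxE [map_mx T Y a b]mxE faug_m [RHS]mxE; apply: (congr1 g).
    have E : map_mx (faug Fg La) Y = X.
      rewrite !map_mxM (rep_aug hga) mul1mx.
      have -> : map_mx (faug Fg La) (rep ga^-1%g) = 1%:M.
        rewrite -[LHS]mul1mx -{1}(rep_aug hga) -map_mxM repVr.
        by rewrite map_mx1.
      by rewrite mulmx1; apply/matrixP => a' b'; rewrite !mxE faug_cst.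
    by have /matrixP/(_ a b) := E; rewrite mxE.
  rewrite rmorphM faug_cst.
  have -> : faug Fg La' ((wS *m Y') 0 b0) = (w *m map_mx g X) 0 b0.
    rewrite -aY !mxE rmorph_sum; apply: eq_bigr => l _.
    by rewrite !mxE rmorphM faug_cst.
  by rewrite ew // mxE mulrCA mulVf // mulr1.
have zE : z = cs (al X).
  apply: (@algebraic_constant K Fg La' (map_poly g (char_poly X))) => //.
  - exact: field_domain.
  - by rewrite map_poly_eq0 -size_poly_eq0 size_char_poly.
  have := horner_mx_eigen (map_poly cs (map_poly g (char_poly X))) wY.
  rewrite Y'E horner_mx_conjugate // -map_horner_mx -map_horner_mx Cayley_Hamilton.
  rewrite !map_mx0 mulmx0 mul0mx mulmx0 => /rowP/(_ b0); rewrite !mxE => E.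
  apply/rootP; set pz := (map_poly _ _).[z].
  have := congr1 (fun t => t * cs (w 0 b0)^-1) (esym E).
  by rewrite mul0r -mulrA -rmorphM mulfV // rmorph1 mulr1.
have wX : wS *m map_mx T (rep ga) *m map_mx cs (map_mx g X) =
    cs (al X) *: (wS *m map_mx T (rep ga)).
  by rewrite -zE scalemxAl -wY Y'E -!mulmxA Q'Q mulmx1.
have evT q : T (ev ga (c q)) = ev (gptL La') (c q).
  by rewrite !ev_nat /=; apply: fm_compE.
have repT : map_mx T (rep ga) = \sum_(q < r) ev (gptL La') (c q) *: map_mx cs (map_mx g (M q)).
  rewrite /rep /rho map_mx_sum; apply: eq_bigr => q _.
  apply/matrixP => a b; rewrite !mxE; apply: etrans (rmorphM T _ _) _.
  by rewrite evT; congr (_ * _); apply: fm_cst.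
apply/rowP => b; apply/eqP; rewrite -subr_eq0; apply/eqP.
(* The failure of w M_q to be an eigenvector, in coordinate [b]. [wX] is a linear relation between
   the values of the [c q] at the dense point with these coefficients. *)
pose t q := (w *m map_mx g (M q) *m map_mx g X - al X *: (w *m map_mx g (M q))) 0 b.
have := @gptL_indep La' t _ k kr; rewrite {2}/t => tk.
suff : t k = 0 by rewrite /t mxE [X in _ + X]mxE.
apply: tk.
have /rowP/(_ b) := wX; rewrite repT.
have E1 (B : 'M[S]_n.+1) : wS *m (\sum_(q < r) ev (gptL La') (c q) *: map_mx cs (map_mx g (M q))) *m B =
   \sum_(q < r) ev (gptL La') (c q) *: (map_mx cs (w *m map_mx g (M q)) *m B).
  rewrite mulmx_sumr mulmx_suml; apply: eq_bigr => q _.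
  by rewrite -scalemxAr -scalemxAl map_mxM.
rewrite E1 -[wS *m _ in RHS]mulmx1 E1 => /eqP; rewrite -subr_eq0 => /eqP E.
apply: etrans E; rewrite [X in _ = _ - X]mxE !summxE mulr_sumr -sumrB.
apply: eq_bigr => q _; rewrite mulmx1 -map_mxM.
rewrite [X in _ = X - _]mxE [X in _ = _ - _ * X]mxE.
rewrite [X in _ = _ * X - _]mxE [X in _ = _ - _ * (_ * X)]mxE mulrCA -mulrBr.
congr (_ * _); rewrite -rmorphM -rmorphB; congr (cs _).
by rewrite /t mxE [X in _ + X]mxE [X in _ - X]mxE.
Qed.
End Stability.

(** Each [X] is a combination of the [M q] with the coefficients of the values of the [c q] at the
    dense point, so [gptL_indep] passes from the commutators of all [X] with [Z] to those of each
    [M k]. *)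
Lemma gpt_coefs_commute (Z : 'M[L]_n.+1) :
  (forall j, let X := \matrix_(a, b) (fcoef j (rep (gptL La) a b) : L) in
     X *m Z = Z *m X) ->
  forall k, (k < r)%N -> M k *m Z = Z *m M k.
Proof.
move=> comm k kr; apply/matrixP => a b; apply/eqP; rewrite -subr_eq0; apply/eqP.
pose t q : La := (M q *m Z) a b - (Z *m M q) a b.
apply: (@gptL_indep La t _ k kr); apply: fam_ext => j.
pose X := \matrix_(a, b) (fcoef j (rep (gptL La) a b) : L).
pose e q : L := fcoef j (ev (gptL La) (c q)).
have XE : X = \sum_(q < r) e q *: M q.
  apply/matrixP => a' b'; rewrite mxE /rep /rho !summxE fcoef_sum.
  by apply: eq_bigr => q _; rewrite !mxE fcoefZr.
rewrite fcoef_sum fcoef0; have /matrixP/(_ a b)/eqP := comm j; rewrite -/X XE.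
rewrite mulmx_suml mulmx_sumr !summxE -subr_eq0 -sumrB => /eqP E.
apply: etrans E; apply: eq_bigr => q _; rewrite fcoefZr -scalemxAl -scalemxAr.
by rewrite [X in _ = X - _]mxE [X in _ = _ - X]mxE -mulrBr.
Qed.

(** Extensions are included because the common eigenspace to which irreducibility is applied is
    defined only over one. *)
Definition irreducible_over_ext := forall (L' : fieldType) (g : {rmorphism L -> L'})
    (U : 'M[L']_n.+1), finite_ext g ->
  (forall k, (k < r)%N -> (U *m map_mx g (M k) <= U)%MS) -> U != 0 -> row_full U.

Lemma irreducible_coefs_scalar i : irreducible_over_ext -> derived_commute i ->
  forall X, coefs i X -> exists x, X = x%:M.
Proof.
move=> irr comm; have [s [sc span]] := finite_spanning (coefs i).
have [|L' [g [v [fg v0 hv]]]] := @commuting_eigenvector L n s.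
  by move=> X Y /sc hX /sc hY; apply: coefs_commute hX hY.
have spanE X : coefs i X -> exists b : 'I_(size s) -> L, X = \sum_j b j *: s`_j.
  move/span; rewrite -[s]/(val (in_tuple s)) => /coord_span XE.
  by exists (fun j => coord (in_tuple s) j X); exact: XE.
have mapE (b : 'I_(size s) -> L) : map_mx g (\sum_j b j *: s`_j) =
    \sum_j g (b j) *: map_mx g s`_j.
  by rewrite map_mx_sum; apply: eq_bigr => j _; rewrite map_mxZ.
have /choice[al hal] : forall X, exists a, coefs i X -> v *m map_mx g X = a *: v.
  move=> X; have [hX|nX] := pselect (coefs i X); last by exists 0.
  have /choice[a ha] : forall j : 'I_(size s), exists a, v *m map_mx g s`_j = a *: v.
    by move=> j; apply: hv; apply: mem_nth.
  have [b ->] := spanE X hX; exists (\sum_j g (b j) * a j) => _.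
  rewrite mapE mulmx_sumr scaler_suml; apply: eq_bigr => j _.
  by rewrite -scalemxAr ha scalerA.
(* Since [s] spans all coefficient matrices, this finite intersection is exactly the space of
   vectors satisfying [eig]. *)
pose U := (\bigcap_(j < size s) eigenspace (map_mx g s`_j) (al s`_j))%MS.
have eigU (w : 'rV_n.+1) : (w <= U)%MS -> @eig L' g i al w.
  move=> /sub_bigcapmxP wU X hX; have [b XE] := spanE X hX.
  have wj (j : 'I_(size s)) : w *m map_mx g s`_j = al s`_j *: w.
    exact/eigenspaceP/wU.
  have alX : al X = \sum_j g (b j) * al s`_j.
    have E : (al X - \sum_j g (b j) * al s`_j) *: v = 0.
      rewrite scalerBl -hal // XE mapE mulmx_sumr scaler_suml -sumrB.
      apply: big1 => j _; rewrite -scalemxAr hal ?scalerA ?subrr //.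
      by apply: sc; apply: mem_nth.
    apply/eqP; rewrite -subr_eq0; move/eqP: E; rewrite scaler_eq0.
    by rewrite (negPf v0) orbF.
  rewrite alX XE mapE mulmx_sumr scaler_suml; apply: eq_bigr => j _.
  by rewrite -scalemxAr wj scalerA.
have Ueig (w : 'rV_n.+1) : @eig L' g i al w -> (w <= U)%MS.
  move=> ew; apply/sub_bigcapmxP => j _; apply/eigenspaceP; apply: ew.
  by apply: sc; apply: mem_nth.
have Ufull : row_full U.
  apply: (irr L' g) => // [k kr|].
    apply/row_subP => q; rewrite row_mul; apply: Ueig.
    by apply: eig_stable => //; apply: eigU; apply: row_sub.
  by apply: contraNneq v0 => U0; rewrite -submx0 -U0; apply: Ueig.
(* Now all vectors have the eigenvalue [al X]. That [X] is scalar descends to [L] because [g] is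
   injective. *)
move=> X hX; have E : map_mx g X = (al X)%:M.
  apply/row_matrixP => q; rewrite -[map_mx g X]mul1mx row_mul.
  rewrite (eigU (row q 1%:M)) ?submx_full //.
  by rewrite -mul_mx_scalar -row_mul mul1mx.
exists (X 0 0); apply/matrixP => a b; apply: (fmorph_inj g).
have /matrixP E' := E; have := E' a b; rewrite !mxE => ->.
by have := E' 0 0; rewrite !mxE eqxx mulr1n => <-; rewrite rmorphMn.
Qed.

Lemma irreducible_commute : solvable_grp G -> irreducible_over_ext ->
  forall k l, (k < r)%N -> (l < r)%N -> M k *m M l = M l *m M k.
Proof.
move=> [N [H [Hcl H0 HN _ Hcomm]]] irr.
have derH i : (i <= N)%N -> forall (F : fam K) (g : G (F La)), derived i g -> H i _ g.
  elim: i => [|i IH] iN F g; first by move=> _; apply: H0.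
  move=> [x [y [hx hy ->]]]; apply: Hcomm => //; apply: IH => //; exact: ltnW.
(* Descending induction on the level: at level [N] the points are trivial, and scalar commutators at
   one level give commutation one level below. *)
have comm m : (m <= N)%N -> derived_commute (N - m).
  elim: m => [_|m IH mN].
    rewrite subn0 => F g h hg hh.
    by rewrite (HN _ _ (derH N (leqnn N) F g hg)) rep1 mul1mx mulmx1.
  have comm1 := IH (ltnW mN); have E : ((N - m.+1).+1 = N - m)%N by rewrite subnSK.
  apply: derived_commute_scalar; rewrite E.
  exact: irreducible_coefs_scalar.
have := comm N (leqnn N); rewrite subnn => comm0 k l kr lr.
(* Level 0 contains the dense point. Its coefficient matrices commute, and density carries this over
   to the [M k], once for each factor. *)
have c0 j : coefs 0 (\matrix_(a, b) (fcoef j (rep (gptL La) a b) : L)).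
  by exists Fg, (gptL La), j; split=> //; apply: gptL_derived.
symmetry; apply: gpt_coefs_commute lr => j /=; symmetry.
apply: gpt_coefs_commute kr => j' /=.
exact: coefs_commute comm0 (c0 j') (c0 j).
Qed.
End Step.

(** Either the representation stays irreducible, and then the [M k] commute, or a proper nonzero
    stable subspace appears over a finite extension and induction on the size applies to it. *)
Lemma solvable_stable_line : solvable_grp G -> has_stable_line r c.
Proof.
move=> solv L f n; have [m] := ubnP n; elim: m n L f => // m IH n L f nm M ff hM.
have [irr|] := pselect (irreducible_over_ext M).
  have [|L' [g [v [fg v0 hv]]]] := @commuting_eigenvector L n [seq M k | k <- iota 0 r].
    move=> X Y /mapP[k + ->] /mapP[l + ->]; rewrite !mem_iota /= => kr lr.
    exact: irreducible_commute hM solv irr k l kr lr.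
  exists L', g, v; split=> // k kr; apply: hv; apply/mapP; exists k => //.
  by rewrite mem_iota.
move=> nirr.
have [L1 [g1 [U [fg1 stab U0 nfull]]]] : exists (L1 : fieldType) (g1 : {rmorphism L -> L1})
    (U : 'M[L1]_n.+1), [/\ finite_ext g1,
      forall k, (k < r)%N -> (U *m map_mx g1 (M k) <= U)%MS, U != 0 & ~~ row_full U].
  apply: contrapT => no; apply: nirr => L1 g1 U fg1 stab U0; apply: contrapT => /negP nf.
  by apply: no; exists L1, g1, U.
have [q [B [qn Bfree BU]]] : exists q (B : 'M[L1]_(q.+1, n.+1)),
    [/\ (q < n)%N, row_free B & (B :=: U)%MS].
  move: (row_base U) (row_base_free U) (eq_row_base U) => B.
  have : (\rank U != 0)%N by rewrite mxrank_eq0.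
  have : (\rank U < n.+1)%N by rewrite ltn_neqAle rank_leq_col andbT.
  by case: (\rank U) B => // q B qn _ Bf BU; exists q, B.
pose f1 : {rmorphism K -> L1} := g1 \o f.
pose N k := B *m map_mx g1 (M k) *m pinvmx B.
have BE k : (k < r)%N -> B *m map_mx g1 (M k) = N k *m B.
  move=> kr; rewrite /N mulmxKpV //; rewrite -(mulmx1 B).
  rewrite mulmx1 (submx_trans _ (_ : (U <= B)%MS)) ?BU //.
  by apply: submx_trans (stab k kr); apply: submxMr; rewrite BU.
have hN : is_rep f1 r c N.
  apply: is_rep_conj (is_rep_map (f' := f1) _ hM) => //; first exact: mulmxVp.
  by move=> k kr; exists (N k); apply: BE.
have ff1 : finite_ext f1 by apply: finite_ext_comp ff fg1.
have [|L2 [g2 [v [fg2 v0 hv]]]] := IH q L1 f1 _ N ff1 hN.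
  by apply: leq_trans qn _; rewrite -ltnS.
exists L2, (g2 \o g1), (v *m map_mx g2 B); split.
- exact: finite_ext_comp fg1 fg2.
- apply: contraNneq v0 => vB0; have := congr1 (fun w => w *m map_mx g2 (pinvmx B)) vB0.
  by rewrite mul0mx -mulmxA -map_mxM mulmxVp // map_mx1 mulmx1 => ->.
- move=> k kr; have [a va] := hv k kr; exists a.
  have -> : map_mx (g2 \o g1) (M k) = map_mx g2 (map_mx g1 (M k)).
    by apply/matrixP => i j; rewrite !mxE.
  by rewrite -mulmxA -map_mxM BE // map_mxM mulmxA va scalemxAl.
Qed.
End LieKolchin.

(** * Noetherian rings and Krull's intersection theorem *)

Lemma dependent_sequence (T : Type) (P : seq T -> T -> Prop) :
  (forall l, exists x, P l x) ->
  exists h : nat -> T, forall n, P [seq h i | i <- iota 0 n] (h n).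
Proof.
move/choice=> [pick hp]; pose g n := iter n (fun l => rcons l (pick l)) [::].
pose h n := pick (g n); exists h => n.
suff -> : [seq h i | i <- iota 0 n] = g n by apply: hp.
elim: n => // n IH; rewrite -addn1 iotaD map_cat IH /= add0n addn1 /=.
by rewrite cats1.
Qed.

(** The ascending chain condition for the ideals generated by initial segments of a sequence, which
    is the form in which it is used. *)
Definition noetherian (R : comNzRingType) := forall a : nat -> R,
  exists (N : nat) (c : nat -> R), a N = \sum_(i < N) c i * a i.

Lemma noetherian_field (K : fieldType) : noetherian K.
Proof.
move=> a; have [a0|a0] := eqVneq (a 0%N) 0.
  by exists 0%N, (fun=> 0); rewrite big_ord0.
by exists 1%N, (fun=> a 1%N / a 0%N); rewrite big_ord1 mulfVK.
Qed.

Lemma noetherian_surj (R S : comNzRingType) (f : {rmorphism R -> S}) :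
  (forall y, exists x, f x = y) -> noetherian R -> noetherian S.
Proof.
move=> /choice[g fg] nR a; have [N [c E]] := nR (g \o a).
exists N, (fun i => f (c i)); rewrite -[LHS]fg -[g _]/((g \o a) N) E rmorph_sum.
by apply: eq_bigr => i _; rewrite rmorphM /= fg.
Qed.

(* Hilbert's basis theorem: in an ideal that is not finitely generated, choose
   successively elements of least degree outside the ideal generated by the
   previous ones; a relation between their leading coefficients then allows to
   lower the degree once more. *)
Lemma noetherian_poly (R : comNzRingType) : noetherian R -> noetherian {poly R}.
Proof.
move=> nR a; apply: contrapT => nex.
pose I (p : {poly R}) := exists N (c : nat -> {poly R}), p = \sum_(i < N) c i * a i.
pose gen (l : seq {poly R}) (p : {poly R}) := exists c : nat -> {poly R}, p = \sum_(i < size l) c i * l`_i.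
have hI : ideal_pred I.
  split=> [|q p p' [N [c ->]] [N' [c' ->]]].
    by exists 0%N, (fun=> 0); rewrite big_ord0.
  exists (maxn N N'), (fun i => (if (i < N)%N then q * c i else 0) +
     (if (i < N')%N then c' i else 0)).
  under [RHS]eq_bigr do rewrite mulrDl.
  rewrite big_split /= mulr_sumr; congr (_ + _).
    rewrite (big_ord_widen _ (fun i => q * (c i * a i)) (leq_maxl N N')).
    by rewrite big_mkcond; apply: eq_bigr => i _; case: ifP; rewrite ?mul0r ?mulrA.
  rewrite (big_ord_widen _ (fun i => c' i * a i) (leq_maxr N N')).
  by rewrite big_mkcond; apply: eq_bigr => i _; case: ifP; rewrite ?mul0r.
have Ia i : I (a i).
  exists i.+1, (fun j => (j == i)%:R); rewrite (bigD1 ord_max) //= eqxx mul1r.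
  by rewrite big1 ?addr0 // => j /negPf ji; rewrite [(j : nat) == i]ji mul0r.
have gen_ideal l : ideal_pred (gen l).
  split=> [|q p p' [c ->] [c' ->]].
    by exists (fun=> 0); rewrite big1 // => i _; rewrite mul0r.
  exists (fun i => q * c i + c' i); rewrite mulr_sumr -big_split.
  by apply: eq_bigr => i _; rewrite mulrDl mulrA.
(* The premise on [l] makes a choice possible for every list, as dependent choice demands; [hI']
   discharges it for the lists that occur. *)
pose P (l : seq {poly R}) (p : {poly R}) := (forall q : {poly R}, q \in l -> I q) -> [/\ I p, ~ gen l p &
  forall q : {poly R}, I q -> ~ gen l q -> (size p <= size q)%N].
have [l|h hP] := @dependent_sequence {poly R} P.
  have [lI|] := pselect (forall q, q \in l -> I q); last by exists 0.
  have [q [Iq nq]] : exists q, I q /\ ~ gen l q.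
    apply: contrapT => no; apply: nex.
    have allgen q : I q -> gen l q by move=> Iq; apply: contrapT => nq; apply: no; exists q.
    have [N hN] : exists N, forall q, q \in l -> exists c : nat -> {poly R},
        q = \sum_(i < N) c i * a i.
      elim: l lI {no allgen} => [|q l IH] lI; first by exists 0%N.
      have [|N hN] := IH; first by move=> p pl; apply: lI; rewrite inE pl orbT.
      have [N' [c' qE]] := lI q (mem_head _ _); exists (maxn N N') => p.
      have ext m (b : nat -> {poly R}) : (m <= maxn N N')%N ->
          \sum_(i < m) b i * a i = \sum_(i < maxn N N') (if (i < m)%N then b i else 0) * a i.
        move=> le; rewrite (big_ord_widen _ (fun i => b i * a i) le) big_mkcond.
        by apply: eq_bigr => i _; case: ifP; rewrite ?mul0r.
      rewrite inE => /orP[/eqP->|/hN[c ->]].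
        by exists (fun i => if (i < N')%N then c' i else 0); rewrite qE ext ?leq_maxr.
      by exists (fun i => if (i < N)%N then c i else 0); rewrite ext ?leq_maxl.
    exists N; have [c ->] := allgen _ (Ia N).
    have /choice[d hd] : forall i : 'I_(size l), exists c : nat -> {poly R},
        l`_i = \sum_(i < N) c i * a i by move=> i; apply/hN/mem_nth.
    exists (fun k => \sum_(i < size l) c i * d i k).
    transitivity (\sum_(i < size l) \sum_(k < N) c i * d i k * a k).
      by apply: eq_bigr => i _; rewrite hd mulr_sumr; apply: eq_bigr => k _; rewrite mulrA.
    by rewrite exchange_big; apply: eq_bigr => k _; rewrite mulr_suml.
  pose Q s := `[< exists p, [/\ I p, ~ gen l p & size p = s] >].
  have exQ : exists s, Q s by exists (size q); apply/asboolP; exists q.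
  case: (ex_minnP exQ) => s /asboolP[p [Ip np sp]] min.
  exists p => _; split=> // p' Ip' np'; rewrite sp; apply: min.
  by apply/asboolP; exists p'.
pose l n := [seq h i | i <- iota 0 n].
have hI' n : I (h n).
  have [m] := ubnP n; elim: m n => // m IH n nm.
  have [|//] := hP n => q /mapP[i]; rewrite mem_iota /= => ni ->; apply: IH.
  exact: leq_trans ni nm.
have hPn n : [/\ I (h n), ~ gen (l n) (h n) &
    forall q : {poly R}, I q -> ~ gen (l n) q -> (size (h n) <= size q)%N].
  by apply: hP => q /mapP[i _ ->]; apply: hI'.
have lnth n i : (i < n)%N -> (l n)`_i = h i.
  by move=> ni; rewrite (nth_map 0%N) ?size_iota // nth_iota.
have size_l n : size (l n) = n by rewrite size_map size_iota.
have gen_h n i : (i < n)%N -> gen (l n) (h i).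
  move=> ni; exists (fun j => (j == i)%:R); rewrite size_l (bigD1 (Ordinal ni)) //= eqxx mul1r lnth //.
  by rewrite big1 ?addr0 // => j /negPf ji; rewrite [(j : nat) == i]ji mul0r.
have gen_le n m p : (n <= m)%N -> gen (l n) p -> gen (l m) p.
  move=> nm [c ->]; apply: (ideal_sum (gen_ideal _)) => i _; apply: (ideal_mull (gen_ideal _)).
  by have := ltn_ord i; rewrite {2}size_l => lt; rewrite lnth //; apply/gen_h/(leq_trans lt nm).
have size_mono i n : (i <= n)%N -> (size (h i) <= size (h n))%N.
  move=> le; have [_ _ min] := hPn i; apply: min; first exact: hI'.
  by move/(gen_le _ _ _ le); have [] := hPn n.
have [N [c lcE]] := nR (fun n => lead_coef (h n)).
have [_ nh min] := hPn N.
pose y : {poly R} := \sum_(i < N) (c i)%:P * 'X^(size (h N) - size (h i)) * h i.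
have geny : gen (l N) y.
  apply: (ideal_sum (gen_ideal _)) => i _; apply: (ideal_mull (gen_ideal _)).
  exact: gen_h.
have hN0 : h N != 0.
  by apply/eqP => h0; apply: nh; rewrite h0; case: (gen_ideal (l N)).
have sy : (size (h N - y)%R < size (h N))%N.
  have sN : (0 < size (h N))%N by rewrite size_poly_gt0.
  rewrite -(prednK sN) ltnS; apply/leq_sizeP => j; rewrite coefB.
  have yj i : (i < N)%N -> ((c i)%:P * 'X^(size (h N) - size (h i)) * h i)`_j =
      if j == (size (h N)).-1 then c i * lead_coef (h i) else
      if (j < size (h N))%N then ((c i)%:P * 'X^(size (h N) - size (h i)) * h i)`_j else 0.
    move=> iN; have le := size_mono i N (ltnW iN).
    rewrite -mulrA coefCM coefXnM.
    case: eqP => [->|_].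
      have [hi0|hi0] := eqVneq (h i) 0; first by rewrite hi0 coef0 if_same lead_coef0.
      have si : (0 < size (h i))%N by rewrite size_poly_gt0.
      rewrite ltnNge -subn1 leq_sub2l //= lead_coefE -subn1; congr (_ * _`_ _).
      by rewrite subnAC subKn // subn1.
    case: (ltnP j (size (h N))) => // jN; case: ifP => _; first by rewrite mulr0.
    by rewrite nth_default ?mulr0 // -{1}(subKn le); apply: leq_sub2r.
  rewrite leq_eqVlt => /orP[/eqP jE|jN].
    have -> : (h N)`_j = lead_coef (h N) by rewrite lead_coefE jE.
    rewrite lcE /y coef_sum; apply/eqP; rewrite subr_eq0.
    by apply/eqP; apply: eq_bigr => i _; rewrite yj // jE eqxx.
  rewrite prednK // in jN; rewrite nth_default // sub0r /y coef_sum big1 ?oppr0 // => i _.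
  by rewrite yj // ltnNge jN /= gtn_eqF // prednK.
have := min (h N - y) (idealB hI (hI' N) _) _; rewrite leqNgt sy => E.
suff : false by []; apply: E.
  apply: (ideal_sum hI) => i _; apply: (ideal_mull hI); exact: hI'.
by move=> g; apply: nh; rewrite -(subrK y (h N)); apply: (idealD (gen_ideal _)).
Qed.

Lemma generated_ind (K : fieldType) (A : comNzRingType) n (f : {rmorphism K -> A})
    (x : 'I_n -> A) (P : A -> Prop) :
  (forall c, P (f c)) -> (forall i, P (x i)) ->
  (forall a b, P a -> P b -> P (a + b)) -> (forall a b, P a -> P b -> P (a * b)) ->
  forall p, P (mmap f x p).
Proof.
move=> Pc Px PD PM; elim/mpolyind => [|c m p _ _ IH].
  by rewrite rmorph0 -(rmorph0 f).
rewrite mmapD mmapZ mmapX; apply: (PD) => //; apply: (PM) => //.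
rewrite /mmap1; apply: (big_ind P) => // [|i _]; first by rewrite -(rmorph1 f).
by elim: (m i) => [|k IHk]; rewrite ?expr0 -?(rmorph1 f) // exprS; apply: PM.
Qed.

Lemma noetherian_mpoly (K : fieldType) n : noetherian {mpoly K[n]}.
Proof.
elim: n => [|n IH].
  apply: (@noetherian_surj K _ (@mpolyC 0 K)) (@noetherian_field K) => p.
  by exists (p@_0%MM); apply: mpolyKC.
pose ev (p : {poly {mpoly K[n]}}) : {mpoly K[n.+1]} := (map_poly (@mwiden n K) p).['X_ord_max].
have evB : {morph ev : p q / p - q}.
  by move=> p q; rewrite /ev rmorphB hornerD hornerN.
have evM : {morph ev : p q / p * q} by move=> p q; rewrite /ev rmorphM hornerM.
have ev1 : ev 1 = 1 by rewrite /ev rmorph1 hornerC.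
pose f := mk_rmorphism evB evM ev1.
apply: (noetherian_surj (f := f)) (noetherian_poly IH) => p.
have <- : mmap (@mpolyC n.+1 K) (fun i => 'X_i) p = p.
  rewrite [RHS]mpolyE /mmap; apply: eq_bigr => m _.
  by rewrite mul_mpolyC mmap1_id.
apply: (generated_ind (P := fun q => exists y, f y = q)).
- by move=> c; exists (c%:MP)%:P; rewrite /= /ev map_polyC hornerC /= mwidenC.
- move=> i; have [->|] := eqVneq i ord_max.
    by exists 'X; rewrite /= /ev map_polyX hornerX.
  rewrite -(inj_eq val_inj) /= => ni.
  have lin : (i < n)%N by rewrite ltn_neqAle ni -ltnS ltn_ord.
  exists ('X_(Ordinal lin))%:P; rewrite /= /ev map_polyC hornerC /= mwidenX mnmwiden1.
  by congr 'X_[_]; congr mnm1; apply: val_inj.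
- by move=> a b [y <-] [z <-]; exists (y + z); rewrite rmorphD.
- by move=> a b [y <-] [z <-]; exists (y * z); rewrite rmorphM.
Qed.

Section MaximalIdealPowers.
Variables (K : fieldType) (A : alg K) (eps : algHom A (kself K)).
Variables (n : nat) (x : 'I_n -> A).
Hypothesis x_gen : forall a : A, exists p : {mpoly K[n]}, mmap (str A) x p = a.
Hypothesis eps_x : forall i, eps (x i) = 0.

Lemma alg_ind (P : A -> Prop) :
  (forall c, P (str A c)) -> (forall i, P (x i)) ->
  (forall a b, P a -> P b -> P (a + b)) -> (forall a b, P a -> P b -> P (a * b)) ->
  forall a, P a.
Proof. by move=> Pc Px PD PM a; have [p <-] := x_gen a; apply: generated_ind. Qed.

Lemma alg_noetherian : noetherian A.
Proof.
exact: (noetherian_surj (f := mmap (str A) x)) x_gen (@noetherian_mpoly K n).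
Qed.

(* The power m^k of the ideal m = (x_i) of the augmentation eps. *)
Fixpoint mpow (k : nat) (a : A) : Prop :=
  if k is k'.+1 then
    exists b : 'I_n -> A, (forall i, mpow k' (b i)) /\ a = \sum_i b i * x i
  else True.

Lemma mpow_ideal k : ideal_pred (mpow k).
Proof.
elim: k => [|k [IH0 IH]]; first by split.
split=> [|a u v [b [hb ->]] [b' [hb' ->]]].
  by exists (fun=> 0); split=> //; rewrite big1 // => i _; rewrite mul0r.
exists (fun i => a * b i + b' i); split=> [i|]; first exact: IH (hb i) (hb' i).
by rewrite mulr_sumr -big_split; apply: eq_bigr => i _; rewrite mulrDl mulrA.
Qed.

Lemma mpow_x k i a : mpow k a -> mpow k.+1 (a * x i).
Proof.
move=> ha; exists (fun j => if j == i then a else 0); split=> [j|].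
  by case: ifP => // _; case: (mpow_ideal k).
rewrite (bigD1 i) //= eqxx big1 ?addr0 // => j /negPf ->.
by rewrite mul0r.
Qed.

Lemma mpowM k l a b : mpow k a -> mpow l b -> mpow (k + l) (a * b).
Proof.
elim: l b => [|l IH] b ha hb; first by rewrite addn0; apply: (ideal_mulr (mpow_ideal k)).
have [b' [hb' ->]] := hb; rewrite addnS mulr_sumr.
apply: (ideal_sum (mpow_ideal _)) => i _; rewrite mulrA; apply: mpow_x.
exact: IH (hb' i).
Qed.

Lemma mpow_le k l a : (k <= l)%N -> mpow l a -> mpow k a.
Proof.
move=> /subnK <-; elim: (l - k)%N a => // d IH a; rewrite addSn => -[b [hb ->]].
by apply: (ideal_sum (mpow_ideal _)) => i _; apply: (ideal_mulr (mpow_ideal _)); apply: IH (hb i).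
Qed.

Lemma mpow1P a : mpow 1 a <-> eps a = 0.
Proof.
split=> [[b [_ ->]]|ea].
  by rewrite rmorph_sum big1 // => i _; rewrite rmorphM eps_x mulr0.
suff : mpow 1 (a - str A (eps a)) by rewrite ea rmorph0 subr0.
have hI := mpow_ideal 1; elim/alg_ind: a {ea} => [c|i|a b ha hb|a b ha hb].
- by rewrite alg_homE /= subrr; case: hI.
- rewrite eps_x rmorph0 subr0 -[x i]mul1r.
  by apply: mpow_x.
- by rewrite !rmorphD opprD addrACA; apply: idealD.
- have -> : a * b - str A (eps (a * b)) =
      a * (b - str A (eps b)) + str A (eps b) * (a - str A (eps a)).
    by rewrite !rmorphM !mulrBr addrA [str A (eps b) * a]mulrC subrK [_ * str A (eps a)]mulrC.
  have [_ h] := hI; apply: h => //; exact: ideal_mull.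
Qed.

Definition minf (a : A) := forall k, mpow k a.

Lemma minf_ideal : ideal_pred minf.
Proof.
split=> [k|a u v hu hv k]; have [h0 h] := mpow_ideal k; first exact: h0.
by apply: h; [apply: hu | apply: hv].
Qed.

(* Krull's intersection theorem, from the noetherianity of the Rees algebra
   generated by the x_i and the x_i T inside A[T]. *)
Lemma krull b : minf b -> exists e, eps e = 0 /\ b = e * b.
Proof.
move=> hb; pose z (i : 'I_(n + n)) : {poly A} :=
  match split i with inl j => (x j)%:P | inr j => (x j)%:P * 'X end.
pose th : {rmorphism {mpoly K[n + n]} -> {poly A}} :=
  mmap (polyC \o str A : {rmorphism K -> {poly A}}) z.
pose im q := exists p, th p = q.
have imD q q' : im q -> im q' -> im (q + q').
  by move=> [p <-] [p' <-]; exists (p + p'); rewrite rmorphD.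
have imM q q' : im q -> im q' -> im (q * q').
  by move=> [p <-] [p' <-]; exists (p * p'); rewrite rmorphM.
have imx i : im (x i)%:P.
  exists 'X_(lshift n i); rewrite /th /= mmapX mmap1U /z.
  by rewrite (unsplitK (inl i : 'I_n + 'I_n)).
have imxT i : im ((x i)%:P * 'X).
  exists 'X_(rshift n i); rewrite /th /= mmapX mmap1U /z.
  by rewrite (unsplitK (inr i : 'I_n + 'I_n)).
have imC a : im a%:P.
  elim/alg_ind: a => // [c|a a' ha ha'|a a' ha ha'].
  - by exists c%:MP; rewrite /th /= mmapC.
  - by rewrite polyCD; apply: imD.
  - by rewrite polyCM; apply: imM.
have imT k a : mpow k a -> im (a%:P * 'X^k).
  elim: k a => [|k IH] a; first by rewrite expr0 mulr1.
  move=> [a' [ha' ->]]; rewrite rmorph_sum mulr_suml.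
  apply: (big_ind im) => // [|i _]; first by exists 0; rewrite rmorph0.
  rewrite rmorphM exprSr mulrACA; apply: imM; first exact: IH (ha' i).
  exact: imxT.
have /choice[p hp] : forall k, exists p, th p = b%:P * 'X^k.
  by move=> k; apply: imT (hb k).
(* The relation expresses b T^N through the b T^i with i < N. In degree N the multiplier of [b] is a
   sum of coefficients of degree N - i > 0 in the Rees algebra, and [eps] kills those. *)
have [N [c E]] := @noetherian_mpoly K (n + n) p.
have := congr1 (fun q => (th q)`_N) E; rewrite hp coefCM coefXn eqxx mulr1.
rewrite rmorph_sum coef_sum => E2.
exists (\sum_(i < N) (th (c i))`_(N - i)); split; last first.
  rewrite {1}E2 mulr_suml; apply: eq_bigr => i _.
  rewrite rmorphM hp mulrCA coefCM coefMXn ltnNge ltnW //=.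
  by rewrite mulrC.
have good q j : (0 < j)%N -> eps ((th q)`_j) = 0.
  suff [d hd] : exists d, map_poly eps (th q) = d%:P.
    by rewrite -coef_map hd coefC => /gtn_eqF ->.
  apply: (generated_ind (P := fun t => exists d, map_poly eps t = d%:P)) =>
    [d|i|a a' [d hd] [d' hd']|a a' [d hd] [d' hd']].
  - by exists (eps (str A d)); rewrite /= map_polyC.
  - rewrite /z; case: (split i) => k.
      by exists (eps (x k)); rewrite map_polyC.
    by exists 0; rewrite rmorphM /= map_polyC /= eps_x mul0r.
  - by exists (d + d'); rewrite rmorphD /= hd hd' polyCD.
  - by exists (d * d'); rewrite rmorphM /= hd hd' polyCM.
rewrite rmorph_sum big1 // => i _; apply: good.
by rewrite subn_gt0.
Qed.

(** Each [b] is killed by some 1 - e with eps(e) = 0. If no finite product of these killed the whole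
    ideal, one could choose a sequence in which the product for the earlier terms never kills the
    next, against [alg_noetherian]. *)
Lemma minf_annihilator : exists s, eps s = 1 /\ forall b, minf b -> s * b = 0.
Proof.
apply: contrapT => no.
have /choice[e he] : forall b, exists e, minf b -> eps e = 0 /\ b = e * b.
  move=> b; have [/krull[e he]|nb] := pselect (minf b); first by exists e.
  by exists 0 => /nb.
pose s (l : seq A) := \prod_(b <- l) (1 - e b).
pose P (l : seq A) b := (forall b', b' \in l -> minf b') -> minf b /\ s l * b <> 0.
have [l|h hP] := @dependent_sequence A P.
  have [lm|] := pselect (forall b', b' \in l -> minf b'); last by exists 0.
  apply: contrapT => nob; apply: no; exists (s l); split.
    rewrite rmorph_prod big1_seq // => b /lm hb; have [e0 _] := he b hb.
    by rewrite rmorphB rmorph1 e0 subr0.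
  move=> b hb; apply: contrapT => sb; apply: nob; exists b => _.
  by split.
have hm k : minf (h k).
  have [m] := ubnP k; elim: m k => // m IH k km.
  have [|//] := hP k => q /mapP[i]; rewrite mem_iota /= => ki ->; apply: IH.
  exact: leq_trans ki km.
have hs k : s [seq h i | i <- iota 0 k] * h k <> 0.
  by have [|//] := hP k => q /mapP[i _ ->].
have [N [c E]] := alg_noetherian h; apply: (hs N).
rewrite E mulr_sumr big1 // => i _; rewrite mulrCA.
have [_ hE] := he _ (hm i); have e0 : (1 - e (h i)) * h i = 0 by rewrite mulrBl mul1r -hE subrr.
rewrite /s (big_rem (h i)) /=; last first.
  by apply/mapP; exists (nat_of_ord i) => //; rewrite mem_iota /=.
by rewrite mulrAC e0 mul0r mulr0.
Qed.
End MaximalIdealPowers.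

(** * Connected groups *)

Section ConnectedGroups.
Variables (K : fieldType) (G : affGrp K).
Local Notation A := (coord_ring G).
Hypothesis hft : finite_type A.
Variables (n : nat) (x : 'I_n -> A).
Hypothesis x_gen : forall a : A, exists p : {mpoly K[n]}, mmap (str A) x p = a.
Hypothesis eps_x : forall i, counit (x i) = 0.

Definition eps : algHom A (kself K) := ev (1%g : G (kself K)).

Section Filtration.
Variable T : tensor A A.
Local Notation i1 := (inl_t T).
Local Notation i2 := (inr_t T).

(** The N-th power of the ideal of the point (1, 1) of G x G, spelled out on pure tensors. *)
Definition tfil N (t : T) := exists s : seq (A * A),
  (forall p, p \in s -> exists e e', [/\ (N <= e + e')%N, mpow x e p.1 & mpow x e' p.2]) /\
  t = \sum_(p <- s) i1 p.1 * i2 p.2.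

Lemma tfil_add N t u : tfil N t -> tfil N u -> tfil N (t + u).
Proof.
move=> [s [hs ->]] [s' [hs' ->]]; exists (s ++ s'); split; last by rewrite big_cat.
by move=> p; rewrite mem_cat => /orP[/hs|/hs'].
Qed.

Lemma tfil0 N : tfil N 0.
Proof. by exists [::]; rewrite big_nil. Qed.

Lemma tfil_mul N N' t u : tfil N t -> tfil N' u -> tfil (N + N') (t * u).
Proof.
move=> [s [hs ->]] [s' [hs' ->]].
exists [seq (p.1 * q.1, p.2 * q.2) | p <- s, q <- s']; split.
  move=> _ /allpairsP[[p q] [/hs[e [e' [le pe pe']]] /hs'[d [d' [le' qd qd']]] ->]].
  exists (e + d)%N, (e' + d')%N; split; [|exact: mpowM|exact: mpowM].
  by rewrite addnACA leq_add.
rewrite big_distrlr big_allpairs_dep /=; apply: eq_bigr => p _; apply: eq_bigr => q _.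
by rewrite !rmorphM mulrACA.
Qed.

(** Since 1 times 1 is 1, the coproduct maps the ideal of the identity into the ideal of (1, 1);
    powers follow by multiplicativity. *)
Lemma tfil_comul (g h : G T) N a : ev g =1 i1 -> ev h =1 i2 ->
  mpow x N a -> tfil N (ev (g * h)%g a).
Proof.
move=> hg hh.
have fil0 a' : tfil 0 (ev (g * h)%g a').
  have [s ->] := tens_gen (ev (g * h)%g a'); exists s; split=> // p _.
  by exists 0%N, 0%N.
have filx i : tfil 1 (ev (g * h)%g (x i)).
  have [r [b [e [_ [_ _ xE]]]]] := comul hft (x i).
  pose c (a : A) : A := str A (counit a).
  have m1 a' : mpow x 1 (a' - c a').
    apply/(mpow1P (eps := eps) x_gen eps_x); rewrite rmorphB /c alg_homE /=.
    by rewrite subrr.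
  (* Each factor is split into its value at 1 and the rest; the purely constant terms add up to the
     value of [x i] at 1, which is 0. *)
  have -> : ev (g * h)%g (x i) = \sum_(k < r) (i1 (b k - c (b k)) * i2 (e k) +
      i1 (c (b k)) * i2 (e k - c (e k))).
    have E0 : \sum_(k < r) i1 (c (b k)) * i2 (c (e k)) = 0.
      have E : \sum_(k < r) counit (b k) * counit (e k) = 0.
        by have := xE (kself K) 1%g 1%g; rewrite mulg1 => <-; apply: eps_x.
      transitivity (str T (\sum_(k < r) counit (b k) * counit (e k))).
        rewrite rmorph_sum; apply: eq_bigr => k _.
        by rewrite /c !alg_homE -rmorphM.
      by rewrite E rmorph0.
    transitivity (\sum_(k < r) ((i1 (b k - c (b k)) * i2 (e k) +
        i1 (c (b k)) * i2 (e k - c (e k))) + i1 (c (b k)) * i2 (c (e k)))); last first.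
      by rewrite [LHS]big_split /= [X in _ + X]E0 addr0.
    rewrite xE; apply: eq_bigr => k _.
    by rewrite hg hh !rmorphB mulrBl mulrBr addrA !subrK.
  apply: (big_ind (tfil 1)) => [||k _]; [exact: tfil0|exact: tfil_add|].
  apply: tfil_add.
    exists [:: (b k - c (b k), e k)]; rewrite big_seq1; split=> // p; rewrite inE => /eqP ->.
    by exists 1%N, 0%N; split=> //; apply: m1.
  exists [:: (c (b k), e k - c (e k))]; rewrite big_seq1; split=> // p; rewrite inE => /eqP ->.
  by exists 0%N, 1%N; split=> //; apply: m1.
elim: N a => // N IH a [b [hb ->]]; rewrite rmorph_sum.
apply: (big_ind (tfil N.+1)) => [||i _]; [exact: tfil0|exact: tfil_add|].
by rewrite rmorphM -addn1; apply: tfil_mul; [exact: IH (hb i)|exact: filx].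
Qed.
End Filtration.

(* Distributions at the identity (functionals killing a power of m) map the
   ideal of functions vanishing to infinite order into itself. *)
Lemma minf_contract (b : A) (phi : A -> K) N r (bl el : nat -> A) :
  minf x b -> functional phi -> (forall a, mpow x N a -> phi a = 0) ->
  (forall (R : alg K) (g h : G R), ev (g * h)%g b = \sum_(i < r) ev g (bl i) * ev h (el i)) ->
  minf x (\sum_(i < r) str A (phi (bl i)) * el i).
Proof.
move=> hb fphi phiN bE k; have [T] := @tensor_exists K A A hft.
have [g hg] := point_of (inl_t T); have [h hh] := point_of (inr_t T).
have [sl slB slE] := tens_lslice T fphi.
have [s [hs sE]] := tfil_comul hg hh (hb (N + k)%N).
have -> : \sum_(i < r) str A (phi (bl i)) * el i = sl (ev (g * h)%g b).
  rewrite bE (additive_sum _ _ _ slB); apply: eq_bigr => i _.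
  by rewrite hg hh slE.
rewrite sE (additive_sum _ _ _ slB) big_seq.
apply: (ideal_sum (mpow_ideal x k)) => p /hs[e [e' [le pe pe']]].
(* The order N + k serves both cases: either the left factor has order at least N and [phi] kills
   it, or the right factor has order at least k. *)
rewrite slE; have [eN|Ne] := leqP N e.
  by rewrite phiN ?rmorph0 ?mul0r; [case: (mpow_ideal x k)|apply: mpow_le pe].
apply: (ideal_mull (mpow_ideal x k)); apply: mpow_le pe'.
by rewrite -(leq_add2l N); apply: leq_trans le _; rewrite leq_add2r ltnW.
Qed.

(** Translation by a point of the closed subscheme of J = [minf x] preserves J. If a slice were
    outside m^N, a functional killing m^N would be 1 on it; by [minf_contract] the contraction of
    [b] lies in J, so [p] kills it, a contradiction. *)
Lemma minf_slice (C : alg K) (T : tensor A C) (g h : G T) (p : algHom A C) b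
    (psi : C -> K) (sl : T -> A) :
  minf x b -> ev g =1 inl_t T -> (forall a, ev h a = inr_t T (p a)) ->
  (forall a, minf x a -> p a = 0) -> functional psi ->
  {morph sl : x y / x - y} ->
  (forall a c, sl (inl_t T a * inr_t T c) = str A (psi c) * a) ->
  minf x (sl (ev (g * h)%g b)).
Proof.
move=> hb hg hh pJ fpsi slB slE N; apply: contrapT => nN.
have [phi [fphi phiN phi1]] :=
  functional_separation (ideal_subspace (mpow_ideal x N)) nN.
have [r [bl [el [_ [_ _ bE]]]]] := comul hft b.
have := minf_contract hb fphi phiN bE; move/pJ; move: phi1.
rewrite bE (additive_sum _ _ _ slB) fnl_sum // => phi1 /(congr1 psi).
rewrite fnl0 // rmorph_sum fnl_sum // => E; move: phi1.
rewrite (eq_bigr (fun i : 'I_r => psi (p (str A (phi (bl i)) * el i)))); last first.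
  by move=> i _; rewrite hg hh slE !fnlZ // rmorphM alg_homE fnlZ // mulrC.
by rewrite E => /esym/eqP; rewrite oner_eq0.
Qed.

Definition annJ (s : A) := forall b, minf x b -> s * b = 0.

Lemma annJ_ideal : ideal_pred annJ.
Proof.
split=> [b _|a s t hs ht b hb]; first by rewrite mul0r.
by rewrite mulrDl -mulrA hs // ht // mulr0 addr0.
Qed.

(* Translating a function s with s(1) = 1 that kills J by the points of the
   closed subgroup defined by J shows that its annihilator and J are comaximal. *)
Lemma minf_comaximal : exists s j, [/\ annJ s, minf x j & s + j = 1].
Proof.
apply: contrapT => no.
pose I a := exists s j, [/\ annJ s, minf x j & a = s + j].
have hI : ideal_pred I.
  split=> [|a u v [s [j [hs hj ->]]] [s' [j' [hs' hj' ->]]]].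
    by exists 0, 0; rewrite addr0; split=> //; [case: annJ_ideal|case: (minf_ideal x)].
  have [_ hA] := annJ_ideal; have [_ hJ] := minf_ideal x.
  exists (a * s + s'), (a * j + j'); split; [exact: hA|exact: hJ|].
  by rewrite mulrDr addrACA.
have nI1 : ~ I 1 by move=> [s [j [hs hj E]]]; apply: no; exists s, j.
(* If the sum of J and its annihilator were proper, the quotient by it would carry a point [p] of G
   that kills both. *)
have [Q [pr [prs pr0]]] := quotient_ring hI nI1.
pose C : alg K := @Alg K Q (pr \o str A).
pose p : algHom A C := @AlgHom K A C pr (fun=> erefl).
have pJ a : minf x a -> p a = 0.
  by move=> ha; apply/pr0; exists 0, a; rewrite add0r; split=> //; case: annJ_ideal.
have pS a : annJ a -> p a = 0.
  by move=> ha; apply/pr0; exists a, 0; rewrite addr0; split=> //; case: (minf_ideal x).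
have [s [s1 sJ]] := minf_annihilator (eps := eps) x_gen eps_x.
have [T] := @tensor_exists K A C hft.
have [gx hx] := point_of (inl_t T); have [gp hp] := point_of p.
pose pT := fmap G (inr_t T) gp.
have hpT a : ev pT a = inr_t T (p a) by rewrite ev_nat /= hp.
pose tau := ev (gx * pT^-1)%g.
have [t' [t'l t'r]] := tens_univ T tau (inr_t T).
have t'x : fmap G t' gx = (gx * pT^-1)%g.
  by apply: ev_inj => a; rewrite ev_nat /= hx t'l.
have t'p : fmap G t' pT = pT.
  by apply: ev_inj => a; rewrite ev_nat /= hpT t'r.
(* Substituting x p^-1 for x in the product of [s] with b(x p): the latter has its slices in J, so
   [s] kills it. Hence the translate of [s] kills J as well. *)
have tausJ b : minf x b -> tau s * inl_t T b = 0.
  move=> hb; pose beta := ev (gx * pT)%g b.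
  have -> : inl_t T b = t' beta.
    by rewrite /beta -evM_nat t'x t'p mulgVK hx.
  rewrite -t'l -rmorphM.
  suff -> : inl_t T s * beta = 0 by rewrite rmorph0.
  have [d [e [psi [a [fpsi dual bE slb]]]]] := tens_expand beta.
  rewrite bE mulr_sumr big1 // => i _; rewrite mulrA -rmorphM.
  have [sl slB slE] := tens_slice T (fpsi i).
  rewrite -(slb i sl slB slE) sJ ?rmorph0 ?mul0r //.
  exact: minf_slice hb hx hpT pJ (fpsi i) slB slE.
have [d [e [psi [a [fpsi dual tE _]]]]] := tens_expand (tau s : T).
have aS i : (i < d)%N -> annJ (a i).
  move=> id b hb; have [sl slB slE] := tens_slice T (fpsi i).
  have := congr1 sl (tausJ b hb); rewrite tE mulr_suml (additive_sum _ _ _ slB).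
  rewrite (eq_bigr (fun k : 'I_d => str A (psi i (e k)) * (a k * b))); last first.
    by move=> k _; rewrite mulrAC -rmorphM slE.
  rewrite (bigD1 (Ordinal id)) //= dual // eqxx rmorph1 mul1r big1 ?addr0.
    by move=> ->; rewrite -(subrr 0) slB subrr.
  by move=> k ki; rewrite dual // eq_sym (negPf ki : (k == i :> nat) = false) rmorph0 mul0r.
(* At x = p the translate of [s] takes the value s(1) = 1, whereas its coefficients annihilate J and
   therefore vanish at [p]. *)
have [h [hl hr]] := tens_univ T p (id_alg C).
have : h (tau s) = 1.
  rewrite /tau -evM_nat; have -> : fmap G h gx = gp.
    by apply: ev_inj => c; rewrite ev_nat /= hx hl hp.
  rewrite fmapV; have -> : fmap G h pT = gp.
    by apply: ev_inj => c; rewrite ev_nat /= hpT hr hp.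
  by rewrite mulgV ev1 -[counit s]/(eps s) s1 rmorph1.
rewrite tE rmorph_sum big1 => [/eqP|i _]; first by rewrite eq_sym oner_eq0.
by rewrite rmorphM hl pS ?mul0r //; apply: aS.
Qed.

(** As s + j = 1 and ann(J) J = 0, the sets V(ann J) and V(J) partition the spectrum. The identity
    is outside V(ann J), since a function with value 1 there kills J. So V(J) is everything, s = 1 -
    j lies in no prime ideal and is a unit, and sJ = 0 gives J = 0. *)
Lemma connected_minf0 : connected_spec A -> forall b, minf x b -> b = 0.
Proof.
move=> conn; have [s [j [hs hj sj1]]] := minf_comaximal.
pose pI : {pred A} := fun a => `[< annJ a >]; pose pJ : {pred A} := fun a => `[< minf x a >].
have idealP (p : {pred A}) : prime_ideal p -> forall a u, u \in p -> a * u \in p.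
  by move=> [[p0 p1 pl] _] a u up; have := pl a u 0 up p0; rewrite addr0.
have [p hp|p hp [h1 h2]|all1|all2] := conn pI pJ.
- have [pj|npj] := pselect (in_V pJ p); [by right|left] => a /asboolP ha.
  have [b [hb nb]] : exists b, minf x b /\ b \notin p.
    apply: contrapT => no; apply: npj => b /asboolP hb; apply/negPn/negP => nb.
    by apply: no; exists b.
  have [[p0 _ _] pr] := hp; have := pr a b; rewrite ha // => /(_ p0).
  by rewrite (negPf nb) orbF.
- have [[p0 p1 pl] _] := hp; case/negP: p1; rewrite -sj1 -[s]mul1r; apply: pl.
    by apply: h1; apply/asboolP.
  by apply: h2; apply/asboolP.
- pose kp : {pred A} := fun a => eps a == 0.
  have inK a : (a \in kp) = (eps a == 0) by [].
  have ker : prime_ideal kp.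
    split; first split; rewrite ?inK ?rmorph0 ?rmorph1 ?oner_eq0 //.
      by move=> a u v; rewrite !inK rmorphD rmorphM => /eqP-> /eqP->; rewrite mulr0 addr0.
    by move=> u v; rewrite !inK rmorphM mulf_eq0.
  have [s' [s1 sJ]] := minf_annihilator (eps := eps) x_gen eps_x.
  have : s' \in kp by apply: (all1 kp ker); apply/asboolP.
  by rewrite inK s1 oner_eq0.
move=> b hb; apply: contrapT => b0.
(* otherwise s generates a proper ideal, hence lies in a prime avoiding j *)
pose I a := exists u, a = u * s.
have hI : ideal_pred I.
  split=> [|a u v [u' ->] [v' ->]]; first by exists 0; rewrite mul0r.
  by exists (a * u' + v'); rewrite mulrDl mulrA.
have nI1 : ~ I 1.
  by move=> [u us]; apply: b0; rewrite -[b]mul1r us -mulrA hs // mulr0.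
have [J [hJ nJ1 IJ maxJ]] := maximal_ideal_above hI nI1.
pose p : {pred A} := fun a => `[< J a >].
have pp : prime_ideal p.
  split; first split.
  - by apply/asboolP; case: hJ.
  - by apply/negP => /asboolP.
  - move=> a u v /asboolP hu /asboolP hv; apply/asboolP.
    by case: hJ => _; apply.
  - move=> u v /asboolP uv; apply/orP.
    have [hu|nu] := pselect (J u); first by left; apply/asboolP.
    right; apply/asboolP; have [a ha] := maxJ u nu.
    have -> : v = v * (1 - a * u) + a * (u * v).
      by rewrite [a * (u * v)]mulrA [_ * v]mulrC mulrBr mulr1 subrK.
    by apply: (idealD hJ); apply: (ideal_mull hJ).
apply: nJ1; rewrite -sj1; apply: (idealD hJ); first by apply: IJ; exists 1; rewrite mul1r.
by have /asboolP : j \in p by apply: (all2 p pp); apply/asboolP.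
Qed.
End ConnectedGroups.

(** * The formal point of a smooth group *)

Section TruncatedSeries.
Variable P : comNzRingType.
Local Notation S := (pseries P).

Definition eqm k (f g : S) := forall i, (i < k)%N -> cf f i = cf g i.

Lemma eqmM k f f' g g' : eqm k f f' -> eqm k g g' -> eqm k (f * g) (f' * g').
Proof.
move=> ff gg i ik; rewrite !cfM; apply: eq_bigr => j _.
have ji : (j <= i)%N by rewrite -ltnS.
by rewrite ff ?(leq_ltn_trans ji) // gg // (leq_ltn_trans (leq_subr _ _) ik).
Qed.

Lemma eqm_ideal k : ideal_pred (eqm k 0).
Proof.
split=> // a f g hf hg i ik; rewrite cfD -hg // cf0 addr0.
have := eqmM (fun j _ => erefl : cf a j = cf a j) hf ik.
by rewrite mulr0 cf0.
Qed.

Lemma eqm_sub k f g : eqm k f g <-> eqm k 0 (f - g).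
Proof.
split=> h i ik; first by rewrite cfB h // subrr cf0.
by apply/eqP; rewrite -subr_eq0 -cfB -h // cf0.
Qed.

Lemma eqm_square0 k f g : (0 < k)%N -> eqm k 0 f -> eqm k 0 g -> eqm k.+1 0 (f * g).
Proof.
move=> k0 hf hg i; rewrite ltnS => ik; rewrite cf0 cfM big1 // => j _.
have [jk|kj] := ltnP j k; first by rewrite -hf // cf0 mul0r.
rewrite -[cf g _]hg ?cf0 ?mulr0 //; apply: leq_ltn_trans k0.
by rewrite leq_subLR addn0 (leq_trans ik).
Qed.
End TruncatedSeries.

Section FormalPoint.
Variables (K : fieldType) (A : alg K) (eps : algHom A (kself K)).
Variables (n : nat) (x : 'I_n -> A).
Hypothesis x_gen : forall a : A, exists p : {mpoly K[n]}, mmap (str A) x p = a.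
Hypothesis eps_x : forall i, eps (x i) = 0.
Hypothesis smooth_A : formally_smooth A.

Section Lifting.
Variable d : nat.
Local Notation P := {mpoly K[d]}.
Local Notation S := (pseries P).
Local Notation cst c := (psC P (c%:MP_[d] : P)).

(** A homomorphism into series modulo s^k, given by representatives, so that the lifts for all k
    have the same type. *)
Definition hom_mod k (th : A -> S) :=
  [/\ forall a b, eqm k (th (a + b)) (th a + th b),
      forall a b, eqm k (th (a * b)) (th a * th b) &
      forall c, eqm k (th (str A c)) (cst c)].

(** Formal smoothness for the reduction from precision k+1 to precision k, whose kernel has square
    zero as 2k >= k+1. *)
Lemma hom_mod_lift k th : (0 < k)%N -> hom_mod k th ->
  exists th', hom_mod k.+1 th' /\ forall a, eqm k (th' a) (th a).
Proof.
move=> k0 [thD thM thC].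
have n1 m : (0 < m)%N -> ~ eqm m 0 (1 : S).
  by move=> m0 /(_ 0%N m0)/eqP; rewrite eq_sym oner_eq0.
have [Q [p [ps p0]]] := quotient_ring (eqm_ideal P k) (n1 k k0).
have [Q' [p' [ps' p0']]] := quotient_ring (eqm_ideal P k.+1) (n1 k.+1 (ltn0Sn k)).
have pE f g : p f = p g <-> eqm k f g.
  rewrite eqm_sub -p0 rmorphB; split=> [->|/eqP]; first by rewrite subrr.
  by rewrite subr_eq0 => /eqP.
have pE' f g : p' f = p' g <-> eqm k.+1 f g.
  rewrite eqm_sub -p0' rmorphB; split=> [->|/eqP]; first by rewrite subrr.
  by rewrite subr_eq0 => /eqP.
have [lft lftK] := choice ps'.
pose u q := p (lft q).
have uE f : u (p' f) = p f.
  by apply/pE => i ik; apply: (pE' _ _).1 (lftK _) _ _; rewrite ltnS ltnW.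
have uB : {morph u : q r / q - r}.
  by move=> q r; rewrite -[q]lftK -[r]lftK -rmorphB !uE rmorphB.
have uM : {morph u : q r / q * r}.
  by move=> q r; rewrite -[q]lftK -[r]lftK -rmorphM !uE rmorphM.
have u1 : u 1 = 1 by rewrite -(rmorph1 p') uE rmorph1.
pose C : {rmorphism K -> S} := psC P \o @mpolyC d K.
pose R := @Alg K Q' (p' \o C); pose R' := @Alg K Q (p \o C).
pose U : algHom R R' := @AlgHom K R R' (mk_rmorphism uB uM u1) (fun c => uE _).
have U_surj y : exists z : R, U z = y.
  by have [f <-] := ps y; exists (p' f); apply: uE.
have U_sq (y z : R) : U y = 0 -> U z = 0 -> y * z = 0.
  rewrite -[y]lftK -[z]lftK -(rmorphM p') => hy hz; rewrite -(rmorph0 p'); apply/esym/pE'.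
  apply: eqm_square0 => //; apply/p0.
    by rewrite -uE.
  by rewrite -uE.
pose f a := p (th a).
have f_D a b : f (a + b) = f a + f b by rewrite /f -rmorphD; apply/pE/thD.
have f_M : {morph f : a b / a * b} by move=> a b; rewrite /f -rmorphM; apply/pE/thM.
have f_C c : f (str A c) = str R' c by apply/pE/thC.
have f1 : f 1 = 1 by rewrite -(rmorph1 (str A)) f_C rmorph1.
have fB : {morph f : a b / a - b}.
  by move=> a b; apply: (addIr (f b)); rewrite -f_D !subrK.
pose ff : algHom A R' := @AlgHom K A R' (mk_rmorphism fB f_M f1) f_C.
have [g hg] := smooth_A U_surj U_sq ff.
have pg a : p' (lft (g a)) = g a by apply: lftK.
exists (fun a => lft (g a)); split; first split.
- by move=> a b; apply/pE'; rewrite pg (rmorphD p') !pg rmorphD.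
- by move=> a b; apply/pE'; rewrite pg (rmorphM p') !pg rmorphM.
- by move=> c; apply/pE'; rewrite pg alg_homE.
- by move=> a; apply/pE; rewrite -[RHS]hg.
Qed.

Lemma hom_mod_limit th0 : hom_mod 2 th0 -> exists ga : algHom A (ps_alg (mp_alg d (kself K))),
  forall a, eqm 2 (ga a) (th0 a).
Proof.
move=> h0; have /choice[F hF] : forall kth : nat * (A -> S), exists th',
    hom_mod kth.1.+2 kth.2 -> hom_mod kth.1.+3 th' /\ forall a, eqm kth.1.+2 (th' a) (kth.2 a).
  move=> [k th] /=; have [h|nh] := pselect (hom_mod k.+2 th); last by exists th.
  by have [//|th' ?] := hom_mod_lift _ h; exists th'.
(* [th k] is a homomorphism modulo s^(k+2), so coefficient i no longer changes from [th i] on and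
   the limit can be read diagonally. *)
pose th := nat_rect (fun=> A -> S) th0 (fun k t => F (k, t)).
have hth k : hom_mod k.+2 (th k).
  by elim: k => // k IH; have [] := hF (k, th k) IH.
have stab k a i j : (i <= k)%N -> (j <= i.+1)%N -> cf (th k a) j = cf (th i a) j.
  move=> ik ji; rewrite -(subnK ik); elim: (k - i)%N => // m IH.
  rewrite -IH addSn; have [_ ] := hF ((m + i)%N, th (m + i)%N) (hth _); apply=> /=.
  by rewrite ltnS (leq_trans ji) // ltnS leq_addl.
pose ga a : S := Pseries (fun i => cf (th i a) i).
have gaE k a i : (i <= k)%N -> cf (ga a) i = cf (th k a) i.
  by move=> ik; rewrite (stab k a i).
have gaD a b : ga (a + b) = ga a + ga b.
  apply: psP => i; rewrite (gaE i) // cfD !(gaE i) //.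
  by have [h _ _] := hth i; rewrite h // ltnS.
have gaM : {morph ga : a b / a * b}.
  move=> a b; apply: psP => i; rewrite (gaE i) //.
  have [_ h _] := hth i; rewrite h ?ltnS // !cfM; apply: eq_bigr => j _.
  by rewrite !(gaE i) ?leq_subr // -ltnS.
have gaC c : ga (str A c) = cst c.
  by apply: psP => i; rewrite (gaE i) //; have [_ _ h] := hth i; rewrite h // ltnS.
have ga1 : ga 1 = 1 by rewrite -(rmorph1 (str A)) gaC !rmorph1.
have gaB : {morph ga : a b / a - b}.
  by move=> a b; apply: (addIr (ga b)); rewrite -gaD !subrK.
exists (@AlgHom K A (ps_alg (mp_alg d (kself K))) (mk_rmorphism gaB gaM ga1) gaC).
move=> a [|[|i]] // _; exact: (stab 1%N a 0%N 1%N).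
Qed.
End Lifting.

Lemma formal_point : exists (d : nat) (ga : algHom A (comp_fam (mp_fam K d) (ps_fam K) (kself K))),
  (forall a, faug (comp_fam (mp_fam K d) (ps_fam K)) (kself K) (ga a) = eps a) /\
  forall a, ga a = 0 -> minf x a.
Proof.
have h2 := mpow_ideal x 2.
(* The [y j] represent a basis of m/m^2. The dual functionals kill m^2, so the [D j] below are the
   corresponding derivations at the identity. *)
have [d [y [phi [fphi phi2 _ _ ex]]]] :=
  dual_family [seq x i | i <- enum 'I_n] (ideal_subspace h2).
pose e a := str A (eps a); pose D j a := phi j (a - e a).
have m1 a : mpow x 1 (a - e a).
  by apply/(mpow1P (eps := eps) x_gen eps_x); rewrite rmorphB /e alg_homE /= subrr.
have DD j a b : D j (a + b) = D j a + D j b.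
  by rewrite /D /e !rmorphD opprD addrACA fnlD.
have DM j a b : D j (a * b) = eps a * D j b + D j a * eps b.
  have -> : D j (a * b) = phi j ((a - e a) * (b - e b) +
      (str A (eps a) * (b - e b) + str A (eps b) * (a - e a))).
    have gen (p q p' q' : A) : p * q - p' * q' =
        (p - p') * (q - q') + (p' * (q - q') + q' * (p - p')).
      by ring.
    by rewrite /D /e !rmorphM gen.
  rewrite fnlD // phi2 ?add0r; last exact: (mpowM (k := 1) (l := 1)).
  by rewrite fnlD // !(fnlZ (fphi j)); congr (_ + _); apply: mulrC.
have Dc j c : D j (str A c) = 0.
  by rewrite /D /e alg_homE /= subrr fnl0.
(* The generic tangent vector: eps + s sum_j lambda_j D_j, a homomorphism modulo s^2. *)
pose th (a : A) : pseries {mpoly K[d]} := Pseries (fun i =>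
  if i is i'.+1 then (if i' is 0 then \sum_(j < d) D j a *: 'X_j else 0) else (eps a)%:MP).
have hth : hom_mod 2 th.
  split.
  - move=> a b [|[|//]] _ /=; first by rewrite rmorphD /= mpolyCD.
    by rewrite -big_split; apply: eq_bigr => j _; rewrite DD scalerDl.
  - move=> a b [|[|//]] _; rewrite cfM.
      by rewrite big_ord1 /= rmorphM /= mpolyCM.
    rewrite 2!big_ord_recl big_ord0 /= addr0 mulr_sumr mulr_suml -big_split /=.
    apply: eq_bigr => j _; rewrite DM scalerDl mul_mpolyC scalerA; congr (_ + _).
    by rewrite [RHS]mulrC mul_mpolyC scalerA; congr (_ *: _); apply: mulrC.
  - move=> c [|[|//]] _ /=; first by rewrite alg_homE.
    by apply: big1 => j _; rewrite Dc scale0r.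
have [ga hga] := hom_mod_limit hth; exists d, ga; split=> [a|a ga0].
  by rewrite /= /ps_eval0 hga //= mcoeffC eqxx mulr1.
have ga_x0 i : cf (ga (x i)) 0 = 0 by rewrite hga //= eps_x.
(* Replacing lambda_j by [y j] turns the coefficient of s^k back into a function on G. *)
pose my := mmap (str A) (fun j : 'I_d => y j).
have ga_x1 i : mpow x 2 (x i - my (cf (ga (x i)) 1%N)).
  rewrite hga //= /my; have -> : mmap (str A) (fun j : 'I_d => y j)
      (\sum_(j < d) D j (x i) *: 'X_j) = \sum_(j < d) str A (phi j (x i)) * y j.
    rewrite (rmorph_sum (mmap (str A) (fun j : 'I_d => y j))) /=; apply: eq_bigr => j _.
    by rewrite mmapZ mmapX mmap1U /D /e eps_x rmorph0 subr0.
  by apply: ex; apply: map_f; rewrite mem_enum.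
(* For [b] in m^k the coefficient of s^k determines [b] modulo m^(k+1). A function killed by [ga]
   therefore climbs through all powers of m. *)
have lead k b : mpow x k b -> (forall i, (i < k)%N -> cf (ga b) i = 0) /\
    mpow x k.+1 (b - my (cf (ga b) k)).
  elim: k b => [|k IH] b hb.
    split=> //; rewrite hga //= /my mmapC; exact: m1.
  have [c [hc ->]] := hb.
  have low i l : (l <= k)%N -> cf (ga (c i * x i)) l = 0.
    move=> lk; rewrite rmorphM cfM big1 // => j _.
    have [jk|kj] := ltnP j k; first by rewrite (IH _ (hc i)).1 // mul0r.
    have -> : (l - j = 0)%N by apply/eqP; rewrite subn_eq0 (leq_trans lk).
    by rewrite ga_x0 mulr0.
  have top i : cf (ga (c i * x i)) k.+1 = cf (ga (c i)) k * cf (ga (x i)) 1.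
    rewrite rmorphM cfM big_ord_recr big_ord_recr /= subnn ga_x0 mulr0 addr0 subSnn.
    by rewrite big1 ?add0r // => j _; rewrite (IH _ (hc i)).1 ?mul0r.
  split=> [l lk|].
    by rewrite rmorph_sum cf_sum big1 // => i _; apply: low; rewrite -ltnS.
  rewrite rmorph_sum cf_sum /my (rmorph_sum (mmap (str A) (fun j : 'I_d => y j))) -sumrB.
  apply: (ideal_sum (mpow_ideal x k.+2)) => i _; rewrite -/my top rmorphM /=.
  rewrite -!/(my _); set u := my _; set v := my _.
  have hu : mpow x k.+1 (c i - u) := (IH _ (hc i)).2.
  have hv : mpow x 2 (x i - v) := ga_x1 i.
  have -> : c i * x i - u * v = c i * (x i - v) + (c i - u) * x i - (c i - u) * (x i - v).
    by ring.
  apply: (idealB (mpow_ideal x k.+2)).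
    apply: (idealD (mpow_ideal x k.+2)); last exact: mpow_x.
    by rewrite -addn2; apply: mpowM (hc i) hv.
  by apply: (mpow_le (l := k.+1 + 2)); [rewrite addn2 ltnW | apply: mpowM hu hv].
move=> k; elim: k => // k IH; have [_] := lead k a IH.
by rewrite ga0 cf0 /my rmorph0 subr0.
Qed.
End FormalPoint.

(** * The theorem *)

Lemma centered_generators (K : fieldType) (A : alg K) (eps : algHom A (kself K)) :
  finite_type A -> exists (n : nat) (x : 'I_n -> A),
    (forall a, exists p : {mpoly K[n]}, mmap (str A) x p = a) /\ forall i, eps (x i) = 0.
Proof.
move=> [n [x gen]]; pose x' i := x i - str A (eps (x i)).
exists n, x'; split=> [a|i]; last by rewrite rmorphB alg_homE /= subrr.
have [p <-] := gen a.
apply: (generated_ind (P := fun b => exists q : {mpoly K[n]}, mmap (str A) x' q = b)).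
- by move=> c; exists c%:MP; rewrite mmapC.
- move=> i; exists ('X_i + (eps (x i))%:MP); rewrite mmapD mmapX mmap1U mmapC.
  by rewrite subrK.
- by move=> b b' [q <-] [q' <-]; exists (q + q'); rewrite mmapD.
- by move=> b b' [q <-] [q' <-]; exists (q * q'); rewrite rmorphM.
Qed.

Theorem theorem1p7 (K : fieldType) (G : affGrp K)
  (hft : finite_type (coord_ring G))
  (hG : commutative_grp G \/
        [/\ smooth (coord_ring G), solvable_grp G & connected_spec (coord_ring G)]) :
  locally_trigonalizable G.
Proof.
apply: (locally_trigonalizable_of_lines hft) => r c chi fchi dual.
case: hG => [commG|[[_ smoothG] solvG connG]].
  exact (commutative_stable_line hft fchi dual commG).
have [n [x [x_gen eps_x]]] := centered_generators (eps G) hft.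
have [d [ga [ga_aug ga_minf]]] := formal_point x_gen eps_x smoothG.
apply: (solvable_stable_line fchi dual _ ga_aug solvG) => a /ga_minf.
exact: (connected_minf0 hft x_gen eps_x connG).
Qed.
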